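(* Let $n\ge2$. For $W$ of type $\widetilde{C}_n$ (resp. $\widetilde{B}_{n+1}$, resp. $\widetilde{D}_{n+2}$), the mean value $\mu_W$ of the growth sequence of fully commutative elements is $$2n+\frac{4^n}{n+1}\qquad\left(\text{resp. } 2n+3+\frac{1}{2n+1}+\frac{2\cdot4^n}{n+1},\quad\text{resp. } 2n+6+\frac{2+4^{n+1}}{n+1}\right).$$
   Context: An element of a Coxeter group is fully commutative (FC) if any of its reduced expressions can be obtained from any other one using only commutation relations. The growth sequence is $(a_\ell)_{\ell\ge0}$ with $a_\ell$ the number of FC elements of Coxeter length $\ell$; in the types considered it is ultimately periodic, and its mean value $\mu_W$ is the arithmetic mean of its values over a period (in the periodic part), equivalently the limit of the arithmetic means of its first $k$ values as $k\to\infty$. Coxeter graphs (unlabeled edges have $m=3$; non-adjacent vertices commute): $\widetilde{C}_n$: path $t,s_1,\dots,s_{n-1},u$ with $m_{ts_1}=m_{s_{n-1}u}=4$. $\widetilde{B}_{n+1}$: path $s_1,\dots,s_{n-1},u$ with $m_{s_{n-1}u}=4$, and two further vertices $t_1,t_2$ each adjacent to $s_1$ only. $\widetilde{D}_{n+2}$: path $s_1,\dots,s_{n-1}$, with further vertices $t_1,t_2$ each adjacent to $s_1$ only and $u_1,u_2$ each adjacent to $s_{n-1}$ only. *)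

(* Defs.v *)
From Stdlib Require Import Relation_Operators.
From HB Require Import structures.
From mathcomp Require Import all_boot all_order all_algebra finmap.
From mathcomp Require Import boolp classical_sets cardinality.

Set Implicit Arguments.
Unset Strict Implicit.
Unset Printing Implicit Defensive.

Local Open Scope classical_set_scope.
Local Open Scope group_scope.

Definition evalw (I : finType) (W : groupType) (s : I -> W) (r : seq I) : W :=
  \prod_(i <- r) s i.

(* W is the group with generators s i and presentation
   (s i * s j) ^+ m i j = 1; since x ^+ 0 = 1, a value m i j = 0 encodes the
   absence of a relation (m i j = oo).  As m i i = 1 makes the generators
   involutions, being generated by the s i is the same as every element being
   a product of them. *)
Definition coxeter_system (I : finType) (m : I -> I -> nat)
    (W : groupType) (s : I -> W) : Prop :=
  [/\ forall w : W, exists r : seq I, evalw s r = w,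
      forall i j : I, (s i * s j) ^+ m i j = 1
    & forall (G : groupType) (f : I -> G),
        (forall i j : I, (f i * f j) ^+ m i j = 1) ->
        exists phi : {multiplicative W -> G}, forall i : I, phi (s i) = f i].

Definition reduced_expr (I : finType) (W : groupType) (s : I -> W)
    (w : W) (r : seq I) : Prop :=
  evalw s r = w /\ forall r' : seq I, evalw s r' = w -> (size r <= size r')%N.

Definition has_length (I : finType) (W : groupType) (s : I -> W)
    (w : W) (l : nat) : Prop :=
  exists2 r : seq I, reduced_expr s w r & size r = l.

Inductive commutation (I : finType) (m : I -> I -> nat) :
    seq I -> seq I -> Prop :=
  Commutation (r1 r2 : seq I) (i j : I) of m i j = 2 :
    commutation m (r1 ++ [:: i; j] ++ r2) (r1 ++ [:: j; i] ++ r2).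

Definition fully_commutative (I : finType) (m : I -> I -> nat)
    (W : groupType) (s : I -> W) (w : W) : Prop :=
  forall r r' : seq I, reduced_expr s w r -> reduced_expr s w r' ->
    clos_refl_sym_trans (seq I) (commutation m) r r'.

(* The set below is finite (there are finitely many words of length l), so
   the value of fset_set on infinite sets is irrelevant. *)
Definition fc_growth (I : finType) (m : I -> I -> nat)
    (W : groupType) (s : I -> W) (l : nat) : nat :=
  #|` fset_set [set w : W | fully_commutative m s w /\ has_length s w l]|.

(* mu does not depend on the choice of the period p and of the bound N. *)
Definition has_mean_value (a : nat -> nat) (mu : rat) : Prop :=
  exists N p : nat,
    [/\ (0 < p)%N,
        forall l : nat, (N <= l)%N -> a (l + p)%N = a l
      & mu = ((\sum_(N <= l < N + p) a l)%N%:R / p%:R)%R].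

(* Coxeter matrix of a graph given by e, which lists each edge in (at least)
   one direction with its label and takes the value 2 elsewhere. *)
Definition coxeter_matrix (I : finType) (e : I -> I -> nat) (x y : I) : nat :=
  if x == y then 1%N else maxn (e x y) (e y x).

(* In the three graphs below, inl i (with i < n - 1) is the vertex s_(i+1), so
   that s_1 is given by i = 0 and s_(n-1) by i + 2 = n. *)
Definition spath_edge n (i j : 'I_n.-1) : nat :=
  if i.+1 == j :> nat then 3 else 2.

(* inr false is t and inr true is u. *)
Definition vertexC n : finType := ('I_n.-1 + bool)%type.

Definition edgeC n (x y : vertexC n) : nat :=
  match x, y with
  | inl i, inl j => spath_edge i j
  | inr false, inl i => if i == 0 :> nat then 4 else 2
  | inl i, inr true => if i.+2 == n then 4 else 2
  | _, _ => 2
  end.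

(* inr (Some false) is t_1, inr (Some true) is t_2 and inr None is u. *)
Definition vertexB n : finType := ('I_n.-1 + option bool)%type.

Definition edgeB n (x y : vertexB n) : nat :=
  match x, y with
  | inl i, inl j => spath_edge i j
  | inr (Some _), inl i => if i == 0 :> nat then 3 else 2
  | inl i, inr None => if i.+2 == n then 4 else 2
  | _, _ => 2
  end.

(* inr (false, b) are t_1 and t_2, and inr (true, b) are u_1 and u_2. *)
Definition vertexD n : finType := ('I_n.-1 + bool * bool)%type.

Definition edgeD n (x y : vertexD n) : nat :=
  match x, y with
  | inl i, inl j => spath_edge i j
  | inr (false, _), inl i => if i == 0 :> nat then 3 else 2
  | inl i, inr (true, _) => if i.+2 == n then 3 else 2
  | _, _ => 2
  end.

Definition coxC n := coxeter_matrix (@edgeC n).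
Definition coxB n := coxeter_matrix (@edgeB n).
Definition coxD n := coxeter_matrix (@edgeD n).

(* Main.v *)
From Stdlib Require Import Relation_Operators.
From HB Require Import structures.
Require Import Defs.
From mathcomp Require Import finmap boolp classical_sets cardinality.
From mathcomp Require Import all_boot all_order all_algebra.
From mathcomp.algebra_tactics Require Import ring lra.
From mathcomp Require Import zify.

Set Implicit Arguments.
Unset Strict Implicit.
Unset Printing Implicit Defensive.

(** Write i j i ... for words in the generators and call two words equivalent if
they differ by commutations.

_From elements to words._  By the exchange condition any two reduced words of an
element are connected by braid moves (matsumoto).  It follows that the fully
commutative elements of length l correspond to the classes of words of size l in
which no word contains a square i i or the long side of a braid relation with
label at least 3 (fcw; fcw_fully_commutative, fully_commutative_fcw).  The exchange
condition comes from the usual action of the group on reflections with a sign, and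
the fact that the labels are the exact orders of the products of two generators
from an integral reflection representation.

_Ladders._  The three graphs have the same form: the generators sit in columns
0, ..., n, neighbouring columns are joined, inner columns have one letter and the
end columns e0 and en letters, one or two; the label is 4 exactly at an end column
with a single letter.  So t is replaced by the pair t_1, t_2, with both labels 3,
and u by u_1, u_2.  Everything is done for such a ladder.

_Classification._  A long word of the above kind falls into one of two families
(classify).  Either any two neighbouring columns alternate in it, and so do the two
letters of an end column (altw); or it is equivalent to a zigzag, a word that runs
back and forth along the ladder, visiting the end columns completely.  Indeed, if
the letter x of a column recurs with no letter of the left neighbouring column in
between, then the letters of the columns on the right must recur too, one inside
the other, up to the last column, which is completely visited: the word contains a
turn k, k + 1, ..., n, ..., k + 1, k (turn_atP), and the letters not on it commute
with x.  After a turn the word cannot go right again before it has been in column k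
(rturn_after).  Since a long word visits every column often, a deviation from
alternation thus produces a full run forth and back, one period of a zigzag
(core_right), and then each further letter on either side has to follow the zigzag:
any other letter would close a forbidden factor (zigzag_next).

_Counting._  In an alternating word the word formed by two neighbouring columns is
known from the numbers of letters and from which of the two columns comes first and
which comes last.  These 2 n bits determine the numbers of letters in the columns
up to a common summand, hence the length modulo n + 1, and all combinations occur;
with the first letters of the end columns this makes e0 en 4 ^ n classes in any
n + 1 consecutive lengths (alt_card).  A zigzag is given by the time at which it
enters the walk, of period P = 2 (n - 1) + e0 + en, and by its length, except that
a zigzag that enters an end column of two letters halfway has the choice between
the two letters, and likewise at its exit.  So there are P + (e0 - 1) + (en - 1)
ways to enter and as many to leave, and the square of this number is the number of
zigzags in any P consecutive lengths (zig_card_sum).  The two families are disjoint,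
hence the growth sequence has mean value
  e0 en 4 ^ n / (n + 1) + (P + e0 + en - 2) ^ 2 / P
(ladder_mean), which is evaluated for (e0, en) = (1, 1), (2, 1) and (2, 2). *)

(** * First and last letters with a given property *)

Lemma split_first (T : Type) (p : pred T) s : has p s ->
  exists s1 x s2, [/\ s = s1 ++ x :: s2, p x & ~~ has p s1].
Proof.
elim: s => //= y s IHs; case py: (p y); first by exists [::], y, s.
move=> /= /IHs[s1 [x [s2 [-> px ps1]]]].
by exists (y :: s1), x, s2; rewrite /= py.
Qed.

Lemma split_last (T : Type) (p : pred T) s : has p s ->
  exists s1 x s2, [/\ s = s1 ++ x :: s2, p x & ~~ has p s2].
Proof.
rewrite -has_rev => /split_first[s1 [x [s2 [def_s px ps1]]]].
exists (rev s2), x, (rev s1); rewrite has_rev; split=> //.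
by rewrite -[s]revK def_s rev_cat rev_cons cat_rcons.
Qed.

(** * Words up to commutation *)

Section Traces.
Variables (I : finType) (m : I -> I -> nat).
Hypothesis m_sym : forall i j, m i j = m j i.

Definition ceq : seq I -> seq I -> Prop := clos_refl_sym_trans (seq I) (commutation m).

Lemma ceq_refl r : ceq r r. Proof. exact: rst_refl. Qed.
Lemma ceq_sym r s : ceq r s -> ceq s r. Proof. exact: rst_sym. Qed.
Lemma ceq_trans r s t : ceq r s -> ceq s t -> ceq r t.
Proof. exact: rst_trans. Qed.

Lemma ceq_swap2 a b i j : m i j = 2 -> ceq (a ++ i :: j :: b) (a ++ j :: i :: b).
Proof. by move=> mij; apply: rst_step; apply: (@Commutation _ m a b i j). Qed.

Lemma commutationP r s : commutation m r s ->
  exists a b i j, [/\ m i j = 2, r = a ++ i :: j :: b & s = a ++ j :: i :: b].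
Proof. by case=> a b i j mij; exists a, b, i, j. Qed.

(** Invariants of commutation classes are established by looking at a single swap in
context. *)
Lemma ceq_ind2 (R : seq I -> seq I -> Prop) :
  (forall r, R r r) -> (forall r s, R r s -> R s r) ->
  (forall r s t, R r s -> R s t -> R r t) ->
  (forall a b i j, m i j = 2 -> R (a ++ i :: j :: b) (a ++ j :: i :: b)) ->
  forall r s, ceq r s -> R r s.
Proof.
move=> Rr Rs Rt Rc r s; elim=> [x y|x|x y _|x y z _ xy _ yz] //.
- by case/commutationP=> a [b [i [j [mij -> ->]]]]; apply: Rc.
- exact: Rs.
- exact: Rt xy yz.
Qed.

Lemma ceq_catl a r s : ceq r s -> ceq (a ++ r) (a ++ s).
Proof.
move: r s; apply: ceq_ind2 => [r|r s|r s t|b c i j mij].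
- exact: ceq_refl.
- exact: ceq_sym.
- exact: ceq_trans.
- by rewrite !catA; apply: ceq_swap2.
Qed.

Lemma ceq_catr b r s : ceq r s -> ceq (r ++ b) (s ++ b).
Proof.
move: r s; apply: ceq_ind2 => [r|r s|r s t|a c i j mij].
- exact: ceq_refl.
- exact: ceq_sym.
- exact: ceq_trans.
- by rewrite -!catA; apply: ceq_swap2.
Qed.

Lemma ceq_cons i r s : ceq r s -> ceq (i :: r) (i :: s).
Proof. exact: (@ceq_catl [:: i]). Qed.

Lemma ceq_perm r s : ceq r s -> perm_eq r s.
Proof.
move: r s; apply: ceq_ind2 => [r|r s|r s t|a b i j _] //.
- by rewrite perm_sym.
- exact: perm_trans.
- by rewrite perm_cat2l; apply/permP => p /=; rewrite addnCA.
Qed.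

Lemma ceq_size r s : ceq r s -> size r = size s.
Proof. by move/ceq_perm/perm_size. Qed.

Lemma ceq_rev r s : ceq r s -> ceq (rev r) (rev s).
Proof.
move: r s; apply: ceq_ind2 => [r|r s|r s t|a b i j mij].
- exact: ceq_refl.
- exact: ceq_sym.
- exact: ceq_trans.
- rewrite !rev_cat !rev_cons -!cats1 -!catA /=; apply: ceq_swap2.
  by rewrite m_sym.
Qed.

Lemma ceq_filter (p : pred I) r s : ceq r s -> ceq (filter p r) (filter p s).
Proof.
move: r s; apply: ceq_ind2 => [r|r s|r s t|a b i j mij].
- exact: ceq_refl.
- exact: ceq_sym.
- exact: ceq_trans.
- rewrite !filter_cat /=; case: (p i); case: (p j); try exact: ceq_refl.
  exact: ceq_swap2.
Qed.

(** Letters that pairwise fail to commute keep their relative order. *)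
Lemma ceq_filter_eq (p : pred I) r s :
  (forall i j, p i -> p j -> m i j <> 2) -> ceq r s -> filter p r = filter p s.
Proof.
move=> pnc; move: r s; apply: ceq_ind2 => [r|r s|r s t -> ->|a b i j mij] //.
rewrite !filter_cat /=; case pi: (p i); case pj: (p j) => //.
by case: (pnc i j pi pj).
Qed.

Lemma ceq_move1 i g b : all (fun j => m i j == 2) g -> ceq (i :: g ++ b) (g ++ i :: b).
Proof.
elim: g => [|j g IHg] /=; first by move=> _; exact: ceq_refl.
case/andP=> /eqP mij /IHg h; apply: ceq_trans (ceq_cons j h).
exact: (@ceq_swap2 [::] _ i j mij).
Qed.

Lemma ceq_catC g h :
  (forall i j, i \in g -> j \in h -> m i j = 2) -> ceq (g ++ h) (h ++ g).
Proof.
elim: g => [|i g IHg] gh; first by rewrite cats0; exact: ceq_refl.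
apply: (@ceq_trans _ (i :: h ++ g)).
  by apply: ceq_cons; apply: IHg => k l kg lh; apply: gh => //; rewrite inE kg orbT.
apply: ceq_move1; apply/allP=> j jh; apply/eqP; apply: gh => //.
exact: mem_head.
Qed.

(** Sorting by p only ever moves a letter with p over letters without. *)
Lemma ceq_partition (p : pred I) g :
  (forall i j, i \in g -> j \in g -> p i -> ~~ p j -> m i j = 2) ->
  ceq g (filter p g ++ filter (predC p) g).
Proof.
elim: g => [|i g IHg] H /=; first exact: ceq_refl.
have /IHg {}IHg : forall k l, k \in g -> l \in g -> p k -> ~~ p l -> m k l = 2.
  by move=> k l kg lg; apply: H; rewrite inE ?kg ?lg orbT.
case pi: (p i) => /=; first exact: ceq_cons.
apply: ceq_trans (ceq_cons i IHg) _; apply: ceq_move1.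
apply/allP=> j; rewrite mem_filter => /andP[pj jg]; apply/eqP.
by rewrite m_sym; apply: H; rewrite ?inE ?jg ?eqxx ?orbT ?pi.
Qed.

(** The projections to pairs of non-commuting letters determine the class: the
first letter i of one word is preceded in the other only by letters commuting
with i, hence can be brought to the front there. *)
Lemma ceq_proj r s :
  (forall i j, m i j <> 2 -> filter (pred2 i j) r = filter (pred2 i j) s) ->
  (forall i, count_mem i r = count_mem i s) -> ceq r s.
Proof.
elim: r s => [|i r IHr] s proj cnt.
  case: s cnt {proj} => [|j s] cnt; first exact: ceq_refl.
  by have := cnt j; rewrite /= eqxx.
have : has (pred1 i) s by rewrite has_count -cnt /= eqxx.
case/split_first=> s1 [j [s2 [def_s /eqP ji]]]; rewrite has_pred1 => is1.
rewrite {j}ji in def_s; move: proj cnt; rewrite {s}def_s => proj cnt.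
have s1i : all (fun j => m i j == 2) s1.
  apply/allP=> j js1; apply: contraT => /eqP mij.
  have := proj _ _ mij; rewrite filter_cat /= eqxx /=.
  have : j \in filter (pred2 i j) s1 by rewrite mem_filter /= eqxx orbT.
  have : {subset filter (pred2 i j) s1 <= s1} by move=> k; rewrite mem_filter => /andP[].
  case: (filter _ s1) => // k t sub _ [ik _]; move: is1.
  by rewrite (sub i) // ik mem_head.
apply: ceq_trans (ceq_move1 s2 s1i); apply: ceq_cons; apply: IHr.
  move=> k l mkl; have := proj _ _ mkl; rewrite /= !filter_cat /=.
  case: ifP => [ikl|_ ->] //.
  suff -> : filter (pred2 k l) s1 = [::] by case.
  apply/eqP; rewrite -(negbK (_ == _)) -has_filter; apply/hasPn => x xs1 /=.
  have /eqP mix := allP s1i x xs1.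
  have xi : x != i by apply: contraNneq is1 => <-.
  case/orP: ikl => /eqP e; rewrite -e in mkl *; rewrite (negPf xi) /= ?orbF.
    by apply/negP => /eqP xl; apply: mkl; rewrite -xl.
  by apply/negP => /eqP xl; apply: mkl; rewrite -xl m_sym.
by move=> k; have := cnt k; rewrite /= !count_cat /= addnCA => /addnI.
Qed.

End Traces.

(** * The word problem in a Coxeter group *)

(** Bijections of an arbitrary type; the product is taken in the order in which
words are read, so that the action of a word unfolds letter by letter. *)
Record bij (T : Type) := Bij {
  bij_fun :> T -> T; bij_inv : T -> T;
  bij_funK : cancel bij_fun bij_inv; bij_invK : cancel bij_inv bij_fun }.

Section BijGroup.
Variable T : Type.
Implicit Types f g h : bij T.

HB.instance Definition _ := gen_eqMixin (bij T).
HB.instance Definition _ := gen_choiceMixin (bij T).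

Lemma bijP f g : (forall x, f x = g x) -> f = g.
Proof.
case: f g => [f f' fK f'K] [g g' gK g'K] /= fg.
have efg : f = g by apply: funext.
subst g; have efg' : f' = g' by apply: funext => x; rewrite -{1}[x]g'K fK.
by subst g'; congr Bij; apply: Prop_irrelevance.
Qed.

Definition bij1 := @Bij T id id (fun=> erefl) (fun=> erefl).
Definition bijM f g :=
  @Bij T (g \o f) (bij_inv f \o bij_inv g)
    (can_comp (bij_funK g) (bij_funK f)) (can_comp (bij_invK f) (bij_invK g)).
Definition bijV f := Bij (bij_invK f) (bij_funK f).

Lemma bijA : associative bijM. Proof. by move=> f g h; apply: bijP. Qed.
Lemma bij1M : left_id bij1 bijM. Proof. by move=> f; apply: bijP. Qed.
Lemma bijM1 : right_id bij1 bijM. Proof. by move=> f; apply: bijP. Qed.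
Lemma bijVM : left_inverse bij1 bijV bijM.
Proof. by move=> f; apply: bijP => x /=; apply: bij_invK. Qed.
Lemma bijMV : right_inverse bij1 bijV bijM.
Proof. by move=> f; apply: bijP => x /=; apply: bij_funK. Qed.
HB.instance Definition _ := isGroup.Build (bij T) bijA bij1M bijM1 bijVM bijMV.

Lemma bij_mulE f g x : (f * g)%g x = g (f x). Proof. by []. Qed.
Lemma bij_oneE x : (1%g : bij T) x = x. Proof. by []. Qed.
End BijGroup.

Fixpoint alt (T : Type) (i j : T) k : seq T :=
  if k is k'.+1 then i :: alt j i k' else [::].

Lemma size_alt (T : Type) (i j : T) k : size (alt i j k) = k.
Proof. by elim: k i j => //= k IHk i j; rewrite IHk. Qed.

Lemma expg_slide (W : groupType) (x y : W) p :
  (x * (y * x) ^+ p = (x * y) ^+ p * x)%g.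
Proof.
elim: p => [|p IHp]; first by rewrite !expg0 mulg1 mul1g.
by rewrite !expgS -[in RHS]mulgA -IHp !mulgA.
Qed.

Section Words.
Variables (I : finType) (W : groupType) (s : I -> W).
Local Open Scope group_scope.

Lemma evalw_nil : evalw s [::] = 1. Proof. by rewrite /evalw big_nil. Qed.
Lemma evalw_cons i r : evalw s (i :: r) = s i * evalw s r.
Proof. by rewrite /evalw big_cons. Qed.
Lemma evalw_cat a b : evalw s (a ++ b) = evalw s a * evalw s b.
Proof. by elim: a => [|i a IHa]; rewrite ?evalw_nil ?mul1g //= !evalw_cons IHa mulgA. Qed.

Lemma evalw_alt i j k : evalw s (alt i j k.*2) = (s i * s j) ^+ k.
Proof.
elim: k => [|k IHk]; first by rewrite evalw_nil.
by rewrite doubleS /= !evalw_cons IHk mulgA expgS.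
Qed.

Hypothesis sK : forall i, s i * s i = 1.

Lemma invs i : (s i)^-1 = s i. Proof. exact: mulg1_eq (sK i). Qed.

Lemma evalw_alt_div i j k :
  evalw s (alt i j k) * (evalw s (alt j i k))^-1 = (s i * s j) ^+ k.
Proof.
elim: k i j => [|k IHk] i j; first by rewrite evalw_nil mulgV.
rewrite /= !evalw_cons invgM invs mulgA -(mulgA (s i)) IHk {IHk}.
by rewrite expg_slide -mulgA -expgSr.
Qed.

Lemma evalw_braid i j k :
  (s i * s j) ^+ k = 1 -> evalw s (alt i j k) = evalw s (alt j i k).
Proof. by rewrite -evalw_alt_div => /mulg1_eq/(congr1 (fun x : W => x^-1)); rewrite !invgK. Qed.

(** Parity of the number of positions of the word r at which the reflection
carried by r is t; it will depend on the value of r only. *)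
Fixpoint nrefl (r : seq I) (t : W) : bool :=
  if r is i :: r' then (t == s i) (+) nrefl r' (t ^ s i) else false.

Lemma nrefl_cat a b t : nrefl (a ++ b) t = nrefl a t (+) nrefl b (t ^ evalw s a).
Proof.
elim: a t => [|i a IHa] t /=; first by rewrite evalw_nil conjg1.
by rewrite IHa evalw_cons conjgM addbA.
Qed.

(** The strong exchange condition for a reflection carried by the word. *)
Lemma nrefl_exchange r t : nrefl r t ->
  exists a i b, r = a ++ i :: b /\ t * evalw s r = evalw s (a ++ b).
Proof.
elim: r t => // i r IHr t /=; case: eqVneq => [-> _|_ /= /IHr[a [j [b [-> e]]]]].
  by exists [::], i, r; rewrite evalw_cons mulgA sK mul1g.
exists (i :: a), j, b; split=> //=.
rewrite !evalw_cons -e conjgE invs !mulgA sK mul1g.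
by rewrite evalw_cat /= evalw_cons !mulgA.
Qed.

Lemma nrefl_alt i j k t :
  nrefl (alt i j k) t = odd (count (fun p => t == (s i * s j) ^+ p * s i) (iota 0 k)).
Proof.
elim: k i j t => //= k IHk i j t.
rewrite expg0 mul1g oddD IHk (iotaDl 1 0) count_map oddb; congr (_ (+) odd _).
apply: eq_count => p /=; rewrite conjgE invs.
rewrite -(inj_eq (mulgI (s i))) -(inj_eq (mulIg (s i))) !mulgA sK mul1g.
rewrite -[t * _ * _]mulgA sK mulg1; congr (_ == _).
by rewrite expg_slide -[_ * s i * s j]mulgA -expgSr add1n.
Qed.

End Words.

Lemma coxeter_hom (I : finType) (m : I -> I -> nat) (W : groupType) (s : I -> W)
    (G : groupType) (f : I -> G) (r r' : seq I) :
  coxeter_system m s -> (forall i j, (f i * f j) ^+ m i j = 1)%g ->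
  evalw s r = evalw s r' -> evalw f r = evalw f r'.
Proof.
case=> _ _ univ /univ[phi phiE].
have phi1 : phi 1%g = 1%g.
  by apply: (mulgI (phi 1%g)); rewrite -gmulfM !mulg1.
have phir q : phi (evalw s q) = evalw f q.
  elim: q => [|i q IHq]; first by rewrite !evalw_nil.
  by rewrite !evalw_cons gmulfM phiE IHq.
by rewrite -!phir => ->.
Qed.

Section Coxeter.
Variables (I : finType) (m : I -> I -> nat) (W : groupType) (s : I -> W).
Hypothesis m_refl : forall i, m i i = 1.
Hypothesis cox : coxeter_system m s.
Local Open Scope group_scope.

Lemma cox_rel i j : (s i * s j) ^+ m i j = 1.
Proof. by case: cox. Qed.

Lemma cox_sK i : s i * s i = 1.
Proof. by have := cox_rel i i; rewrite m_refl. Qed.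

Let sK := cox_sK.

(** The action of a generator on the reflections with a sign: conjugation, together
with a change of sign at the generator itself.  It is extended to all of W, so that
no set of reflections has to be singled out; a word r then changes the sign of t by
nrefl r t. *)
Definition refl_fun i (x : W * bool) := (x.1 ^ s i, x.2 (+) (x.1 == s i)).

Lemma refl_funK i : involutive (refl_fun i).
Proof.
case=> t b; rewrite /refl_fun /=; congr pair; first by rewrite -conjgM sK conjg1.
have {3}-> : s i = s i ^ s i by rewrite conjgE mulKg.
by rewrite (inj_eq (conjg_inj _)) -addbA addbb addbF.
Qed.

Definition refl_bij i : bij (W * bool) := Bij (refl_funK i) (refl_funK i).

Lemma refl_evalE r t b :
  evalw refl_bij r (t, b) = (t ^ evalw s r, b (+) nrefl s r t).
Proof.
elim: r t b => [|i r IHr] t b; first by rewrite !evalw_nil conjg1 /= addbF.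
by rewrite !evalw_cons bij_mulE /refl_bij [Bij _ _ _]/= {1}/refl_fun IHr conjgM /= addbA.
Qed.

(** In the word i j i j ... of length 2 m the reflections carried in the second half
repeat those of the first half, so every sign is changed an even number of times. *)
Lemma refl_rel i j : (refl_bij i * refl_bij j) ^+ m i j = 1.
Proof.
rewrite -evalw_alt; apply: bijP => -[t b]; rewrite refl_evalE bij_oneE.
rewrite evalw_alt cox_rel conjg1; congr pair.
rewrite nrefl_alt // -addnn iotaD count_cat add0n.
have -> : iota (m i j) (m i j) = map (addn (m i j)) (iota 0 (m i j)).
  by rewrite -iotaDl addn0.
rewrite count_map.
rewrite (@eq_count _ (preim _ _) (fun p => t == (s i * s j) ^+ p * s i)).
  by rewrite addnn odd_double addbF.
by move=> p /=; rewrite expgnDr cox_rel mul1g.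
Qed.

Lemma nrefl_eval r r' t : evalw s r = evalw s r' -> nrefl s r t = nrefl s r' t.
Proof.
move=> /(coxeter_hom cox refl_rel)/(congr1 (fun f : bij _ => (f (t, false)).2)).
by rewrite !refl_evalE.
Qed.

(** All relations have even length, so the parity of a word is determined by its
value. *)
Lemma parity_eval r r' : evalw s r = evalw s r' -> odd (size r) = odd (size r').
Proof.
pose f (_ : I) : bij bool := Bij negbK negbK.
have fev q b : evalw f q b = b (+) odd (size q).
  elim: q b => [|i q IHq] b; first by rewrite evalw_nil /= addbF.
  by rewrite evalw_cons bij_mulE IHq /=; case: b; case: odd.
have fK i j : (f i * f j) ^+ m i j = 1.
  suff -> : f i * f j = 1 by rewrite expg1n.
  by apply: bijP => b; rewrite bij_mulE bij_oneE /= negbK.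
move=> /(coxeter_hom cox fK)/(congr1 (fun f : bij _ => f false)).
by rewrite !fev.
Qed.

End Coxeter.

(** An integral Cartan matrix for labels 2, 3, 4: the products of opposite
entries are 4 cos^2 (pi / m), that is 0, 1, 2. *)
Definition cartan (I : finType) (m : I -> I -> nat) (i j : I) : int :=
  if i == j then 2%R
  else if m i j == 2 then 0%R
  else if (m i j == 4) && (enum_rank i < enum_rank j)%N then (- 2)%R else (- 1)%R.

Section Orders.
Variables (I : finType) (m : I -> I -> nat) (W : groupType) (s : I -> W).
Hypothesis m_sym : forall i j, m i j = m j i.
Hypothesis m_refl : forall i, m i i = 1.
Hypothesis m_off : forall i j, i != j -> 1 < m i j <= 4.
Hypothesis cox : coxeter_system m s.
Import GRing.Theory.
Local Open Scope ring_scope.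

Let a := cartan m.

Lemma cartan_diag i : a i i = 2. Proof. by rewrite /a /cartan eqxx. Qed.

Lemma cartan2 i j : m i j = 2%N -> a i j = 0.
Proof.
by move=> mij; rewrite /a /cartan mij eqxx; case: eqVneq mij => // ->; rewrite m_refl.
Qed.

Lemma cartan3 i j : m i j = 3%N -> a i j = -1.
Proof.
by move=> mij; rewrite /a /cartan mij /=; case: eqVneq mij => // ->; rewrite m_refl.
Qed.

Lemma cartan4 i j : m i j = 4%N ->
  a i j = -1 /\ a j i = -2 \/ a i j = -2 /\ a j i = -1.
Proof.
move=> mij; have ij : i != j by apply/eqP => e; rewrite e m_refl in mij.
rewrite /a /cartan [in m j i]m_sym mij /= (eq_sym j) (negPf ij).
have : (enum_rank i != enum_rank j :> nat).
  by apply: contra ij => /eqP e; apply/eqP/enum_rank_inj/val_inj.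
by rewrite neq_ltn; case/orP => h; rewrite h; [right|left]; rewrite ltnNge ltnW.
Qed.

(** The i-th simple reflection, acting on linear forms that are given by their values
on the simple roots. *)
Definition cartan_fun i (v : I -> int) : I -> int := fun k => v k - a i k * v i.

Lemma cartan_funK i : involutive (cartan_fun i).
Proof.
by move=> v; apply: funext => k; rewrite /cartan_fun cartan_diag; ring.
Qed.

Definition cartan_bij i : bij (I -> int) := Bij (cartan_funK i) (cartan_funK i).

Lemma cartan_rel i j : ((cartan_bij i * cartan_bij j) ^+ m i j)%g = 1%g.
Proof.
have [<-|/m_off] := eqVneq i j.
  by rewrite m_refl expg1; apply: bijP => v; rewrite bij_mulE; apply: cartan_funK.
case/andP=> m1 m4; have : m i j \in [:: 2; 3; 4]%N by rewrite !inE; lia.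
rewrite !inE => /or3P[]/eqP mij; rewrite mij !expgS expg0; apply: bijP => v;
  apply: funext => k; rewrite !bij_mulE bij_oneE /= /cartan_fun.
- rewrite !cartan_diag (cartan2 mij).
  by rewrite m_sym in mij; rewrite (cartan2 mij); ring.
- rewrite !cartan_diag (cartan3 mij).
  by rewrite m_sym in mij; rewrite (cartan3 mij); ring.
- by rewrite !cartan_diag; case: (cartan4 mij) => -[-> ->]; ring.
Qed.

(** The product of two generators has no smaller order than prescribed; a
faithful rank-2 computation in the integral representation. *)
Lemma cox_order i j p : i != j -> (0 < p < m i j)%N -> ((s i * s j) ^+ p)%g <> 1%g.
Proof.
move=> ij pm sp.
have fp : ((cartan_bij i * cartan_bij j) ^+ p)%g = 1%g.
  rewrite -evalw_alt -[RHS](evalw_nil cartan_bij); apply: (coxeter_hom cox cartan_rel).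
  by rewrite evalw_alt evalw_nil.
have fm := cartan_rel i j.
have /andP[m1 m4] := m_off ij.
pose v k : int := (k == i)%:R.
have vi : v i = 1 by rewrite /v eqxx.
have vj : v j = 0 by rewrite /v eq_sym (negPf ij).
have no1 : (cartan_bij i * cartan_bij j)%g <> 1%g.
  move=> e; have : cartan_fun i v = cartan_fun j v.
    by rewrite -[LHS](cartan_funK j); congr cartan_fun; apply: (congr1 (fun f : bij _ => f v) e).
  by move/(congr1 (fun w => w i)); rewrite /cartan_fun cartan_diag vi vj; lia.
have [p1|p1] := eqVneq p 1%N; first by rewrite p1 expg1 in fp.
have [p3|p3] := eqVneq p (m i j).-1.
  by apply: no1; rewrite -[LHS]mulg1 -{1}fp p3 -expgS prednK ?fm //; lia.
have mij : m i j = 4%N by lia.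
have p2 : p = 2%N by lia.
move: fp; rewrite p2 expg2 => /(congr1 (fun f : bij _ => f v i)).
rewrite !bij_mulE bij_oneE /= /cartan_fun !cartan_diag vi vj.
by case: (cartan4 mij) => -[-> ->]; lia.
Qed.
End Orders.

(** Words whose commutation class contains neither a repeated letter nor the long
side of a braid relation: in a Coxeter group these are exactly the reduced words
of the fully commutative elements. *)
Definition fcw (I : finType) (m : I -> I -> nat) (r : seq I) : Prop :=
  forall r', ceq m r r' ->
    (forall a b i, r' <> a ++ i :: i :: b) /\
    (forall a b i j, 3 <= m i j -> r' <> a ++ alt i j (m i j) ++ b).

Section FCWords.
Variables (I : finType) (m : I -> I -> nat).
Hypothesis m_sym : forall i j, m i j = m j i.
Hypothesis m_off : forall i j, i != j -> 1 < m i j.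

Lemma fcw_ceq r r' : ceq m r r' -> fcw m r -> fcw m r'.
Proof. by move=> rr' fr q r'q; apply: fr; apply: ceq_trans rr' r'q. Qed.

Lemma fcw_factor a r b : fcw m (a ++ r ++ b) -> fcw m r.
Proof.
move=> fr q rq; have [|no2 nob] := fr (a ++ q ++ b).
  by apply: ceq_catl; apply: ceq_catr.
split=> [c d i e|c d i j mij e].
  by apply: (no2 (a ++ c) (d ++ b) i); rewrite e -!catA.
by apply: (nob (a ++ c) (d ++ b) i j mij); rewrite e -!catA.
Qed.

Lemma alt_rcons (i j : I) k : alt i j k.+1 = rcons (alt i j k) (if odd k then j else i).
Proof. by elim: k i j => // k IHk i j; rewrite [LHS]/= -/(alt j i k.+1) IHk /= if_neg. Qed.

Lemma rev_alt (i j : I) k : rev (alt i j k) = if odd k then alt i j k else alt j i k.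
Proof.
elim: k i j => // k IHk i j; rewrite [in LHS]/= rev_cons IHk oddS if_neg.
by rewrite !alt_rcons; case: (odd k).
Qed.

Lemma fcw_rev r : fcw m r -> fcw m (rev r).
Proof.
move=> fr q. move=> /(ceq_rev m_sym); rewrite revK => /fr[no2 nob]; split=> [a b i e|a b i j mij e].
  by apply: (no2 (rev b) (rev a) i); rewrite e rev_cat !rev_cons -!cats1 -!catA.
have := rev_alt i j (m i j); case: ifP => _ erev.
  by apply: (nob (rev b) (rev a) i j mij); rewrite e !rev_cat -catA erev.
apply: (nob (rev b) (rev a) j i); first by rewrite m_sym.
by rewrite e !rev_cat -catA erev m_sym.
Qed.

Definition braid_step (r r' : seq I) : Prop := exists a b i j,
  [/\ i != j, r = a ++ alt i j (m i j) ++ b & r' = a ++ alt j i (m i j) ++ b].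

Definition bsim : seq I -> seq I -> Prop := clos_refl_sym_trans (seq I) braid_step.

Lemma bsim_cons i r r' : bsim r r' -> bsim (i :: r) (i :: r').
Proof.
elim=> [x y [a [b [j [k [jk -> ->]]]]]|x|x y _ IH|x y z _ IH1 _ IH2].
- by apply: rst_step; exists (i :: a), b, j, k.
- exact: rst_refl.
- exact: rst_sym.
- exact: rst_trans IH1 IH2.
Qed.

(** The only braid moves that apply to such a word are those with label 2, and they
lead to words of the same kind. *)
Lemma bsim_ceq r r' : fcw m r -> bsim r r' -> ceq m r r'.
Proof.
move=> fr rr'; suff: fcw m r \/ fcw m r' -> ceq m r r' by apply; left.
elim: rr' => {r r' fr} [r r' [a [b [i [j [ij er er']]]]]|r|r r' _ IH|r s t _ IH1 _ IH2].
- have [/eqP mij _|mij2] := boolP (m i j == 2).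
    by rewrite er er' mij /=; apply: ceq_swap2.
  have [mij|mij] := leqP 3 (m i j).
    case=> [/(_ r (ceq_refl _ _))[_ /(_ a b i j mij)] //|].
    rewrite m_sym in mij er'.
    by move=> /(_ r' (ceq_refl _ _))[_ /(_ a b j i mij)].
  by have := m_off ij; lia.
- by move=> _; apply: ceq_refl.
- by move=> f; apply: ceq_sym; apply: IH; case: f; [right|left].
- case=> [fr|ft].
    have rs := IH1 (or_introl fr); apply: (ceq_trans rs); apply: IH2.
    by left; apply: fcw_ceq rs fr.
  have st := IH2 (or_intror ft); apply: ceq_trans (st); apply: IH1.
  by right; apply: fcw_ceq (ceq_sym st) ft.
Qed.
End FCWords.

Section Matsumoto.
Variables (I : finType) (m : I -> I -> nat) (W : groupType) (s : I -> W).
Hypothesis m_sym : forall i j, m i j = m j i.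
Hypothesis m_refl : forall i, m i i = 1.
Hypothesis m_off : forall i j, i != j -> 1 < m i j <= 4.
Hypothesis cox : coxeter_system m s.

Let sK := cox_sK m_refl cox.

Definition reduced (r : seq I) := forall r', evalw s r' = evalw s r -> size r <= size r'.

Lemma reduced_eval r r' : reduced r -> evalw s r' = evalw s r -> size r' = size r -> reduced r'.
Proof. by move=> rr e e' q eq; rewrite e' rr // eq. Qed.

Lemma reduced_factor a r b : reduced (a ++ r ++ b) -> reduced r.
Proof.
move=> rr q eq; have := rr (a ++ q ++ b).
by rewrite !evalw_cat eq !size_cat leq_add2l leq_add2r => /(_ erefl).
Qed.

Lemma reduced_behead i r : reduced (i :: r) -> reduced r.
Proof. by move=> ir; apply: (@reduced_factor [:: i] r [::]); rewrite cats0. Qed.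

(** A letter that may begin a reduced word of w is carried as a reflection by
every word of w. *)
Lemma descent_nrefl i v r : reduced (i :: v) -> evalw s r = evalw s (i :: v) ->
  nrefl s r (s i).
Proof.
move=> iv e; rewrite (nrefl_eval m_refl cox _ e) /= eqxx /=.
have -> : (s i ^ s i = s i)%g by rewrite conjgE mulKg.
apply/negP => /(nrefl_exchange sK)[a [j [b [ev es]]]].
have := iv (a ++ b); rewrite -es evalw_cons => /(_ erefl).
by rewrite ev /= !size_cat /= addnS -ltnS ltnNge leqnSn.
Qed.

(** If both i and j may begin a reduced word of w, exchanging them in turn produces
reduced words of w with longer and longer alternating prefixes; the letter
removed by the exchange never lies in the prefix, as this would bound the order
of the product of the two generators. *)
Lemma descents_alt (w : W) i j u v k : i != j -> k <= m i j ->
  reduced (i :: u) -> reduced (j :: v) -> evalw s (i :: u) = w -> evalw s (j :: v) = w ->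
  exists z, reduced (alt i j k ++ z) /\ evalw s (alt i j k ++ z) = w.
Proof.
move=> + + ri rj ei ej; elim: k i j u v ri rj ei ej => [|k IHk] i j u v ri rj ei ej ij km.
  by exists (i :: u).
have ji : j != i by rewrite eq_sym.
have [|z [rz ez]] := IHk j i v u rj ri ej ei ji; first by rewrite m_sym ltnW.
have : nrefl s (alt j i k ++ z) (s i) by apply: descent_nrefl ri _; rewrite ez ei.
rewrite nrefl_cat; case ak: (nrefl s (alt j i k) (s i)).
  move: ak; rewrite nrefl_alt // => /odd_gt0; rewrite -has_count => /hasP[p].
  rewrite mem_iota add0n => /= pk /eqP e.
  case: (cox_order m_sym m_refl m_off cox ji (p := p.+1)); last first.
    by rewrite expgSr mulgA -e sK.
  by rewrite m_sym; apply: leq_ltn_trans km.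
rewrite addFb => /(nrefl_exchange sK)[a [l [b [ez' es]]]].
exists (a ++ b); have e : evalw s (alt i j k.+1 ++ a ++ b) = w.
  rewrite [alt _ _ _]/= cat_cons evalw_cons evalw_cat -es conjgE -ez evalw_cat.
  by rewrite -!mulgA mulVKg -[X in (X * _)%g](invs sK) mulKg.
split=> //; apply: (reduced_eval rz); first by rewrite e ez.
by rewrite ez' !size_cat !size_alt /=; lia.
Qed.

(** Reduced words with different first letters i and j are linked through words with
the same value beginning with the long sides i j i ... and j i j ... of a braid
relation; words with the same first letter are linked by induction. *)
Lemma matsumoto r r' : reduced r -> reduced r' -> evalw s r = evalw s r' -> bsim m r r'.
Proof.
have [n] := ubnP (size r); elim: n r r' => // n IHn r r' + rr rr' err'.
have sz : size r = size r' by apply/eqP; rewrite eqn_leq rr ?rr'.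
case: r rr err' sz => [|i u] rr err' sz.
  by move/eqP: sz; rewrite eq_sym size_eq0 => /eqP -> _; apply: rst_refl.
case: r' rr' err' sz => [|j v] // rr' err' sz; rewrite ltnS => szn.
have hd l x y : size x < n -> reduced (l :: x) -> reduced (l :: y) ->
    evalw s (l :: x) = evalw s (l :: y) -> bsim m (l :: x) (l :: y).
  move=> xn rx ry e; apply: bsim_cons; apply: IHn => //.
  - exact: reduced_behead rx.
  - exact: reduced_behead ry.
  - by move: e; rewrite !evalw_cons => /mulgI.
have [ij|ij] := eqVneq i j; first by subst j; apply: hd.
have [z [rz ez]] := descents_alt ij (leqnn _) rr rr' erefl (esym err').
have ez' := ez; rewrite evalw_cat (evalw_braid sK (cox_rel cox i j)) -evalw_cat in ez'.
have rz' : reduced (alt j i (m i j) ++ z).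
  by apply: (reduced_eval rz); rewrite ?ez ?ez' // !size_cat !size_alt.
have sz' : size (alt j i (m i j) ++ z) = size (j :: v).
  by apply/eqP; rewrite eqn_leq rz' ?rr' ?ez' ?err'.
have st : bsim m (alt i j (m i j) ++ z) (alt j i (m i j) ++ z).
  by apply: rst_step; exists [::], z, i, j.
have [k mk] : exists k, m i j = k.+1.
  by exists (m i j).-1; rewrite prednK //; have/andP[/ltnW] := m_off ij.
rewrite mk /= in rz ez rz' ez' sz' st.
apply: (@rst_trans _ _ _ (i :: alt j i k ++ z)); first by apply: hd; rewrite ?ez.
apply: (@rst_trans _ _ _ (j :: alt i j k ++ z)); first exact: st.
by apply: rst_sym; apply: hd; rewrite ?ez' //; case: sz => <-.
Qed.

(** Suppose that the tail r is reduced but i :: r is not.  A shorter word q of the same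
value is shorter by at least two because of parity, so that i :: q is another
reduced word for the value of r.  It is equivalent to r, and i :: r is equivalent to a
word beginning with i i. *)
Theorem fcw_reduced r : fcw m r -> reduced r.
Proof.
elim: r => [|i r IHr] fr q eq //.
have rr : reduced r.
  by apply: IHr; apply: (@fcw_factor _ _ [:: i] r [::]); rewrite cats0.
rewrite leqNgt; apply/negP => qr.
have par := parity_eval cox eq; rewrite /= in par qr.
have sqr : size q < size r.
  by rewrite ltn_neqAle -ltnS qr andbT; apply: contra_eq_neq par => /= ->; case: odd.
have ei : evalw s (i :: q) = evalw s r by rewrite evalw_cons eq evalw_cons mulgA sK mul1g.
have rq : reduced (i :: q).
  by apply: (reduced_eval rr ei); apply/eqP; rewrite eqn_leq rr ?andbT.
have rb : bsim m r (i :: q) by apply: matsumoto.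
have fr' : fcw m r by apply: (@fcw_factor _ _ [:: i] r [::]); rewrite cats0.
have /(ceq_cons i) := bsim_ceq m_sym (fun i j ij => proj1 (andP (m_off ij))) fr' rb.
by move/fr => [/(_ [::] q i)].
Qed.

Theorem fcw_fully_commutative r : fcw m r -> fully_commutative m s (evalw s r).
Proof.
have m1 i j : i != j -> 1 < m i j by move/m_off/andP => [].
move=> fr p q [ep rp] [eq rq]; have rr := fcw_reduced fr.
have cl x : evalw s x = evalw s r -> reduced x -> ceq m r x.
  move=> ex rx; apply: (bsim_ceq m_sym m1 fr).
  by apply: matsumoto.
apply: (ceq_trans (s := r)); last by apply: cl => // x; rewrite eq => /rq.
by apply: ceq_sym; apply: cl => // x; rewrite ep => /rp.
Qed.

Lemma ceq_evalw r r' : ceq m r r' -> evalw s r = evalw s r'.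
Proof.
move: r r'; apply: ceq_ind2 => [||r q t -> ->|a b i j mij] //.
rewrite !evalw_cat !evalw_cons !mulgA; congr (_ * _)%g; rewrite -!mulgA; congr (_ * _)%g.
have := evalw_braid sK (cox_rel cox i j).
by rewrite mij /= !evalw_cons evalw_nil !mulg1.
Qed.

(** A braid move would change the order of the letters i and j in a reduced word, which
commutations cannot do. *)
Theorem fully_commutative_fcw w r :
  fully_commutative m s w -> reduced_expr s w r -> fcw m r.
Proof.
move=> fw [er rr] r' rr'; have er' : evalw s r' = w by rewrite -(ceq_evalw rr').
have r'r : reduced_expr s w r' by split=> // q /rr; rewrite (ceq_size rr').
split=> [a b i e|a b i j mij e].
  have /r'r.2 : evalw s (a ++ b) = w.
    by rewrite -er' e !evalw_cat !evalw_cons (mulgA (s i)) sK mul1g.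
  by rewrite e !size_cat /= leq_add2l ltnNge leqnSn.
have ij : i != j by apply: contraTneq mij => ->; rewrite m_refl.
pose q := a ++ alt j i (m i j) ++ b.
have rq : reduced_expr s w q.
  split; last by move=> x /r'r.2; rewrite e !size_cat !size_alt.
  by rewrite -er' e !evalw_cat (evalw_braid sK (cox_rel cox i j)).
have /ceq_filter_eq/(_ (fw _ _ r'r rq)) : forall k l : I,
    pred2 i j k -> pred2 i j l -> m k l <> 2.
  by move=> k l /pred2P[]-> /pred2P[]->; rewrite ?m_refl //; have := m_sym i j; lia.
rewrite e !filter_cat => /(congr1 (fun x => nth i x (size (filter (pred2 i j) a)))).
have altp x y k : pred2 i j x -> pred2 i j y -> filter (pred2 i j) (alt x y k) = alt x y k.
  by elim: k x y => //= k IHk x y px py; rewrite px IHk.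
rewrite !nth_cat ltnn subnn !altp /= ?eqxx ?orbT //.
case: (m i j) mij => [|k] //= _ ei.
by rewrite ei eqxx in ij.
Qed.

(** Fully commutative elements of length l are counted by any set of labels in
bijection with the classes of words of length l. *)
Theorem fc_growth_card (T : finType) (S : {pred T}) (R : T -> seq I -> Prop) l :
  (forall p, p \in S -> exists r, [/\ fcw m r, size r = l & R p r]) ->
  (forall r, fcw m r -> size r = l -> exists p r', [/\ p \in S, ceq m r r' & R p r']) ->
  (forall p r r', size r = l -> size r' = l -> R p r -> R p r' -> ceq m r r') ->
  (forall p p' r r', fcw m r -> size r = l -> size r' = l ->
     R p r -> R p' r' -> ceq m r r' -> p = p') ->
  fc_growth m s l = #|S|.
Proof.
move=> ex onto uniq inj.
have ex' p : exists r, p \in S -> [/\ fcw m r, size r = l & R p r].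
  by case pS: (p \in S); [have [r] := ex p pS; exists r | exists [::]].
pose om p := proj1_sig (cid (ex' p)).
have omP p : p \in S -> [/\ fcw m (om p), size (om p) = l & R p (om p)].
  exact: (proj2_sig (cid (ex' p))).
rewrite /fc_growth.
rewrite [X in fset_set X](_ : _ = [set` [fset evalw s (om p) | p in S]%fset]%classic).
  rewrite set_fsetK card_in_imfset /= -?cardE // => p p' pS p'S e.
  have [fp sp Rp] := omP p pS; have [fp' sp' Rp'] := omP p' p'S.
  apply: (inj p p' (om p) (om p')) => //.
  apply: (fcw_fully_commutative fp); first by split; last exact: fcw_reduced.
  by rewrite e; split; last exact: fcw_reduced.
apply/seteqP; split=> [w [fw [r rr rl]]|w /= /imfsetP[p /= pS ->]] /=.
  have fr := fully_commutative_fcw fw rr.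
  have [p [r' [pS rr' Rp]]] := onto r fr rl; have [_ sp Rp'] := omP p pS.
  apply/imfsetP; exists p => //=; have [<- _] := rr.
  rewrite (ceq_evalw rr'); apply: ceq_evalw.
  by apply: (uniq p) => //; rewrite -rl (ceq_size rr').
have [fp sp _] := omP p pS; split; first exact: fcw_fully_commutative.
by exists (om p) => //; split=> //; exact: fcw_reduced.
Qed.

End Matsumoto.

Ltac catn := rewrite -?cats1; repeat progress (rewrite /= -?catA).

(** * Gaps between equal letters *)

Section Gaps.
Variables (I : finType) (m : I -> I -> nat).
Hypothesis m_sym : forall i j, m i j = m j i.

Definition commw i (g : seq I) := all (fun j => m i j == 2) g.

Lemma commw_cat i g h : commw i (g ++ h) = commw i g && commw i h.
Proof. exact: all_cat. Qed.

Lemma commw_ceq i g b : commw i g -> ceq m (g ++ i :: b) (i :: g ++ b).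
Proof. by move=> fg; apply: ceq_sym; apply: ceq_move1. Qed.

(** In the following three lemmas the letters commuting with i, or with j, are moved out
of the way, which brings the letters of a forbidden factor i i, i j i or i j i j
together. *)
Lemma gap0 a i g b : fcw m (a ++ i :: g ++ i :: b) -> commw i g -> False.
Proof.
move=> f fg; have /f[/(_ a (g ++ b) i)] : ceq m (a ++ i :: g ++ i :: b) (a ++ i :: i :: g ++ b).
  by apply: ceq_catl; apply: ceq_cons; apply: commw_ceq.
by [].
Qed.

Lemma gap1 a i g1 j g2 b : fcw m (a ++ i :: g1 ++ j :: g2 ++ i :: b) ->
  m i j = 3 -> commw i g1 -> commw i g2 -> False.
Proof.
move=> f mij f1 f2.
have /f[_ /(_ (a ++ g1) (g2 ++ b) i j)] :
    ceq m (a ++ i :: g1 ++ j :: g2 ++ i :: b) ((a ++ g1) ++ i :: j :: i :: g2 ++ b).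
  rewrite -catA; apply: ceq_catl; apply: ceq_trans (ceq_move1 _ f1) _.
  by apply: ceq_catl; do 2!apply: ceq_cons; apply: commw_ceq.
by rewrite mij; apply.
Qed.

Lemma gap2 a i g1 j g2 g3 b :
  fcw m (a ++ i :: g1 ++ j :: g2 ++ i :: g3 ++ j :: b) -> m i j = 4 ->
  commw i g1 -> commw i g2 -> commw j g2 -> commw j g3 -> False.
Proof.
move=> f mij f1 f2 f2' f3.
have /f[_ /(_ (a ++ g1) (g2 ++ g3 ++ b) i j)] : ceq m
    (a ++ i :: g1 ++ j :: g2 ++ i :: g3 ++ j :: b)
    ((a ++ g1) ++ i :: j :: i :: j :: g2 ++ g3 ++ b).
  rewrite -catA; apply: ceq_catl; apply: ceq_trans (ceq_move1 _ f1) _.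
  apply: ceq_catl; do 2!apply: ceq_cons; apply: ceq_trans (commw_ceq _ f2) _.
  apply: ceq_cons; apply: ceq_trans (commw_ceq _ f2').
  by apply: ceq_catl; apply: commw_ceq.
by rewrite mij; apply.
Qed.

Lemma commw_first i g : ~~ commw i g ->
  exists g1 j g2, [/\ g = g1 ++ j :: g2, m i j != 2 & commw i g1].
Proof.
rewrite -has_predC => /split_first[g1 [j [g2 [-> mj h]]]]; exists g1, j, g2; split=> //.
by rewrite -[commw _ _]negbK -has_predC.
Qed.

(** With one letter not commuting with i in between there would be a factor i j i. *)
Lemma gap_two a i g b : fcw m (a ++ i :: g ++ i :: b) ->
  {in g, forall j, m i j = 2 \/ m i j = 3} ->
  exists g1 j g2 j' g3, [/\ g = g1 ++ j :: g2 ++ j' :: g3,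
    m i j = 3, m i j' = 3, commw i g1 & commw i g2].
Proof.
move=> f gi.
have /commw_first[g1 [j [g' [eg mj f1]]]] : ~~ commw i g by apply/negP => /(gap0 f).
have jg : j \in g by rewrite eg mem_cat mem_head orbT.
have {}mj : m i j = 3 by case: (gi _ jg) mj => ->.
have /commw_first[g2 [j' [g3 [eg' mj' f2]]]] : ~~ commw i g'.
  apply/negP => fg'; apply: (@gap1 a i g1 j g' b) => //.
  by move: f; rewrite eg -!catA.
have j'g : j' \in g by rewrite eg eg' mem_cat inE mem_cat mem_head !orbT.
have {}mj' : m i j' = 3 by case: (gi _ j'g) mj' => ->.
by exists g1, j, g2, j', g3; rewrite eg eg'.
Qed.

End Gaps.

(** * Ladders *)

Definition colsize (I : finType) (col : I -> nat) k := #|[pred i | col i == k]|.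

Definition adj (k l : nat) := (k.+1 == l) || (l.+1 == k).

Definition lone (I : finType) (col : I -> nat) n k :=
  ((k == 0) || (k == n)) && (colsize col k == 1).

(** A common description of the three Coxeter graphs: the letters sit in columns
0, ..., n, one letter in each inner column and one or two in each end column, and
the labels 4 are on the edges to an end column with a single letter. *)
Record ladder (I : finType) (m : I -> I -> nat) n (col : I -> nat) : Prop := Ladder {
  ladder_n : 1 < n;
  ladder_le : forall i, col i <= n;
  ladder_size : forall k, k <= n -> 0 < colsize col k <= 2;
  ladder_inner : forall k, 0 < k < n -> colsize col k = 1;
  ladder_m : forall i j, m i j =
    if i == j then 1
    else if adj (col i) (col j)
    then if lone col n (col i) || lone col n (col j) then 4 else 3
    else 2 }.

Section Ladder.
Variables (I : finType) (m : I -> I -> nat) (n : nat) (col : I -> nat).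
Hypothesis L : ladder m n col.

Lemma adj_sym k l : adj k l = adj l k.
Proof. by rewrite /adj orbC. Qed.

Lemma ladder_sym i j : m i j = m j i.
Proof.
by rewrite !(ladder_m L) eq_sym adj_sym orbC.
Qed.

Lemma ladder_refl i : m i i = 1.
Proof. by rewrite (ladder_m L) eqxx. Qed.

Lemma ladder_off i j : i != j -> 1 < m i j <= 4.
Proof. by rewrite (ladder_m L) => /negPf ->; case: ifP => // _; case: ifP. Qed.

Lemma ladder_commute i j : (m i j == 2) = (i != j) && ~~ adj (col i) (col j).
Proof. by rewrite (ladder_m L); case: (eqVneq i j) => //= _; case: (adj _ _) => //; case: (_ || _). Qed.

Lemma ladder_label3 i j : adj (col i) (col j) -> ~~ lone col n (col i) -> ~~ lone col n (col j) ->
  m i j = 3.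
Proof.
rewrite (ladder_m L) => a /negPf -> /negPf ->; rewrite a; case: eqP => // e.
by move: a; rewrite e /adj; lia.
Qed.

Lemma ladder_label4 i j : adj (col i) (col j) -> lone col n (col i) || lone col n (col j) ->
  m i j = 4.
Proof.
rewrite (ladder_m L) => a ->; rewrite a; case: eqP => // e.
by move: a; rewrite e /adj; lia.
Qed.

Lemma inner_lone k : 0 < k < n -> lone col n k = false.
Proof. by move=> kn; apply/negbTE; rewrite negb_and; apply/orP; left; lia. Qed.

Lemma col_ex k : k <= n -> exists i, col i = k.
Proof.
move=> kn; have /andP[+ _] := ladder_size L kn; case/card_gt0P=> i /eqP ik.
by exists i.
Qed.

Lemma col1_inj i j : colsize col (col i) = 1 -> col i = col j -> i = j.
Proof.
move=> /mem_card1[x xP] ij.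
have: i \in [pred k | col k == col i] by rewrite inE.
have: j \in [pred k | col k == col i] by rewrite inE ij.
by rewrite !xP !inE => /eqP -> /eqP.
Qed.

Lemma inner_inj i j : 0 < col i < n -> col i = col j -> i = j.
Proof. by move=> /(ladder_inner L); apply: col1_inj. Qed.

Lemma col2 i j l : i != j -> col i = col j -> col l = col i -> l = i \/ l = j.
Proof.
move=> ij eij li; have /andP[_ c2] := ladder_size L (ladder_le L i).
case: (eqVneq l i) => [->|il]; first by left.
case: (eqVneq l j) => [->|jl]; first by right.
have /card_uniqP e : uniq [:: i; j; l].
  by rewrite /= !inE negb_or ij (eq_sym i) il (eq_sym j) jl.
suff : #|[:: i; j; l]| <= colsize col (col i) by rewrite e /=; lia.
by apply/subset_leq_card/subsetP => x; rewrite !inE => /or3P[]/eqP ->; apply/eqP.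
Qed.

Lemma col_pair i j : i != j -> col i = col j ->
  colsize col (col i) = 2 /\ ((col i == 0) || (col i == n)).
Proof.
move=> ij eij; have := ladder_size L (ladder_le L i).
have : colsize col (col i) != 1 by apply: contra ij => /eqP c1; apply/eqP/col1_inj.
move=> h1 h2; split; first by lia.
have := @ladder_inner _ _ _ _ L (col i); have := ladder_le L i.
lia.
Qed.

Definition avoids k (g : seq I) := all (fun i => col i != k) g.

Lemma avoids_cat k g h : avoids k (g ++ h) = avoids k g && avoids k h.
Proof. exact: all_cat. Qed.

Lemma avoids_cons k i g : avoids k (i :: g) = (col i != k) && avoids k g.
Proof. by []. Qed.

Lemma avoids_sub k g h : {subset g <= h} -> avoids k h -> avoids k g.
Proof. by move=> sub /allP H; apply/allP => i /sub /H. Qed.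

Lemma avoids_rev k g : avoids k (rev g) = avoids k g.
Proof. exact: all_rev. Qed.

Lemma avoids_commw i k g : col i = k -> avoids k.-1 g -> avoids k g -> avoids k.+1 g -> commw m i g.
Proof.
move=> ik /allP n1 /allP n2 /allP n3; apply/allP => j jg; rewrite ladder_commute /adj ik.
have := n1 j jg; have := n2 j jg; have := n3 j jg.
by case: (eqVneq i j) => [<-|_] /=; lia.
Qed.

Lemma avoids_first k g : ~~ avoids k g -> exists g1 y g2, [/\ g = g1 ++ y :: g2, col y = k & avoids k g1].
Proof.
rewrite -has_predC => /split_first[g1 [y [g2 [-> /= yk h]]]]; exists g1, y, g2; split=> //.
  by apply/eqP; rewrite -[_ == _]negbK.
by rewrite /avoids -[all _ _]negbK -has_predC.
Qed.

End Ladder.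

Definition mirror (I : Type) n (col : I -> nat) i := n - col i.

Lemma ladder_mirror (I : finType) (m : I -> I -> nat) n col :
  ladder m n col -> ladder m n (mirror n col).
Proof.
move=> L; have cs k : k <= n -> colsize (mirror n col) k = colsize col (n - k).
  move=> kn; apply: eq_card => i; rewrite !inE /mirror; have := ladder_le L i; lia.
split.
- exact: ladder_n L.
- by move=> i; apply: leq_subr.
- by move=> k kn; rewrite cs //; apply: (ladder_size L); apply: leq_subr.
- by move=> k kn; rewrite cs; [apply: (ladder_inner L)|]; lia.
- move=> i j; rewrite (ladder_m L); have := ladder_le L i; have := ladder_le L j => cj ci.
  have lo x : col x <= n -> lone (mirror n col) n (mirror n col x) = lone col n (col x).
    by move=> cx; rewrite /lone cs /mirror ?leq_subr // subKn //; congr (_ && _); lia.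
  have -> : adj (mirror n col i) (mirror n col j) = adj (col i) (col j).
    by rewrite /adj /mirror; lia.
  by rewrite !lo.
Qed.

(** * Turns at an end of the ladder *)

Section Turns.
Variables (I : finType) (m : I -> I -> nat) (n : nat) (col : I -> nat).
Hypothesis L : ladder m n col.
Let ngt1 : 1 < n := ladder_n L.

(** A run from column k to column n and back, with a full visit of column n. *)
Inductive rturn : nat -> seq I -> Prop :=
| RTurnEnd x e : col x = n.-1 -> all (fun i => col i == n) e -> uniq e ->
    size e = colsize col n -> rturn n.-1 (x :: rcons e x)
| RTurnStep k x v : 0 < k -> col x = k -> rturn k.+1 v -> rturn k (x :: rcons v x).

Lemma rturn_bound k v : rturn k v -> 0 < k < n.
Proof. by elim=> [x e _ _ _ _|k' x v' k0 _ _]; lia. Qed.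

Lemma rturn_ends k v : rturn k v -> exists x w, col x = k /\ v = x :: rcons w x.
Proof. by case=> [x e xk _ _ _|k' x w _ xk _]; [exists x, e|exists x, w]. Qed.

Lemma rturn_rev k v : rturn k v -> rturn k (rev v).
Proof.
elim=> [x e xk en ue se|k' x w k0 xk _ IH]; rewrite rev_cons rev_rcons rcons_cons.
  by apply: RTurnEnd; rewrite ?all_rev ?rev_uniq ?size_rev.
exact: RTurnStep.
Qed.

Lemma full_end e y k : all (fun i => col i == k) e -> uniq e -> size e = colsize col k ->
  col y = k -> y \in e.
Proof.
move=> /allP ek /card_uniqP ue se yk; have : e =i [pred i | col i == k].
  apply/subset_cardP; first by rewrite ue se.
  by apply/subsetP => i /ek.
by move/(_ y); rewrite !inE yk eqxx => ->.
Qed.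

(** After the last letter of a full visit of an end column, this column is not
visited again before the neighbouring letter x has occurred: with two letters
t, t' in the column one finds t x t, and with a single one x t x t. *)
Lemma end_after a x g b t c k : col x = k -> 0 < k < n -> adj k (col t) ->
  (col t == 0) || (col t == n) ->
  fcw m (a ++ x :: g ++ x :: b ++ t :: c) -> t \in g ->
  (lone col n (col t) -> avoids col k g /\ commw m x (filter (predC1 t) g)) ->
  avoids col k g -> avoids col k b -> t \notin b -> False.
Proof.
move=> xk kn at_ te f tg lg ncg ncb tb.
have [g1 [t' [g2 [eg /eqP tt' tg2]]]] : exists g1 t' g2,
    [/\ g = g1 ++ t' :: g2, pred1 t t' & ~~ has (pred1 t) g2].
  by apply: split_last; rewrite has_pred1.
subst t'; rewrite has_pred1 in tg2.
have kt : forall l, adj (col t) l -> l <= n -> l = k.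
  by move=> l; move: at_ te; rewrite /adj; lia.
have frt h : avoids col k h -> t \notin h -> commw m t h.
  move=> /allP nh th; apply/allP => j jh; rewrite (ladder_commute L).
  have -> : t != j by apply: contraNneq th => ->.
  apply/negP => aj; have := nh j jh; have := kt _ aj (ladder_le L j).
  by move=> ->; rewrite eqxx.
move: ncg; rewrite eg avoids_cat avoids_cons => /and3P[ncg1 _ ncg2].
have at' : adj (col t) (col x) by rewrite xk adj_sym.
have [lo|lo] := boolP (lone col n (col t)); last first.
  apply: (@gap1 _ m (a ++ x :: g1) t g2 x b c).
  - by move: f; rewrite eg; catn.
  - by apply: (ladder_label3 L); rewrite // xk (inner_lone _ kn).
  - exact: frt.
  - exact: frt.
have [_] := lg lo; rewrite eg filter_cat /= eqxx /= commw_cat => /andP[fg1 fg2].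
have ft h : avoids col k h -> commw m x (filter (predC1 t) h) -> t \notin h -> commw m x h.
  by move=> _ + th; rewrite (_ : filter _ _ = h) //; apply/all_filterP/allP => j jh;
    apply: contraNneq th => <-.
have [tg1|tg1] := boolP (t \in g1).
  have [g3 [t' [g4 [eg1 /eqP tt' tg4]]]] : exists g1' t' g2',
      [/\ g1 = g1' ++ t' :: g2', pred1 t t' & ~~ has (pred1 t) g2'].
    by apply: split_last; rewrite has_pred1.
  subst t'; rewrite has_pred1 in tg4.
  apply: (@gap0 _ m (a ++ x :: g3) t g4 (g2 ++ x :: b ++ t :: c)).
    by move: f; rewrite eg eg1; catn.
  by apply: frt => //; move: ncg1; rewrite eg1 avoids_cat avoids_cons => /and3P[].
apply: (@gap2 _ m a x g1 t g2 b c).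
- by move: f; rewrite eg; catn.
- by apply: (ladder_label4 L); rewrite ?xk // lo orbT.
- exact: ft.
- exact: ft.
- exact: frt.
- exact: frt.
Qed.

(** After a turn starting from column k, column k + 1 is not visited again before
column k; otherwise the obstruction travels along the turn to the end column. *)
Lemma rturn_after k v a b y c : rturn k v -> col y = k.+1 ->
  fcw m (a ++ v ++ b ++ y :: c) -> avoids col k b -> False.
Proof.
move=> rv; elim: rv a b y c => {k v} [x e xn en ue se|k x v k0 xk rv IH] a b y c yk f ncb.
  rewrite prednK in yk; last by lia.
  wlog ncn : b y c yk f ncb / avoids col n b.
    move=> W; case/boolP: (avoids col n b); first exact: W f ncb.
    move=> /avoids_first[b1 [y' [b2 [eb y'n nb1]]]].
    apply: (W b1 y' (b2 ++ y :: c)) => //; first by move: f; rewrite eb; catn.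
    by move: ncb; rewrite eb avoids_cat => /andP[].
  have ye : y \in e by apply: full_end en ue se yk.
  have nce : avoids col n.-1 e.
    by apply: sub_all en => i /= /eqP ->; lia.
  apply: (@end_after a x e b y c n.-1) => //.
  - lia.
  - by rewrite yk /adj prednK ?eqxx //; lia.
  - by rewrite yk eqxx orbT.
  - by move: f; catn.
  - rewrite yk => /andP[_ /eqP c1]; split=> //.
    have -> : e = [:: y].
      case: e en se ye {f ue nce} => [|z [|z' e]]; rewrite c1 //= andbT => /eqP zn _.
      by rewrite inE => /eqP ->.
    by rewrite /= eqxx.
  - by apply/negP => /(allP ncn); rewrite yk eqxx.
have /andP[_ kn] := rturn_bound rv.
wlog nc1 : b y c yk f ncb / avoids col k.+1 b.
  move=> W; case/boolP: (avoids col k.+1 b); first exact: W f ncb.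
  move=> /avoids_first[b1 [y' [b2 [eb y'n nb1]]]].
  apply: (W b1 y' (b2 ++ y :: c)) => //; first by move: f; rewrite eb; catn.
  by move: ncb; rewrite eb avoids_cat => /andP[].
have [z [w [zk ev]]] := rturn_ends rv.
have zy : z = y by apply: (inner_inj L); rewrite zk ?yk //; lia.
subst z.
have nc2 : avoids col k.+2 b.
  apply/negPn/negP => /avoids_first[b1 [z [b2 [eb zk2 nb1]]]].
  apply: (IH (a ++ [:: x]) (x :: b1) z (b2 ++ y :: c) zk2).
    by move: f; rewrite eb; catn.
  by rewrite avoids_cons xk; move: nc1; rewrite eb avoids_cat => /andP[-> _]; lia.
apply: (@gap1 _ m (a ++ x :: y :: w) y [::] x b c) => //.
- by move: f; rewrite ev; catn.
- apply: (ladder_label3 L); rewrite ?yk ?xk /adj ?eqxx ?orbT //.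
    by rewrite inner_lone //; lia.
  by rewrite inner_lone //; lia.
- by apply: (avoids_commw L (k := k.+1)).
Qed.

(** The letters that may be moved past the letter of column k, because they lie in
neither column k nor a neighbouring one. *)
Definition far k g := [&& avoids col k.-1 g, avoids col k g & avoids col k.+1 g].

Lemma far_commw k x g : col x = k -> far k g -> commw m x g.
Proof. by move=> xk /and3P[k1 k2 k3]; apply: (avoids_commw L xk). Qed.

(** The letters off the turn are required to be far from column k: they can then be
moved past x, which lets turns at successive columns be nested. *)
Definition turn_at k := forall a x g b, col x = k -> fcw m (a ++ x :: g ++ x :: b) ->
  avoids col k.-1 g -> avoids col k g ->
  exists h1 v h2, [/\ rturn k v, ceq m (x :: rcons g x) (h1 ++ v ++ h2),
    far k h1 & far k h2].

(** After the turn between the first two occurrences of x, column k + 1 is not visited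
before x recurs (rturn_after), so nothing keeps the last two occurrences apart. *)
Lemma no_three_of_turn k a x g g' b : 0 < k < n -> turn_at k -> col x = k ->
  fcw m (a ++ x :: g ++ x :: g' ++ x :: b) ->
  avoids col k.-1 g -> avoids col k g -> avoids col k.-1 g' -> avoids col k g' -> False.
Proof.
move=> kn S xk f g1 g2 g'1 g'2.
have [h1 [v [h2 [rv e /and3P[h11 h12 h13] /and3P[h21 h22 h23]]]]] := S _ _ _ _ xk f g1 g2.
have f' : fcw m ((a ++ h1) ++ v ++ (h2 ++ g') ++ x :: b).
  apply: (fcw_ceq _ f).
  have -> : a ++ x :: g ++ x :: g' ++ x :: b = a ++ (x :: rcons g x) ++ g' ++ x :: b by catn.
  rewrite -!catA; apply: ceq_catl; rewrite !catA; do 2!apply: ceq_catr.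
  by rewrite -!catA.
have nc1 : avoids col k.+1 g'.
  apply/negPn/negP => /avoids_first[b1 [y [b2 [eb yk nb1]]]].
  apply: (rturn_after (a := a ++ h1) (b := h2 ++ b1) (c := b2 ++ x :: b) rv yk).
    by move: f'; rewrite eb; catn.
  by rewrite avoids_cat h22; move: g'2; rewrite eb avoids_cat => /andP[].
have [z [w [zk ev]]] := rturn_ends rv.
have zx : z = x by apply: (inner_inj L); rewrite zk ?xk //; lia.
subst z; apply: (@gap0 _ m ((a ++ h1) ++ x :: w) x (h2 ++ g') b).
  by move: f'; rewrite ev; catn.
by rewrite commw_cat !(avoids_commw L xk).
Qed.

(** Only letters of column n - 1 can keep two equal letters of column n apart. *)
Lemma seg_end_uniq a g b : fcw m (a ++ g ++ b) -> avoids col n.-1 g ->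
  uniq (filter (fun i => col i == n) g).
Proof.
move=> /fcw_factor; elim: g => //= i g IH f /andP[_ ng].
have {}IH : uniq (filter (fun i => col i == n) g).
  by apply: IH => //; apply: (@fcw_factor _ _ [:: i] g [::]); rewrite cats0.
case: eqP => //= icol; rewrite IH andbT mem_filter icol eqxx /=.
apply/negP => ig; have : has (pred1 i) g by rewrite has_pred1.
case/split_first=> g1 [j [g2 [eg /eqP ji]]]; rewrite has_pred1 => ig1; subst j.
apply: (@gap0 _ m [::] i g1 g2); first by rewrite -eg.
apply/allP => j jg; rewrite (ladder_commute L) icol.
have -> /= : i != j by apply: contraNneq ig1 => ->.
have : col j != n.-1 by apply: (allP ng); rewrite eg mem_cat jg.
by have := ladder_le L j; rewrite /adj; lia.
Qed.

(** By induction from column n - 1 downwards.  For k + 1 < n no label 4 is involved, so the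
letter of column k + 1 occurs at least twice between the two occurrences of x; by
no_three_of_turn it occurs exactly twice, and the turn between these two is enclosed
by the two occurrences of x. *)
Lemma turn_atP k : 0 < k < n -> turn_at k.
Proof.
have [d] := ubnP (n - k); elim: d k => // d IHd k nkd kn a x g b xk f gk1 gk.
have [kn1|kn1] := eqVneq k n.-1.
  rewrite kn1 in xk gk gk1 kn *; pose e := filter (fun i => col i == n) g; pose h := filter (fun i => col i != n) g.
  have ue : uniq e.
    apply: (@seg_end_uniq (a ++ [:: x]) g (x :: b)) => //.
    by move: f; catn.
  have ge : ceq m g (h ++ e).
    apply: ceq_trans (ceq_partition (ladder_sym L) (p := fun i => col i != n) _) _.
      move=> i j ig jg; case: (col j =P n) => // jn icol _.
      apply/eqP; rewrite (ladder_commute L) jn; have := allP gk i ig => iH.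
      have -> /= : i != j by apply: contraNneq icol => ->; apply/eqP.
      by have := ladder_le L i; rewrite /adj; lia.
    by apply: ceq_catl; rewrite /e (eq_filter (a2 := predC (fun i => col i != n)));
      [exact: ceq_refl | move=> i /=; rewrite negbK].
  have fh : far n.-1 h.
    have hg l : avoids col l g -> avoids col l h.
      by apply: avoids_sub => i; rewrite mem_filter => /andP[].
    apply/and3P; split; [exact: (hg _ gk1) | exact: (hg _ gk) |].
    rewrite prednK ?(ltnW ngt1) //.
    by apply/allP => i; rewrite mem_filter => /andP[].
  exists h, (x :: rcons e x), [::]; split=> //.
    apply: RTurnEnd => //; first by apply/allP => i; rewrite mem_filter => /andP[].
    have : 0 < size e.
      rewrite size_filter -has_count; apply/negP => /negP ne.
      apply: (gap0 f); apply: (avoids_commw L xk) => //.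
      rewrite prednK ?(ltnW ngt1) //; apply/allP => i ig; apply: contra ne => /eqP ik.
      by apply/hasP; exists i => //; apply/eqP.
    have le2 := ladder_size L (leqnn n).
    have : size e <= colsize col n.
      rewrite -(card_uniqP ue); apply/subset_leq_card/subsetP => i.
      by rewrite mem_filter inE => /andP[].
    suff : colsize col n = 2 -> size e <> 1 by lia.
    move=> c2 e1; have f' : fcw m (a ++ x :: (h ++ e) ++ x :: b).
      by apply: fcw_ceq f; apply: ceq_catl; apply: ceq_cons; apply: ceq_catr.
    have en : all (fun i => col i == n) e.
      by apply/allP => i; rewrite mem_filter => /andP[].
    case: e e1 en f' {ge ue} => [|y [|]] //= _; rewrite andbT => /eqP yn f'.
    apply: (@gap1 _ m a x h y [::] b) => //.
    - by move: f'; catn.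
    - apply: (ladder_label3 L); first by rewrite xk yn /adj prednK ?eqxx // ltnW.
        by rewrite xk inner_lone.
      by rewrite /lone yn c2 andbF.
    - exact: far_commw fh.
  rewrite cats0; apply: (@ceq_trans _ _ _ (x :: h ++ e ++ [:: x])).
    by apply: ceq_cons; rewrite -cats1 catA; apply: ceq_catr.
  by rewrite cats1; apply: ceq_move1; apply: far_commw fh.
have [y yk] := col_ex L (k := k.+1) (ltac:(lia)).
have kn' : 0 < k.+1 < n by lia.
have S := IHd k.+1 (ltac:(lia)) kn'.
have kltn : lone col n k = false by apply: inner_lone.
have k1ltn : lone col n k.+1 = false by apply: inner_lone.
have [|g1 [y1 [g2 [y2 [g3 [eg m1 m2 f1 f2]]]]]] := gap_two f.
  move=> j jg; have jk : col j != k := allP gk j jg.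
  have jk1 : col j != k.-1 := allP gk1 j jg.
  case: (eqVneq (col j) k.+1) => jk2.
    by right; apply: (ladder_label3 L); rewrite ?xk ?jk2 /adj ?eqxx ?kltn ?k1ltn.
  left; apply/eqP; rewrite (ladder_commute L) xk /adj; apply/andP; split; last by lia.
  by apply: contraNneq jk => <-; rewrite xk.
have nby j : j \in g -> m x j = 3 -> j = y.
  move=> jg mj; have jk : col j != k := allP gk j jg.
  have jk1 : col j != k.-1 := allP gk1 j jg.
  have : m x j != 2 by rewrite mj.
  rewrite (ladder_commute L) xk /adj; have -> /= : x != j.
    by apply: contraNneq jk => <-; rewrite xk.
  move=> h; apply: (inner_inj L); last by rewrite yk; lia.
  by lia.
have y1y : y1 = y by apply: nby => //; rewrite eg !(mem_cat, inE) eqxx !orbT.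
have y2y : y2 = y by apply: nby => //; rewrite eg !(mem_cat, inE) eqxx !orbT.
subst y1 y2; rewrite eg in gk gk1 f.
move: gk gk1; rewrite !(avoids_cat, avoids_cons) => /and5P[k1 yk0 k2 _ k3] /and5P[l1 yl0 l2 _ l3].
have cf h : avoids col k h -> commw m x h -> avoids col k.+1 h.
  move=> /allP nk /allP ch; apply/allP => j jh; apply/eqP => jk.
  have := ch j jh; rewrite (ladder_commute L) xk jk /adj eqxx andbF //.
have c2 : avoids col k.+1 g2 by apply: cf.
have c1 : avoids col k.+1 g1 by apply: cf.
have c3 : avoids col k.+1 g3.
  apply/negPn/negP => /avoids_first[g4 [y' [g5 [eg3 y'k ng4]]]].
  have y'y : y' = y by apply: (inner_inj L); rewrite y'k.
  subst y'; apply: (@no_three_of_turn k.+1 (a ++ x :: g1) y g2 g4 (g5 ++ x :: b) kn' S yk) => //.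
    by move: f; rewrite eg3; catn.
  by move: k3; rewrite eg3 avoids_cat => /andP[].
have [|h1 [v [h2 [rv e /and3P[h11 h12 h13] /and3P[h21 h22 h23]]]]] :=
    S (a ++ x :: g1) y g2 (g3 ++ x :: b) yk _ k2 c2.
  by move: f; catn.
have hsub i : i \in h1 ++ h2 -> (i == y) || (i \in g2).
  move=> ih; have : i \in y :: rcons g2 y.
    rewrite (perm_mem (ceq_perm e)) !mem_cat; move: ih; rewrite mem_cat.
    by case/orP => ->; rewrite ?orbT.
  by rewrite inE mem_rcons inE; case/orP => [->//|]; rewrite orbC.
have hl l : avoids col l g2 -> col y != l -> avoids col l (h1 ++ h2).
  move=> ng2 yl; apply/allP => i /hsub /orP[/eqP -> //|]; exact: (allP ng2).
have hl0 := hl _ l2 yl0; have hk0 := hl _ k2 yk0.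
move: hl0 hk0; rewrite !avoids_cat => /andP[h1l h2l] /andP[h1k h2k].
exists (g1 ++ h1), (x :: rcons v x), (h2 ++ g3); split.
- by apply: RTurnStep => //; case/andP: kn.
- apply: (@ceq_trans _ _ _ (x :: (g1 ++ h1) ++ v ++ (h2 ++ g3) ++ [:: x])).
    apply: ceq_cons; rewrite eg -!cats1; do 2![catn].
    apply: ceq_catl; rewrite -cat_cons; have := ceq_catr (g3 ++ [:: x]) e; by catn.
  have fx h : avoids col k.-1 h -> avoids col k h -> avoids col k.+1 h -> commw m x h.
    by move=> ? ? ?; apply: (avoids_commw L xk).
  rewrite -cats1; catn.
  apply: ceq_trans (ceq_move1 _ _) _; first by apply: fx.
  apply: ceq_catl; apply: ceq_trans (ceq_move1 _ _) _; first by apply: fx.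
  apply: ceq_catl; apply: ceq_cons; apply: ceq_catl; have := @commw_ceq _ m x (h2 ++ g3) [::].
  by rewrite cats0 -!catA; apply; rewrite commw_cat !fx.
- by rewrite /far !avoids_cat l1 k1 c1 h1l h1k h12.
- by rewrite /far !avoids_cat l3 k3 c3 h2l h2k h22.
Qed.

End Turns.

(** * Long words visit every column often *)

Definition cnt (I : Type) (col : I -> nat) k (r : seq I) := count (fun i => col i == k) r.

(** The word is cut into segments at its letters with p. *)
Lemma count_segments (T : Type) (p q : pred T) B (r : seq T) :
  (forall x, p x -> ~~ q x) ->
  (forall a g b, r = a ++ g ++ b -> ~~ has p g -> count q g <= B) ->
  count q r <= B * (count p r).+1.
Proof.
move=> pq; have [l] := ubnP (size r); elim: l r => // l IH r rl seg.
have [|np] := boolP (has p r); last first.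
  have := seg [::] r [::]; rewrite cats0 /= => /(_ erefl np) le.
  by apply: leq_trans le _; rewrite leq_pmulr.
case/split_first=> r1 [x [r2 [er px np]]].
have le1 : count q r1 <= B by apply: (seg [::] r1 (x :: r2)).
have le2 : count q r2 <= B * (count p r2).+1.
  apply: IH; first by move: rl; rewrite er size_cat /=; lia.
  by move=> a g b e; apply: (seg (r1 ++ x :: a) g b); rewrite er e -catA.
have cp : 1 + count p r2 <= count p r by rewrite er count_cat /= px; lia.
have cq : count q r = count q r1 + count q r2.
  by rewrite er count_cat /= (negPf (pq _ px)).
apply: leq_trans (_ : B * (1 + count p r2).+1 <= _); last by rewrite leq_mul2l ltnS cp orbT.
by rewrite cq add1n mulnS leq_add.
Qed.

Section Counts.
Variables (I : finType) (m : I -> I -> nat) (n : nat) (col : I -> nat).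
Hypothesis L : ladder m n col.

Lemma has_avoids k (g : seq I) : has (fun i => col i == k) g = ~~ avoids col k g.
Proof. by rewrite -has_predC; apply: eq_has => i /=; rewrite negbK. Qed.

(** Three visits of an inner column would contradict no_three_of_turn, and the last
column contributes distinct letters only. *)
Lemma segment_count a g b k : k < n -> fcw m (a ++ g ++ b) -> avoids col k g ->
  cnt col k.+1 g <= 2.
Proof.
move=> kn f gk; have [kn1|kn1] := eqVneq k.+1 n.
  have ek : k = n.-1 by rewrite -kn1.
  subst k; have ue := seg_end_uniq L f gk; rewrite kn1 /cnt -size_filter -(card_uniqP ue).
  have /andP[_ le2] := ladder_size L (leqnn n); apply: leq_trans le2.
  by apply/subset_leq_card/subsetP => i; rewrite mem_filter inE => /andP[].
rewrite leqNgt; apply/negP => c3; set p := fun i => col i == k.+1 in c3.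
have h1 : has p g by rewrite has_count; move: c3; rewrite /cnt -/p; lia.
case/split_first: h1 => g1 [x [g' [eg /eqP xk]]]; rewrite has_avoids negbK => ng1.
have c2 : 1 < count p g'.
  move: c3; rewrite /cnt -/p eg count_cat /=.
  have -> : count p g1 = 0 by apply/eqP; rewrite -leqn0 leqNgt -has_count has_avoids negbK.
  by lia.
have h2 : has p g' by rewrite has_count; lia.
case/split_first: h2 => g2 [x2 [g'' [eg' /eqP xk2]]]; rewrite has_avoids negbK => ng2.
have h3 : has p g''.
  move: c2; rewrite eg' count_cat /= has_count.
  have -> : count p g2 = 0 by apply/eqP; rewrite -leqn0 leqNgt -has_count has_avoids negbK.
  by lia.
case/split_first: h3 => g3 [x3 [g4 [eg'' /eqP xk3]]]; rewrite has_avoids negbK => ng3.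
have kn' : 0 < k.+1 < n by lia.
have e2 : x2 = x by apply: (inner_inj L); rewrite xk2.
have e3 : x3 = x by apply: (inner_inj L); rewrite xk3.
subst x2 x3; move: gk; rewrite eg eg' eg'' !(avoids_cat, avoids_cons).
move=> /and3P[_ _ /and3P[k2 _ /and3P[k3 _ _]]].
apply: (@no_three_of_turn _ _ _ _ L k.+1 (a ++ g1) x g2 g3 (g4 ++ b)) => //.
  exact: turn_atP.
by move: f; rewrite eg eg' eg''; catn.
Qed.

Lemma count_up r k : k < n -> fcw m r -> cnt col k.+1 r <= 2 * (cnt col k r).+1.
Proof.
move=> kn f; apply: count_segments; first by move=> i /eqP ->; lia.
move=> a g b e; rewrite has_avoids negbK; apply: (@segment_count a g b) => //.
by rewrite -e.
Qed.

Lemma size_cnt r : size r = \sum_(k < n.+1) cnt col k r.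
Proof.
elim: r => [|i r IHr] /=; first by rewrite big1.
rewrite IHr -add1n big_split /=; congr (_ + _).
have ci : col i < n.+1 := ladder_le L i.
rewrite (bigD1 (Ordinal ci)) //= eqxx big1 // => k /eqP ki.
by apply/eqP; rewrite eqb0; apply/negP => /eqP e; apply: ki; apply: val_inj.
Qed.

Lemma cnt_mirror k r : k <= n -> cnt (mirror n col) (n - k) r = cnt col k r.
Proof.
by move=> kn; apply: eq_count => i; rewrite /mirror; have := ladder_le L i; lia.
Qed.

Lemma avoids_mirror k g : k <= n -> avoids (mirror n col) (n - k) g = avoids col k g.
Proof.
by move=> kn; apply: eq_all => i; rewrite /mirror; have := ladder_le L i; lia.
Qed.
End Counts.

Section Counts2.
Variables (I : finType) (m : I -> I -> nat) (n : nat) (col : I -> nat).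
Hypothesis L : ladder m n col.

Lemma count_down r k : k < n -> fcw m r -> cnt col k r <= 2 * (cnt col k.+1 r).+1.
Proof.
move=> kn f; have := @count_up _ _ _ _ (ladder_mirror L) r (n - k.+1).
rewrite -subSn // subSS !(cnt_mirror L) //; last exact: ltnW.
by apply=> //; lia.
Qed.

(** Some bound that forces several visits of the columns 1 and n - 1. *)
Definition long (r : seq I) := n.+1 * (2 ^ n.+1 + 6) < size r.

(** By count_up the numbers of visits grow at most geometrically away from column 1, so
few visits of column 1 would bound the length of the word. *)
Lemma long_cnt1 r : long r -> fcw m r -> 2 < cnt col 1 r.
Proof.
move=> lr f; rewrite ltnNge; apply/negP => c1; move: lr; rewrite /long ltnNge => /negP; apply.
have ngt1 := ladder_n L.
have up k : k < n -> cnt col k.+1 r + 2 <= 2 ^ k.+2.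
  elim: k => [|k IHk] kn; first by rewrite (leq_add2r 2 _ 2).
  have cu := count_up L kn f; have := IHk (ltnW kn).
  by rewrite (expnS 2 k.+2); lia.
have all_le (k : ordinal n.+1) : cnt col k r <= 2 ^ n.+1 + 6.
  case: k => [[|k] kn] /=; first by have := count_down (ltnW ngt1) f; lia.
  have := up k kn; have : 2 ^ k.+2 <= 2 ^ n.+1 by rewrite leq_exp2l.
  by lia.
rewrite (size_cnt L) -[X in _ <= X * _]card_ord -sum_nat_const.
by apply: leq_sum.
Qed.
End Counts2.

Section Counts3.
Variables (I : finType) (m : I -> I -> nat) (n : nat) (col : I -> nat).
Hypothesis L : ladder m n col.

Lemma long_cntn r : long n r -> fcw m r -> 2 < cnt col n.-1 r.
Proof.
move=> lr f; have ngt1 := ladder_n L.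
have := long_cnt1 (ladder_mirror L) lr f; have -> : 1 = n - n.-1 by lia.
by rewrite (cnt_mirror L) //; lia.
Qed.
End Counts3.

(** * Alternating words *)

Section SortedFilter.
Variable T : Type.

Lemma sorted_mid (e : rel T) a x y b : sorted e (a ++ x :: y :: b) -> e x y.
Proof. by case: a => [|z a] /=; rewrite ?cat_path /=; [case/andP|case/and4P]. Qed.

Lemma not_sorted (e : rel T) s : ~~ sorted e s ->
  exists a x y b, s = a ++ x :: y :: b /\ ~~ e x y.
Proof.
elim: s => // x [|y s] IH //=; case exy: (e x y) => /= h; last first.
  by exists [::], x, y, s; rewrite exy.
by have [a [z [t [b [-> ezt]]]]] := IH h; exists (x :: a), z, t, b.
Qed.

Lemma filter_cons_split (p : pred T) r x s : filter p r = x :: s ->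
  exists g b, [/\ r = g ++ x :: b, ~~ has p g & filter p b = s].
Proof.
elim: r => //= y r IH; case py: (p y); first by case=> <- <-; exists [::], r.
move=> /IH[g [b [-> ng fb]]].
by exists (y :: g), b; rewrite /= py.
Qed.

Lemma filter_split (p : pred T) r s x y t : filter p r = s ++ x :: y :: t ->
  exists a g b, [/\ r = a ++ x :: g ++ y :: b, ~~ has p g, p x & p y].
Proof.
move=> e; have px : p x && p y.
  by have := filter_all p r; rewrite e all_cat /= => /and4P[_ -> ->].
case/andP: px => px py.
elim: s r e => [|z s IH] r e.
  have [a [r' [-> na /filter_cons_split[g [b [-> ng _]]]]]] := filter_cons_split e.
  by exists a, g, b.
have [h [r' [-> _ /IH[a [g [b [-> ng _ _]]]]]]] := filter_cons_split e.
by exists (h ++ z :: a), g, b; rewrite -catA.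
Qed.
End SortedFilter.

Definition colpair (I : Type) (col : I -> nat) k (i : I) := (col i == k) || (col i == k.+1).

(** Neighbouring columns alternate, and so do the two letters of an end column. *)
Definition altw (I : finType) (n : nat) (col : I -> nat) (r : seq I) : Prop :=
  (forall k, k < n -> sorted (fun i j => adj (col i) (col j)) (filter (colpair col k) r)) /\
  (forall k, (k == 0) || (k == n) -> colsize col k = 2 ->
    sorted (fun i j => i != j) (filter (fun i => col i == k) r)).

(** A visit of the whole column 0 between two occurrences of the letter of column 1,
which separates these two occurrences also from column 2 if column 0 is lone. *)
Definition leftfull (I : finType) (n : nat) (col : I -> nat) (r : seq I) : Prop :=
  exists a x g b, [/\ r = a ++ x :: g ++ x :: b, col x = 1, avoids col 1 g,
    (forall t, col t = 0 -> t \in g) & (lone col n 0 -> avoids col 2 g)].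

Lemma leftfull_rev (I : finType) n (col : I -> nat) r :
  leftfull n col (rev r) -> leftfull n col r.
Proof.
move=> [a [x [g [b [er x1 g1 gt g2]]]]]; exists (rev b), x, (rev g), (rev a); split=> //.
- by rewrite -[r]revK er; rewrite !(rev_cat, rev_cons) -!cats1; catn.
- by rewrite avoids_rev.
- by move=> t /gt; rewrite mem_rev.
- by rewrite avoids_rev.
Qed.

Section Rigid.
Variables (I : finType) (m : I -> I -> nat).
Hypothesis m_sym : forall i j, m i j = m j i.

(** No commutation applies to such a word. *)
Lemma ceq_rigid w w' : sorted (fun i j => m i j != 2) w -> ceq m w w' -> w = w'.
Proof.
pose st := sorted (fun i j => m i j != 2).
suff H v v' : ceq m v v' -> st v \/ st v' -> v = v' by move=> sw /H; apply; left.
move: v v'; apply: ceq_ind2 => // [r s IH|r s t IH1 IH2|a b i j mij].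
- by move=> h; rewrite IH //; case: h; [right|left].
- case=> [sr|sq].
    by have rs := IH1 (or_introl sr); rewrite rs; apply: IH2; left; rewrite -rs.
  by have rs := IH2 (or_intror sq); rewrite -rs; apply: IH1; right; rewrite rs.
- by case=> h; have := sorted_mid h; rewrite ?mij // m_sym mij.
Qed.
End Rigid.

Section Alt.
Variables (I : finType) (m : I -> I -> nat) (n : nat) (col : I -> nat).
Hypothesis L : ladder m n col.
Let ngt1 : 1 < n := ladder_n L.

Lemma altw_filter r r' k : altw n col r -> ceq m r r' -> k < n ->
  filter (colpair col k) r = filter (colpair col k) r'.
Proof.
move=> [ar _] rr' kn; apply: (@ceq_rigid _ m (ladder_sym L)); last exact: ceq_filter.
by apply: sub_sorted (ar k kn) => i j a; rewrite (ladder_commute L) a andbF.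
Qed.

Lemma filter_col_pair k l r : (k == l) || (k == l.+1) ->
  filter (fun i => col i == k) r =
  filter (fun i => col i == k) (filter (colpair col l) r).
Proof.
move=> kl; rewrite -filter_predI; apply: eq_filter => i /=; rewrite /colpair.
by case: eqP => //= ->.
Qed.

Lemma altw_ceq r r' : altw n col r -> ceq m r r' -> altw n col r'.
Proof.
move=> ar rr'; split=> [k kn|k ke c2]; first by rewrite -(altw_filter ar rr' kn); apply: (ar.1).
have [l ln kl] : exists2 l, l < n & (k == l) || (k == l.+1).
  by exists (minn k n.-1); lia.
by rewrite (filter_col_pair _ kl) -(altw_filter ar rr' ln) -filter_col_pair //; apply: ar.2.
Qed.

(** The letter i would recur without the column on its other side in between. *)
Lemma altw_no_iji a b i j : adj (col i) (col j) -> 0 < col i < n ->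
  altw n col (a ++ i :: j :: i :: b) -> False.
Proof.
move=> aij ci [h _].
have [l ln [il jl]] : exists2 l, l < n & colpair col l i /\ ~~ colpair col l j.
  have [e|e] := eqVneq (col i).+1 (col j).
    by exists (col i).-1; rewrite /colpair; [|split]; lia.
  by exists (col i); move: aij; rewrite /colpair /adj; [|split]; lia.
have := h l ln; rewrite filter_cat /= il (negPf jl) => sh; have {sh} := sorted_mid sh.
by rewrite /adj; lia.
Qed.

(** A factor i j i is only possible with i in an end column of a single letter, where
the label is 4; in i j i j the letter j would violate altw_no_iji. *)
Lemma altw_fcw r : altw n col r -> fcw m r.
Proof.
move=> ar r' rr'; have {r rr' ar}ar' := altw_ceq ar rr'; split=> [a b i e|a b i j mij e]; subst r'.
  have [l ln kl] : exists2 l, l < n & (col i == l) || (col i == l.+1).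
    by exists (minn (col i) n.-1); have := ladder_le L i; lia.
  have := ar'.1 l ln; rewrite filter_cat /= [colpair _ _ _]kl => sh; have {sh} := sorted_mid sh.
  by rewrite /adj; lia.
have aij : adj (col i) (col j).
  by move: mij; rewrite (ladder_m L); case: eqP => // _; case: ifP.
have [k mk] : exists k, m i j = k.+3 by exists (m i j - 3); lia.
rewrite mk /= in ar'; have [ci|ci] := boolP (0 < col i < n).
  exact: altw_no_iji aij ci ar'.
have ie : (col i == 0) || (col i == n) by have := ladder_le L i; lia.
have [lo|lo] := boolP (lone col n (col i)).
  have e4 : m i j = 4 by apply: (ladder_label4 L); rewrite ?lo.
  have k1 : k = 1 by lia.
  rewrite k1 /= in ar'; apply: (@altw_no_iji (a ++ [:: i]) b j i).
  - by rewrite adj_sym.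
  - by move: aij ie; rewrite /adj; have := ladder_le L j; lia.
  - by rewrite -catA.
have c2 : colsize col (col i) = 2.
  by move: lo; rewrite /lone ie /=; have := ladder_size L (ladder_le L i); lia.
have := ar'.2 _ ie c2; rewrite filter_cat /= eqxx.
have -> : col j == col i = false by move: aij; rewrite /adj; lia.
by move=> sh; have := sorted_mid sh; rewrite eqxx.
Qed.

(** * Words that do not alternate *)

Lemma commw_end i k g : (col i == 0) || (col i == n) -> adj (col i) k -> 0 < k < n ->
  avoids col k g -> i \notin g -> commw m i g.
Proof.
move=> ie ik kn /allP gk ig; apply/allP => j jg; rewrite (ladder_commute L).
have -> /= : i != j by apply: contraNneq ig => ->.
by have := gk j jg; have := ladder_le L j; move: ie ik; rewrite /adj; lia.
Qed.

Lemma commw_avoids x g l : commw m x g -> adj (col x) l -> avoids col l g.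
Proof.
move=> /allP xg al; apply/allP => j /xg; rewrite (ladder_commute L) => /andP[_].
by apply: contra => /eqP ->.
Qed.

(** If the letter x recurs before column k + 1 is visited, then so does, in between,
the letter of column k - 1, and so on down to column 1. *)
Lemma descend_left k a x g b : 0 < k < n -> col x = k -> fcw m (a ++ x :: g ++ x :: b) ->
  avoids col k g -> avoids col k.+1 g -> leftfull n col (a ++ x :: g ++ x :: b).
Proof.
elim: k a x g b => // k IHk a x g b kn xk f gk gk1.
have lx : lone col n k.+1 = false by apply: inner_lone.
have [k0|k0] := posnP k.
  subst k; have only j : j \in g -> m x j != 2 -> col j = 0.
    move=> jg; rewrite (ladder_commute L) negb_and negbK xk /adj.
    by have := allP gk j jg; have := allP gk1 j jg; case: (eqVneq x j) => [<-|_] /=; rewrite ?xk; lia.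
  exists a, x, g, b; split=> //.
  move=> t t0; have [c1|c1] := eqVneq (colsize col 0) 1.
    have : ~~ commw m x g by apply/negP => /(gap0 f).
    case/commw_first=> g1 [y [g2 [eg my _]]].
    have yg : y \in g by rewrite eg mem_cat mem_head orbT.
    by rewrite (@col1_inj _ col t y) ?t0 // (only y).
  have lo : lone col n 0 = false by rewrite /lone (negPf c1) andbF.
  have [|g1 [y [g2 [y' [g3 [eg my my' _ f2]]]]]] := gap_two f.
    move=> j jg; case: (eqVneq (m x j) 2) => [->|mj]; first by left.
    by right; apply: (ladder_label3 L); rewrite ?xk ?(only j jg mj) ?lo ?lx.
  have yg : y \in g by rewrite eg mem_cat mem_head orbT.
  have y'g : y' \in g by rewrite eg mem_cat inE mem_cat mem_head !orbT.
  have y0 : col y = 0 by apply: only; rewrite ?my.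
  have y'0 : col y' = 0 by apply: only; rewrite ?my'.
  have yy' : y != y'.
    apply/eqP => e; subst y'.
    apply: (@gap0 _ m (a ++ x :: g1) y g2 (g3 ++ x :: b)).
      by move: f; rewrite eg; catn.
    have n0 : avoids col 0 g2 by apply: commw_avoids f2 _; rewrite xk.
    apply: (avoids_commw L y0) => //.
    by move: gk; rewrite eg !(avoids_cat, avoids_cons) => /and3P[_ _ /andP[]].
  by case: (@col2 _ _ _ _ L y y' t yy'); rewrite ?y0 // => ->.
have only j : j \in g -> m x j != 2 -> col j = k.
  move=> jg; rewrite (ladder_commute L) negb_and negbK xk /adj.
  by have := allP gk j jg; have := allP gk1 j jg; case: (eqVneq x j) => [<-|_] /=; rewrite ?xk; lia.
have lk : lone col n k = false by apply: inner_lone; lia.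
have [|g1 [y [g2 [y' [g3 [eg my my' _ f2]]]]]] := gap_two f.
  move=> j jg; case: (eqVneq (m x j) 2) => [->|mj]; first by left.
  right; apply: (ladder_label3 L); rewrite ?xk ?(only j jg mj) ?lk ?lx //.
  by rewrite /adj eqxx orbT.
have yg : y \in g by rewrite eg mem_cat mem_head orbT.
have y'g : y' \in g by rewrite eg mem_cat inE mem_cat mem_head !orbT.
have yk : col y = k by apply: only; rewrite ?my.
have y'k : col y' = k by apply: only; rewrite ?my'.
have e : y' = y by apply: (inner_inj L); rewrite y'k ?yk //; lia.
subst y'; have := IHk (a ++ x :: g1) y g2 (g3 ++ x :: b).
rewrite eg; catn; apply => //.
- by lia.
- by move: f; rewrite eg; catn.
- by apply: commw_avoids f2 _; rewrite xk /adj eqxx orbT.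
- by move: gk; rewrite eg !(avoids_cat, avoids_cons) => /and3P[_ _ /andP[]].
Qed.

End Alt.

Section Deviations.
Variables (I : finType) (m : I -> I -> nat) (n : nat) (col : I -> nat).
Hypothesis L : ladder m n col.
Let ngt1 : 1 < n := ladder_n L.
Let L' : ladder m n (mirror n col) := ladder_mirror L.

Lemma mirrorK : mirror n (mirror n col) = col.
Proof. by apply: funext => i; rewrite /mirror subKn // (ladder_le L). Qed.

Lemma descend_right k a x g b : 0 < k < n -> col x = k -> fcw m (a ++ x :: g ++ x :: b) ->
  avoids col k g -> avoids col k.-1 g -> leftfull n (mirror n col) (a ++ x :: g ++ x :: b).
Proof.
move=> kn xk f gk gk1; apply: (descend_left L' (k := n - k)) => //.
- by lia.
- by rewrite /mirror xk.
- by rewrite (avoids_mirror L) //; lia.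
- by rewrite (_ : (n - k).+1 = n - k.-1) ?(avoids_mirror L) //; lia.
Qed.

Section TwoEnd.
Variables (a g b : seq I) (i j : I).
Hypothesis f : fcw m (a ++ i :: g ++ j :: b).
Hypotheses (i0 : col i = 0) (j0 : col j = 0) (g0 : avoids col 0 g) (g1 : avoids col 1 g).
Hypothesis nR : ~ leftfull n (mirror n col) (a ++ i :: g ++ j :: b).

Let ce k h : col k = 0 -> avoids col 1 h -> k \notin h -> commw m k h.
Proof. by move=> k0; apply: (commw_end L) => //; rewrite ?k0. Qed.

Let notin0 k h : avoids col 0 h -> col k = 0 -> k \notin h.
Proof. by move=> /allP h0 k0; apply/negP => /h0; rewrite k0. Qed.

Lemma two_end_neq : i != j.
Proof.
apply/eqP => ij; have f' := f; rewrite -ij in f'; apply: (gap0 f').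
by apply: ce => //; apply: notin0.
Qed.

Let c2 : colsize col 0 = 2.
Proof. by have [] := col_pair L two_end_neq _; rewrite i0 ?j0. Qed.

Let lo : lone col n 0 = false.
Proof. by rewrite /lone c2 andbF. Qed.

Lemma two_end_letters t : col t = 0 -> t = i \/ t = j.
Proof. by move=> t0; apply: (col2 L two_end_neq); rewrite i0 ?j0. Qed.

(** Between two later visits of column 1 the word would either turn at column n, which
is excluded by nR, or return to the letter i or j and close a factor t x t with
label 3. *)
Lemma two_end_after : cnt col 1 b <= 1.
Proof.
rewrite leqNgt; apply/negP => cb.
have : has (fun k => col k == 1) b by rewrite has_count; exact: ltnW cb.
case/split_first=> b1 [x [b' [eb /eqP x1]]]; rewrite has_avoids negbK => b11.
have : has (fun k => col k == 1) b'.
  move: cb; rewrite /cnt eb count_cat /= x1 eqxx has_count.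
  have -> : count (fun k => col k == 1) b1 = 0.
    by apply/eqP; rewrite -leqn0 leqNgt -has_count has_avoids negbK.
  by lia.
case/split_first=> b2 [x' [b3 [eb' /eqP x'1]]]; rewrite has_avoids negbK => b21.
have ex : x' = x by apply: (inner_inj L); rewrite x'1.
subst x'; have ij := two_end_neq.
have ib1 : i \notin b1.
  apply/negP => ib; have : has (pred1 i) b1 by rewrite has_pred1.
  case/split_first=> c [k [c' [eb1 /eqP ki]]]; rewrite has_pred1 => ic; subst k.
  apply: (@gap0 _ m a i (g ++ j :: c) (c' ++ x :: b')).
    by move: f; rewrite eb eb1; catn.
  apply: ce => //; last by rewrite mem_cat inE negb_or (notin0 g0 i0) negb_or ij.
  by rewrite avoids_cat avoids_cons g1 j0; move: b11; rewrite eb1 avoids_cat => /andP[-> _].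
have jb1 : j \notin b1.
  apply/negP => jb; have : has (pred1 j) b1 by rewrite has_pred1.
  case/split_first=> c [k [c' [eb1 /eqP kj]]]; rewrite has_pred1 => jc; subst k.
  apply: (@gap0 _ m (a ++ i :: g) j c (c' ++ x :: b')).
    by move: f; rewrite eb eb1; catn.
  by apply: ce => //; move: b11; rewrite eb1 avoids_cat => /andP[-> _].
have [b20|] := boolP (avoids col 0 b2).
  apply: nR; rewrite eb eb'.
  have := @descend_right 1 (a ++ i :: g ++ j :: b1) x b2 b3.
  by catn; apply => //; move: f; rewrite eb eb'; catn.
case/avoids_first=> c [t [c' [eb2 t0 c0]]].
have mt : m t x = 3 by apply: (ladder_label3 L); rewrite ?t0 ?x1 // ?lo // inner_lone.
have c1 : avoids col 1 c by move: b21; rewrite eb2 avoids_cat => /andP[].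
case: (two_end_letters t0) => et; subst t.
  apply: (@gap1 _ m a i (g ++ j :: b1) x c (c' ++ x :: b3)) => //.
  - by move: f; rewrite eb eb' eb2; catn.
  - apply: ce => //; first by rewrite avoids_cat avoids_cons g1 j0.
    by rewrite mem_cat inE negb_or (notin0 g0 i0) negb_or ij.
  - by apply: ce => //; apply: notin0.
apply: (@gap1 _ m (a ++ i :: g) j b1 x c (c' ++ x :: b3)) => //.
- by move: f; rewrite eb eb' eb2; catn.
- exact: ce.
- by apply: ce => //; apply: notin0.
Qed.
End TwoEnd.

(** By two_end_after, applied to the word and to its reverse, column 1 is visited once
after and once before the letters i and j; so column 0 is fully visited between two
visits of column 1. *)
Lemma two_end a g b i j : fcw m (a ++ i :: g ++ j :: b) -> col i = 0 -> col j = 0 ->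
  avoids col 0 g -> avoids col 1 g -> 1 < cnt col 1 (a ++ i :: g ++ j :: b) ->
  ~ leftfull n col (a ++ i :: g ++ j :: b) ->
  ~ leftfull n (mirror n col) (a ++ i :: g ++ j :: b) -> False.
Proof.
move=> f i0 j0 g0 g1 c1 nL nR.
have ij := two_end_neq f i0 g0 g1.
have cb := two_end_after f i0 j0 g0 g1 nR.
have er : rev b ++ j :: rev g ++ i :: rev a = rev (a ++ i :: g ++ j :: b).
  by rewrite !(rev_cat, rev_cons) -!cats1; catn.
have ca : cnt col 1 a <= 1.
  rewrite /cnt -count_rev; apply: (@two_end_after (rev b) (rev g) (rev a) j i) => //.
  - by rewrite er; apply: fcw_rev (ladder_sym L) _ f.
  - by rewrite avoids_rev.
  - by rewrite avoids_rev.
  - by rewrite er => /leftfull_rev.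
have cg : cnt col 1 g = 0 by apply/eqP; rewrite -leqn0 leqNgt -has_count has_avoids negbK.
have {}c1 : 1 < cnt col 1 a + cnt col 1 b.
  by move: c1 cg; rewrite /cnt count_cat /= count_cat /= i0 j0 /=; lia.
have : has (fun k => col k == 1) b by rewrite has_count; rewrite /cnt in ca cb c1 *; lia.
case/split_first=> b1 [x [b2 [eb /eqP x1]]]; rewrite has_avoids negbK => b11.
have : has (fun k => col k == 1) a by rewrite has_count; rewrite /cnt in ca cb c1 *; lia.
case/split_last=> a1 [x' [a2 [ea /eqP x'1]]]; rewrite has_avoids negbK => a21.
have ex : x' = x by apply: (inner_inj L); rewrite x'1.
subst x'; apply: nL; exists a1, x, (a2 ++ i :: g ++ j :: b1), b2; split=> //.
- by rewrite ea eb; catn.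
- by rewrite !avoids_cat avoids_cons avoids_cat avoids_cons a21 b11 g1 i0 j0.
- move=> t /(two_end_letters f i0 j0 g0 g1) [] ->; rewrite !(mem_cat, inE) eqxx ?orbT //.
- have [] := col_pair L ij _; rewrite i0 ?j0 // => c2 _.
  by rewrite /lone c2 andbF.
Qed.

(** Column 1 would be visited twice without column 0 in between, which makes the word
turn at column n. *)
Lemma pair_end a g b i : fcw m (a ++ i :: g ++ i :: b) -> col i = 0 ->
  colsize col 0 = 2 -> avoids col 0 g ->
  ~ leftfull n (mirror n col) (a ++ i :: g ++ i :: b) -> False.
Proof.
move=> f i0 c2 g0 nR.
have lo : lone col n 0 = false by rewrite /lone c2 andbF.
have only j : j \in g -> m i j != 2 -> col j = 1.
  move=> jg; rewrite (ladder_commute L) negb_and negbK i0 /adj.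
  have := allP g0 j jg; case: (eqVneq i j) => [<-|_] /=; first by rewrite i0.
  by lia.
have [|g1 [y [g2 [y' [g3 [eg my my' _ f2]]]]]] := gap_two f.
  move=> j jg; case: (eqVneq (m i j) 2) => [->|mj]; first by left.
  right; apply: (ladder_label3 L); rewrite ?i0 ?(only j jg mj) ?lo //.
  by rewrite inner_lone.
have y1 : col y = 1 by apply: only; rewrite ?my // eg mem_cat mem_head orbT.
have y'1 : col y' = 1.
  by apply: only; rewrite ?my' // eg mem_cat inE mem_cat mem_head !orbT.
have e : y' = y by apply: (inner_inj L); rewrite y'1 ?y1 //.
subst y'; apply: nR; have := @descend_right 1 (a ++ i :: g1) y g2 (g3 ++ i :: b).
rewrite eg; catn; apply => //.
- by move: f; rewrite eg; catn.
- by apply: (commw_avoids L f2); rewrite i0.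
- by move: g0; rewrite eg !(avoids_cat, avoids_cons) => /and3P[_ _ /andP[]].
Qed.
End Deviations.

Section AltOf.
Variables (I : finType) (m : I -> I -> nat) (n : nat) (col : I -> nat).
Hypothesis L : ladder m n col.
Let ngt1 : 1 < n := ladder_n L.
Let L' : ladder m n (mirror n col) := ladder_mirror L.

(** Where alternation fails there are either two occurrences of one inner letter with
one neighbouring column missing in between, and the word runs to the opposite end
from there, or two letters of an end column. *)
Lemma altw_of_not_full r : fcw m r -> 1 < cnt col 1 r -> 1 < cnt col n.-1 r ->
  ~ leftfull n col r -> ~ leftfull n (mirror n col) r -> altw n col r.
Proof.
move=> f c1 cn nL nR; have nL' : ~ leftfull n (mirror n (mirror n col)) r.
  by rewrite (mirrorK L).
have cn' : 1 < cnt (mirror n col) 1 r.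
  by rewrite (_ : 1 = n - n.-1) ?(cnt_mirror L) //; lia.
have mir0 i : col i = n -> mirror n col i = 0 by rewrite /mirror => ->; rewrite subnn.
have nc0 g : avoids col n g -> avoids (mirror n col) 0 g by rewrite -(avoids_mirror L _ (leqnn n)) subnn.
have nc1 g : avoids col n.-1 g -> avoids (mirror n col) 1 g.
  by rewrite (_ : 1 = n - n.-1) ?(avoids_mirror L) //; lia.
split=> [k kn|k ke c2]; apply/negPn/negP => /not_sorted[s [i [j [t [es]]]]].
  have [a [g [b [er ng ik jk]]]] := filter_split es.
  have [gk gk1] : avoids col k g /\ avoids col k.+1 g.
    by split; apply/allP => l lg; apply: contra (hasPn ng l lg); rewrite /colpair => ->;
      rewrite ?orbT.
  move=> nij; have eij : col i = col j by move: ik jk nij; rewrite /colpair /adj; lia.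
  case/orP: ik => /eqP ik.
    have [k0|k0] := posnP k.
      rewrite k0 in gk gk1 ik; rewrite er in f c1 nL nR.
      by apply: (two_end L f) => //; lia.
    have ij : i = j by apply: (inner_inj L); lia.
    subst j; apply: nL; rewrite er; apply: (descend_left L (k := k)) => //; first by lia.
    by rewrite -er.
  have [k1|k1] := eqVneq k.+1 n.
    rewrite er in f cn' nR nL'; apply: (two_end L' f) => //.
    - by apply: mir0; rewrite ik.
    - by apply: mir0; rewrite -eij ik.
    - by apply: nc0; rewrite -k1.
    - by apply: nc1; rewrite -k1.
  have ij : i = j by apply: (inner_inj L); lia.
  subst j; apply: nR; rewrite er; apply: (descend_right L (k := k.+1)) => //; first by lia.
  by rewrite -er.
move=> /negPn/eqP ij; subst j; have [a [g [b [er ng /eqP ik _]]]] := filter_split es.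
rewrite has_avoids negbK in ng; rewrite er in f nR nL'; case/orP: ke => /eqP ek; rewrite ek in ik c2 ng.
  exact: (pair_end L f).
apply: (pair_end L' f) => //.
- exact: mir0.
- by rewrite -c2; apply: eq_card => l; rewrite !inE /mirror; have := ladder_le L l; lia.
- exact: nc0.
Qed.

(** Once column 0 is fully visited, a further occurrence of the letter of column 1
forces a turn at column n. *)
Lemma core_right a x g b : fcw m (a ++ x :: g ++ x :: b) -> col x = 1 -> avoids col 1 g ->
  (forall t, col t = 0 -> t \in g) -> (lone col n 0 -> avoids col 2 g) ->
  x \in b ->
  exists a' e v b', [/\ ceq m (a ++ x :: g ++ x :: b) (a' ++ (x :: e ++ v) ++ b'),
    all (fun i => col i == 0) e, uniq e, size e = colsize col 0 & rturn n col 1 v].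
Proof.
move=> f x1 g1 gt lg xb.
have kn : 0 < 1 < n by [].
have : has (fun k => col k == 1) b by apply/hasP; exists x => //; apply/eqP.
case/split_first=> b1 [x' [b2 [eb /eqP x'1]]]; rewrite has_avoids negbK => b11.
have ex : x' = x by apply: (inner_inj L); rewrite x'1.
subst x' b.
have b10 : avoids col 0 b1.
  apply/negPn/negP => /avoids_first[c [t [c' [eb1 t0 c0]]]].
  apply: (@end_after _ _ _ _ L a x g c t (c' ++ x :: b2) 1) => //.
  - by rewrite t0.
  - by rewrite t0.
  - by move: f; rewrite eb1; catn.
  - exact: gt.
  - rewrite t0 => lo; split=> //; apply: (avoids_commw L x1).
    + apply/allP => i; rewrite mem_filter => /andP[/= it ig]; apply/eqP => i0.
      case/negP: it; apply/eqP/(@col1_inj _ col); rewrite i0 ?t0 //.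
      by move: lo => /andP[_ /eqP].
    + by apply: avoids_sub g1 => i; rewrite mem_filter => /andP[].
    + by apply: avoids_sub (lg lo) => i; rewrite mem_filter => /andP[].
  - by move: b11; rewrite eb1 avoids_cat => /andP[].
  - by apply/negP => /(allP c0); rewrite t0.
have [|h1 [v [h2 [rv ev fh1 fh2]]]] := @turn_atP _ _ _ _ L 1 kn (a ++ x :: g) x b1 b2 x1 _ b10 b11.
  by move: f; catn.
pose r' := a ++ x :: g ++ h1 ++ v ++ h2 ++ b2.
have rr' : ceq m (a ++ x :: g ++ x :: b1 ++ x :: b2) r'.
  apply: ceq_catl; apply: ceq_cons; apply: ceq_catl.
  by have := ceq_catr b2 ev; catn.
have f' : fcw m r' := fcw_ceq rr' f.
have g2 : avoids col 2 g.
  apply/negPn/negP; rewrite -has_avoids => /split_last[c [y [c' [eg /eqP y2]]]].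
  rewrite has_avoids negbK => c'2.
  apply: (@rturn_after _ _ _ _ L 1 (rev v) (rev (h2 ++ b2)) (rev (c' ++ h1)) y
            (rev (a ++ x :: c))) => //.
  - exact: rturn_rev.
  - have := fcw_rev (ladder_sym L) f'; rewrite /r' eg !(rev_cat, rev_cons) -!cats1.
    by catn.
  - rewrite avoids_rev avoids_cat; move: g1; rewrite eg avoids_cat avoids_cons => /and3P[_ _ ->].
    by case/and3P: fh1.
pose e := filter (fun i => col i == 0) g; pose h := filter (fun i => col i != 0) g.
have e0 : all (fun i => col i == 0) e by apply/allP => i; rewrite mem_filter => /andP[].
have ue : uniq e.
  have := @seg_end_uniq _ _ _ _ L' (a ++ [:: x]) g (x :: b1 ++ x :: b2).
  rewrite (_ : filter _ g = e).
    apply; first by move: f; catn.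
    have -> : n.-1 = n - 1 by rewrite subn1.
    by rewrite (avoids_mirror L) // ltnW.
  apply: eq_filter => i; rewrite /mirror; have := ladder_le L i.
  by move: (col i) ngt1; clear; lia.
have he : ceq m g (h ++ e).
  apply: ceq_trans (ceq_partition (ladder_sym L) (p := fun i => col i != 0) _) _.
    move=> i j ig jg; case: (col j =P 0) => // j0 icol _.
    apply/eqP; rewrite (ladder_commute L) j0; have := allP g1 i ig => iH.
    have -> /= : i != j by apply: contraNneq icol => ->; apply/eqP.
    by move: iH; rewrite /adj; move: (col i); clear; lia.
  by apply: ceq_catl; rewrite /e (eq_filter (a2 := predC (fun i => col i != 0)));
    [exact: ceq_refl | move=> i /=; rewrite negbK].
have fh : far col 1 h.
  have sub : {subset h <= g} by move=> i; rewrite mem_filter => /andP[].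
  apply/and3P; split; [|exact: avoids_sub sub g1|exact: avoids_sub sub g2].
  by apply/allP => i; rewrite mem_filter => /andP[].
exists (a ++ h ++ h1), e, v, (h2 ++ b2); split=> //; last first.
  rewrite -(card_uniqP ue); apply: eq_card => i; rewrite inE mem_filter.
  by case: eqP => //= i0; rewrite gt.
apply: ceq_trans rr' _; rewrite /r' -!catA; apply: ceq_catl.
have cx k : far col 1 k -> commw m x k by apply: (far_commw L).
apply: (@ceq_trans _ _ _ (x :: h ++ h1 ++ e ++ v ++ h2 ++ b2)).
  apply: ceq_cons; rewrite [g ++ _]catA [h ++ _]catA [(h ++ h1) ++ _]catA.
  rewrite !catA; do 3!apply: ceq_catr; apply: (@ceq_trans _ _ _ ((h ++ e) ++ h1)).
    exact: ceq_catr.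
  rewrite -!catA; apply: ceq_catl; apply: ceq_catC => i j ie jh.
  have /eqP i0 := allP e0 i ie; case/and3P: fh1 => /allP/(_ j jh) j0 /allP/(_ j jh) j1 _.
  apply/eqP; rewrite (ladder_commute L) i0 /adj.
  have -> /= : i != j by apply: contraNneq j0 => <-; apply/eqP.
  by move: j0 j1; move: (col j); clear; lia.
apply: ceq_trans (ceq_move1 _ (cx _ fh)) _; apply: ceq_catl.
rewrite cat_cons -catA; apply: ceq_move1; exact: cx.
Qed.
End AltOf.

(** * Zigzags *)

Section ZigzagColumns.
Variables (n e0 en : nat).
Hypotheses (ngt1 : 1 < n) (e0P : 0 < e0 <= 2) (enP : 0 < en <= 2).

Definition zperiod := n.-1.*2 + e0 + en.

(** The column of the p-th letter of the two-way infinite walk 0, 1, ..., n, ..., 1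
in which an end column is repeated when it has two letters. *)
Definition walk p := minn (p %% zperiod) (n.*2 + en - 1 - p %% zperiod).

Lemma zperiod_gt0 : 0 < zperiod. Proof. by rewrite /zperiod; lia. Qed.

Lemma mod_lt p : p %% zperiod < zperiod.
Proof. by rewrite ltn_mod zperiod_gt0. Qed.

Lemma mod_succ p :
  p.+1 %% zperiod = if (p %% zperiod).+1 == zperiod then 0 else (p %% zperiod).+1.
Proof.
have e : p.+1 %% zperiod = (p %% zperiod).+1 %% zperiod 
  by rewrite -[p.+1]addn1 -[(p %% _).+1]addn1 modnDml.
have := mod_lt p; rewrite e leq_eqVlt.
by case: eqP => [-> _|_ /= h]; rewrite ?modnn // modn_small.
Qed.

Lemma walk_mod p : walk (p %% zperiod) = walk p.
Proof. by rewrite /walk modn_mod. Qed.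

Lemma walk_eqmod p p' : p = p' %[mod zperiod] -> walk p = walk p'.
Proof. by move=> e; rewrite -walk_mod e walk_mod. Qed.

Lemma walkDP p : walk (p + zperiod) = walk p.
Proof. by apply: walk_eqmod; rewrite modnDr. Qed.

Lemma walk_small p : p < zperiod -> walk p = minn p (n.*2 + en - 1 - p).
Proof. by move=> pl; rewrite /walk modn_small. Qed.

Lemma walk_le p : walk p <= n.
Proof. by rewrite /walk; have := mod_lt p; rewrite /zperiod; lia. Qed.

(** The walk goes straight through the inner columns and turns at the end columns,
resting there for one step if the column has two letters. *)
Definition straight_or_turn a b c :=
  [|| (0 < b < n) && ((a.+1 == b) && (c == b.+1) || (a == b.+1) && (c.+1 == b)),
      (b == 0) && (if e0 == 1 then (a == 1) && (c == 1)
                   else (a == 0) && (c == 1) || (a == 1) && (c == 0)) |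
      (b == n) && (if en == 1 then (a == n.-1) && (c == n.-1)
                   else (a == n) && (c == n.-1) || (a == n.-1) && (c == n))].

Lemma walk_up r : r <= n -> walk r = r.
Proof. by move=> rn; rewrite walk_small; rewrite ?/zperiod; lia. Qed.

Lemma walk_down r : n < r < zperiod -> walk r = n.*2 + en - 1 - r.
Proof. by move=> rn; rewrite walk_small; lia. Qed.

Lemma walk_local p : straight_or_turn (walk p) (walk p.+1) (walk p.+2).
Proof.
have P0 := zperiod_gt0; have wrap r : r = zperiod -> walk r = 0 /\ walk r.+1 = 1.
  by move=> ->; rewrite -[zperiod]add0n -addSn !walkDP !walk_up // ltnW.
have Pn : n.+1 < zperiod by rewrite /zperiod; lia.
have -> : walk p = walk (p %% zperiod) by rewrite walk_mod.
have -> : walk p.+1 = walk (p %% zperiod).+1.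
  by apply: walk_eqmod; rewrite -[p.+1]addn1 -[(p %% _).+1]addn1 modnDml.
have -> : walk p.+2 = walk (p %% zperiod).+2.
  by apply: walk_eqmod; rewrite -[p.+2]addn2 -[(p %% _).+2]addn2 modnDml.
have := mod_lt p; move: (p %% zperiod) => r rP.
rewrite /straight_or_turn; have [h|h] := leqP r.+2 n.
  by rewrite !walk_up; lia.
have [h1|h1] := eqVneq r.+1 n.
  have -> : walk r = n.-1 by rewrite walk_up; lia.
  have -> : walk r.+1 = n by rewrite walk_up; lia.
  have -> : walk r.+2 = n + en - 2 by rewrite walk_down; lia.
  by rewrite !eqxx orbA orbC; case: eqP => e; lia.
have [h2|h2] := eqVneq r n.
  have -> : walk r = n by rewrite walk_up; lia.
  have -> : walk r.+1 = n + en - 2 by rewrite walk_down; lia.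
  have -> : walk r.+2 = n + en - 3.
    have [e|e] := eqVneq r.+2 zperiod; first by have [-> _] := wrap _ e; rewrite /zperiod in e; lia.
    by rewrite walk_down; lia.
  by case: (eqVneq en 1) => e; lia.
have zr : walk r = n.*2 + en - 1 - r by rewrite walk_down; lia.
have [h3|h3] := eqVneq r.+1 zperiod.
  have [-> ->] := wrap _ h3; rewrite zr; rewrite /zperiod in h3.
  by case: (eqVneq e0 1) => e; lia.
have zr1 : walk r.+1 = n.*2 + en - 2 - r by rewrite walk_down; lia.
have zr2 : walk r.+2 = n.*2 + en - 3 - r.
  have [e|e] := eqVneq r.+2 zperiod.
    by have [-> _] := wrap _ e; rewrite /zperiod in e; lia.
  by rewrite walk_down; lia.
rewrite zr zr1 zr2; rewrite /zperiod in h3 rP Pn.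
have [b0|b0] := posnP (n.*2 + en - 2 - r); last by apply/or3P/Or31; lia.
have -> : e0 == 1 = false by lia.
have -> : n.*2 + en - 1 - r = 1 by lia.
by have -> : n.*2 + en - 3 - r = 0 by lia; rewrite b0 orbT.
Qed.

Lemma walk_adj p : walk p != walk p.+1 -> adj (walk p) (walk p.+1).
Proof.
have := walk_local p; rewrite /straight_or_turn /adj.
by case/or3P; [lia| |]; case/andP=> /eqP ->; case: ifP => _; lia.
Qed.

Lemma walk_flat p : walk p = walk p.+1 ->
  [\/ walk p = 0 /\ e0 = 2 | walk p = n /\ en = 2] /\ walk p.+2 <> walk p.+1.
Proof.
have := walk_local p; rewrite /straight_or_turn.
case/or3P; [lia| |]; case/andP=> /eqP -> + e; rewrite e; case: eqP => e1 h.
- lia.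
- by split; [left|]; lia.
- lia.
- by split; [right|]; lia.
Qed.

Lemma walk_back p : walk p = walk p.+2 ->
  [\/ walk p.+1 = 0 /\ e0 = 1 | walk p.+1 = n /\ en = 1].
Proof.
have := walk_local p; rewrite /straight_or_turn => + e; rewrite -e.
by case/or3P; [lia| |]; case/andP=> /eqP -> +; case: eqP => e1; lia.
Qed.

Lemma walk_inner p k : 0 < walk p.+1 < n -> adj (walk p.+1) k -> k <> walk p.+2 -> k = walk p.
Proof.
move=> b; have := walk_local p; rewrite /straight_or_turn b /adj.
by case/or3P; [lia| |]; case/andP=> /eqP; lia.
Qed.

Lemma walk_lone p k : (walk p.+1 = 0 /\ e0 = 1) \/ (walk p.+1 = n /\ en = 1) ->
  adj (walk p.+1) k -> k <= n -> walk p.+2 = k /\ walk p = k.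
Proof.
move=> e; have := walk_local p; rewrite /straight_or_turn /adj.
by case: e => [] [-> ->]; rewrite ?eqxx /= ?ltnn ?andbF /=; lia.
Qed.

Lemma walk_pair p k : (walk p.+1 = 0 /\ e0 = 2) \/ (walk p.+1 = n /\ en = 2) ->
  (walk p = walk p.+1 /\ (adj (walk p.+1) k -> k <= n -> walk p.+2 = k)) \/
  (walk p.+2 = walk p.+1 /\ (adj (walk p.+1) k -> k <= n -> walk p = k)).
Proof.
move=> e; have := walk_local p; rewrite /straight_or_turn /adj.
by case: e => [] [-> ->]; rewrite ?eqxx /= ?ltnn ?andbF /=; lia.
Qed.

(** The walk looks the same when it is run backwards, which makes the reverse of a
zigzag a zigzag. *)
Lemma walk_refl p p' : p + p' = n.*2 + en - 1 %[mod zperiod] -> walk p = walk p'.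
Proof.
have key r r' : r < zperiod -> r' < zperiod ->
    r + r' = n.*2 + en - 1 \/ [/\ e0 = 1, r = 0 & r' = 0] -> walk r = walk r'.
  move=> rP r'P [e|[_ -> ->] //]; rewrite !walk_small // minnC; congr minn; lia.
rewrite -modnDm => e; rewrite -(walk_mod p) -(walk_mod p'); apply: key; rewrite ?mod_lt //.
have := mod_lt p; have := mod_lt p'; move: e.
move: (p %% zperiod) (p' %% zperiod) => r r' e rP r'P.
have E : e0 = 1 \/ e0 = 2 by lia.
have s : n.*2 + en - 1 = if e0 == 1 then zperiod else zperiod.-1.
  by rewrite /zperiod; case: eqP; lia.
rewrite s in e *; case: E => E; rewrite E /= in e *.
  rewrite modnn in e; have [l|l] := ltnP (r + r') zperiod.
    by rewrite modn_small // in e; right; split=> //; lia.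
  rewrite -(subnK l) modnDr modn_small in e; last by lia.
  by left; lia.
left; rewrite [in RHS]modn_small in e; last by have := zperiod_gt0; lia.
have [l|l] := ltnP (r + r') zperiod; first by rewrite modn_small in e.
by rewrite -(subnK l) modnDr modn_small in e; lia.
Qed.

End ZigzagColumns.

Lemma walk_mirror n e0 en p : 1 < n -> 0 < e0 <= 2 -> 0 < en <= 2 ->
  n - walk n en e0 p = walk n e0 en (p + (n + en - 1)).
Proof.
move=> ngt1 e0P enP; have sP : zperiod n en e0 = zperiod n e0 en by rewrite /zperiod addnAC.
rewrite -walk_mod -[RHS]walk_mod -modnDml -sP; have := mod_lt ngt1 enP e0P p.
rewrite sP; move: (p %% _) => r rP.
have [l|l] := ltnP (r + (n + en - 1)) (zperiod n e0 en).
  rewrite modn_small // !walk_small ?sP //.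
  by move: l rP; rewrite /zperiod; lia.
rewrite -(subnK l) modnDr modn_small; last by move: l rP; rewrite /zperiod; lia.
rewrite !walk_small ?sP //; last by move: l rP; rewrite /zperiod; lia.
by move: l rP; rewrite /zperiod; lia.
Qed.

Lemma fcw_sorted (I : finType) (m : I -> I -> nat) r :
  fcw m r -> sorted (fun i j => i != j) r.
Proof.
move=> f; apply/negPn/negP => /not_sorted[a [i [j [b [e /negPn/eqP ij]]]]].
by subst j; have [/(_ a b i)] := f r (ceq_refl _ _).
Qed.

Section Zigzag.
Variables (I : finType) (m : I -> I -> nat) (n : nat) (col : I -> nat).
Hypothesis L : ladder m n col.
Let ngt1 : 1 < n := ladder_n L.
Let e0P : 0 < colsize col 0 <= 2 := ladder_size L (leq0n n).
Let enP : 0 < colsize col n <= 2 := ladder_size L (leqnn n).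

Local Notation walk := (walk n (colsize col 0) (colsize col n)).
Local Notation P := (zperiod n (colsize col 0) (colsize col n)).

Fixpoint ztrack q (z : seq I) :=
  if z is i :: z' then (col i == walk q) && ztrack q.+1 z' else true.

Definition zigzag q z := ztrack q z && sorted (fun i j => i != j) z.

Lemma ztrack_cat q a b : ztrack q (a ++ b) = ztrack q a && ztrack (q + size a) b.
Proof. by elim: a q => [|i a IH] q /=; rewrite ?addn0 // IH addnS -andbA. Qed.

Lemma ztrack_rcons q a i : ztrack q (rcons a i) = ztrack q a && (col i == walk (q + size a)).
Proof. by rewrite -cats1 ztrack_cat /= andbT. Qed.

Lemma ztrack_eqmod q q' z : q = q' %[mod P] -> ztrack q z = ztrack q' z.
Proof.
elim: z q q' => //= i z IH q q' e; rewrite (walk_eqmod e); congr (_ && _); apply: IH.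
by rewrite -[q.+1]addn1 -[q'.+1]addn1 -modnDml e modnDml.
Qed.

Lemma ztrack_rev q z : ztrack q z -> exists q', ztrack q' (rev z).
Proof.
move=> tz; exists (n.*2 + colsize col n - 1 + 1 + (q + size z) * P.-1).
set q' := _ + _; have : q + size z + q' = n.*2 + colsize col n - 1 + 1 %[mod P].
  rewrite /q' addnCA -mulnS prednK ?zperiod_gt0 //.
  by rewrite addnC modnMDl.
move: q' => q'; elim: z q tz q' => //= i z IH q /andP[/eqP qi tz] q' e.
rewrite rev_cons ztrack_rcons (IH _ tz) /= ?size_rev; last by rewrite -e addSn addnS.
rewrite qi; apply/eqP/walk_refl => //.
by apply/eqP; rewrite -(eqn_modDr 1); apply/eqP; rewrite -e; congr (_ %% _); lia.
Qed.

Lemma walk_is_lone p : (walk p = 0 /\ colsize col 0 = 1) \/ (walk p = n /\ colsize col n = 1) ->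
  lone col n (walk p).
Proof. by rewrite /lone; case=> [] [-> ->]; rewrite eqxx ?orbT. Qed.

Lemma walk_is_pair p : (walk p == 0) || (walk p == n) -> ~~ lone col n (walk p) ->
  (walk p = 0 /\ colsize col 0 = 2) \/ (walk p = n /\ colsize col n = 2).
Proof.
rewrite /lone => /[dup] h -> /= c; case/orP: h => /eqP h; rewrite h in c *.
  by left; split=> //; move: c e0P; lia.
by right; split=> //; move: c enP; lia.
Qed.

Lemma zigzag_cons q i z : zigzag q (i :: z) =
  [&& col i == walk q, (if z is j :: _ then i != j else true) & zigzag q.+1 z].
Proof.
rewrite /zigzag; case: z => [|j z] /=; rewrite ?andbT // -!andbA.
by case: (col i == _) => //=; case: (i != j) => //=; rewrite ?andbF.
Qed.

(** Consecutive letters of a zigzag commute only within an end column, where they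
may be swapped. *)
Lemma zigzag_swap q a b i j : m i j = 2 ->
  zigzag q (a ++ i :: j :: b) -> zigzag q (a ++ j :: i :: b).
Proof.
move=> /eqP; rewrite (ladder_commute L) => /andP[ij nadj].
have flat p : col i = walk p -> col j = walk p.+1 -> walk p = walk p.+1 /\ walk p.+2 <> walk p.+1.
  move=> ci cj; have e : walk p = walk p.+1.
    by apply/eqP; apply: contraNT nadj => /(walk_adj ngt1 e0P enP); rewrite ci cj.
  by split=> //; have [] := walk_flat ngt1 e0P enP e.
elim: a q => [|l a IH] q; rewrite ?cat0s ?cat_cons !zigzag_cons.
  case/and5P=> /eqP ci _ /eqP cj jb zb; have [e ne] := flat q ci cj.
  rewrite cj ci -e eqxx (eq_sym j) ij zb /= andbT.
  case: b jb zb => // k b _; rewrite zigzag_cons => /andP[/eqP ck _].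
  by apply/eqP => ik; apply: ne; rewrite -ck -ik ci.
case/and3P=> /eqP cl la za; rewrite (IH _ za) cl eqxx andbT /=.
case: a la za {IH} => [|l' a] //= _; rewrite !zigzag_cons => /and4P[/eqP ci _ /eqP cj _].
have [e ne] := flat q.+1 ci cj; apply/eqP => lj.
have e' : walk q = walk q.+1 by rewrite -cl lj cj -e.
by have [_] := walk_flat ngt1 e0P enP e'; rewrite e.
Qed.

Lemma zigzag_ceq q z z' : ceq m z z' -> zigzag q z = zigzag q z'.
Proof.
move: z z'; apply: ceq_ind2 => // [r s t -> //|a b i j mij].
apply/idP/idP; first exact: zigzag_swap.
by apply: zigzag_swap; rewrite (ladder_sym L).
Qed.

(** The columns repeat after two steps only about an end column of a single letter,
where the label is 4, and they do not do so twice in a row. *)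
Lemma zigzag_fcw q z : zigzag q z -> fcw m z.
Proof.
move=> zz r zr; rewrite (zigzag_ceq _ zr) in zz; case/andP: zz => tr so.
split=> [a b i e|a b i j mij e]; subst r; first by have := sorted_mid so; rewrite eqxx.
have aij : adj (col i) (col j).
  by move: mij; rewrite (ladder_m L); case: eqP => // _; case: ifP.
have [k mk] : exists k, m i j = k.+3 by exists (m i j - 3); lia.
move: tr; rewrite mk ztrack_cat /= => /and5P[_ /eqP ci /eqP cj /eqP ci' tr].
have bk := walk_back ngt1 e0P enP (etrans (esym ci) ci').
have lo : lone col n (col j) by rewrite cj; apply: walk_is_lone; case: bk; [left|right].
have m4 : m i j = 4 by apply: (ladder_label4 L); rewrite ?lo ?orbT.
have k1 : k = 1 by lia.
move: tr; rewrite k1 /= => /andP[/eqP cj' _].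
have := walk_back ngt1 e0P enP (etrans (esym cj) cj'); rewrite -ci' => bk'.
by move: aij bk bk'; rewrite -cj /adj; lia.
Qed.

(** A letter prolonging a zigzag to a word of the same kind, and whose column or a
neighbouring one has been visited at a time p >= q + 2, must follow the walk: if it
does not commute with the last letter y, any other choice closes a factor x x, x y x or
x y x y; if it does, it is a continuation of the word without y. *)
Lemma zigzag_next q z x : ztrack q z -> fcw m (rcons z x) ->
  (exists2 p, q.+2 <= p < q + size z & walk p <= (col x).+1 /\ col x <= (walk p).+1) ->
  col x = walk (q + size z).
Proof.
elim/last_ind: z => [|z y IH] ; first by move=> _ _ [p]; rewrite addn0; lia.
rewrite ztrack_rcons size_rcons addnS => /andP[tz /eqP cy] f [p pP px].
have [near|far] := boolP ((walk (q + size z) <= (col x).+1) && (col x <= (walk (q + size z)).+1)); last first.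
  have mxy : m y x = 2.
    apply/eqP; rewrite (ladder_commute L) cy /adj; apply/andP; split; last by lia.
    by apply: contraNneq far => <-; rewrite cy; lia.
  have cx : col x = walk (q + size z).
    apply: IH => //.
      apply: (@fcw_factor _ _ [::] (rcons z x) [:: y]).
      apply: fcw_ceq f; rewrite -!cats1 -!catA /=; exact: ceq_swap2.
    exists p => //; have : p != q + size z.
      by apply/eqP => e; move: far; rewrite -e; case: px => -> ->.
    by lia.
  by move: far; rewrite cx; lia.
have sz : 1 < size z by lia.
case/lastP: z tz sz f cy pP near {IH} => // z v; rewrite size_rcons ltnS => tz sz.
case/lastP: z tz sz => // z u; rewrite !ztrack_rcons !size_rcons => tz _ f cy pP near.
case/andP: tz => /andP[tz /eqP cu] /eqP cv.
set t := q + size z in cu; have et : q + (size z).+2 = t.+2 by rewrite /t; lia.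
rewrite et in cy near *; rewrite addnS -/t in cv; rewrite -!cats1 -!catA /= in f.
have loc1 := walk_local ngt1 e0P enP t.
have uv : u != v.
  exact: sorted_mid (fcw_sorted f).
have vy : v != y.
  have so := fcw_sorted f; rewrite -[u :: _]/([:: u] ++ _) catA in so.
  exact: sorted_mid so.
have yx : y != x.
  have so := fcw_sorted f; rewrite -[u :: _]/([:: u; v] ++ _) catA in so.
  exact: sorted_mid so.
have [//|kn] := eqVneq (col x) (walk t.+3).
exfalso; have le := ladder_le L.
have inn w : 0 < walk w < n -> lone col n (walk w) = false by apply: inner_lone.
have innx : 0 < col x < n -> lone col n (col x) = false by apply: inner_lone.
have f1 : fcw m ((z ++ [:: u]) ++ v :: [:: y] ++ x :: [::]) by rewrite -catA.
have [cxy|cxy] := eqVneq (col x) (walk t.+2).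
  (* x is in the column of y *)
  have cyx : col y = col x by rewrite cy.
  have [cs ce] := col_pair L yx cyx; rewrite cyx cxy in cs ce.
  have nl : ~~ lone col n (walk t.+2) by rewrite /lone cs andbF.
  have cvy : walk t.+1 = walk t.+2.
    case: (walk_pair ngt1 e0P enP (n.-1) (walk_is_pair ce nl)) => [[-> //]|[e _]].
    by move: kn; rewrite e cxy eqxx.
  have xv : x = v.
    by case: (col2 L vy _ (l := x)); rewrite ?cv ?cy ?cxy ?cvy // => e; move: yx; rewrite e eqxx.
  subst x; apply: (gap0 f1); rewrite /commw /= andbT (ladder_commute L) vy cv cy cvy.
  by rewrite /adj; lia.
have axy : adj (walk t.+2) (col x) by rewrite /adj; lia.
have [iy|iy] := boolP (0 < walk t.+2 < n); last first.
  (* y is in an end column: x was visited just before *)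
  have ce : (walk t.+2 == 0) || (walk t.+2 == n) by have := walk_le ngt1 e0P enP t.+2; lia.
  have [lo|nl] := boolP (lone col n (walk t.+2)).
    have h : (walk t.+2 = 0 /\ colsize col 0 = 1) \/ (walk t.+2 = n /\ colsize col n = 1).
      by move: lo; rewrite /lone ce /=; case/orP: ce => /eqP -> /eqP; [left|right].
    by have [e _] := walk_lone ngt1 e0P enP h axy (le x); rewrite e eqxx in kn.
  case: (walk_pair ngt1 e0P enP (col x) (walk_is_pair ce nl)) => [[_ /(_ axy (le x)) e]|].
    by rewrite e eqxx in kn.
  case=> _ /(_ axy (le x)) e.
  have ix : 0 < col x < n by have := le x; have := ngt1; move: axy ce; rewrite /adj; lia.
  have xv : x = v by apply: (inner_inj L); rewrite // cv.
  subst x; apply: (@gap1 _ m (z ++ [:: u]) v [::] y [::] [::]) => //.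
  by apply: (ladder_label3 L); rewrite ?(innx ix) ?cy // adj_sym.
have cxv : col x = walk t.+1.
  by apply: (walk_inner ngt1 e0P enP iy axy); apply/eqP.
have [ix|ix] := boolP (0 < col x < n).
  have xv : x = v by apply: (inner_inj L); rewrite // cv.
  subst x; apply: (@gap1 _ m (z ++ [:: u]) v [::] y [::] [::]) => //.
  by apply: (ladder_label3 L); rewrite ?(innx ix) ?cy ?(inn _ iy) // adj_sym.
have ce : (walk t.+1 == 0) || (walk t.+1 == n) by have := le x; rewrite -cxv; lia.
have avy : adj (walk t.+1) (walk t.+2) by rewrite -cxv adj_sym.
have [lo|nl] := boolP (lone col n (walk t.+1)).
  (* y x y x with x the single letter of an end column *)
  have c1 : colsize col (col x) = 1 by move: lo; rewrite -cxv => /andP[_ /eqP].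
  have xv : x = v by apply: (col1_inj c1); rewrite cv.
  have cuy : walk t.+2 = walk t.
    have h : (walk t.+1 = 0 /\ colsize col 0 = 1) \/ (walk t.+1 = n /\ colsize col n = 1).
      by move: lo; rewrite /lone ce /=; case/orP: ce => /eqP -> /eqP; [left|right].
    by have [_ ->] := walk_lone ngt1 e0P enP h avy (walk_le ngt1 e0P enP _).
  have uy : u = y by apply: (inner_inj L); rewrite cu ?cy -cuy.
  subst x u; apply: (@gap2 _ m z y [::] v [::] [::] [::]) => //.
  by apply: (ladder_label4 L); rewrite ?cv ?cy ?lo ?orbT // adj_sym.
have [[e _]|[e _]] := walk_pair ngt1 e0P enP (walk t.+2) (walk_is_pair ce nl); last first.
  by move: avy; rewrite e /adj; lia.
have f2 : fcw m (z ++ u :: [:: v] ++ y :: [::] ++ x :: [::]) by [].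
have fvy : m v y = 3.
  by apply: (ladder_label3 L); rewrite ?cv ?cy ?(inn _ iy).
case: (col2 L uv _ (l := x)); rewrite ?cu ?cv ?cxv ?e // => xe; subst x.
  apply: (gap1 f2) => //.
    by apply: (ladder_label3 L); rewrite ?cu ?e ?cy ?(inn _ iy).
  by rewrite /commw /= andbT (ladder_commute L) uv cu cv e /adj; lia.
by apply: (@gap1 _ m (z ++ [:: u]) v [::] y [::] [::]).
Qed.

End Zigzag.

Section Classify.
Variables (I : finType) (m : I -> I -> nat) (n : nat) (col : I -> nat).
Hypothesis L : ladder m n col.
Let ngt1 : 1 < n := ladder_n L.
Let e0P : 0 < colsize col 0 <= 2 := ladder_size L (leq0n n).
Let enP : 0 < colsize col n <= 2 := ladder_size L (leqnn n).

Local Notation walk := (walk n (colsize col 0) (colsize col n)).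
Local Notation P := (zperiod n (colsize col 0) (colsize col n)).
Local Notation ztrack := (ztrack n col).
Local Notation zigzag := (zigzag n col).

(** The interval is one short of a period; a column met only at the missing time q + 1
is within one step of the column met at time q + 2. *)
Lemma walk_near q k : k <= n ->
  exists2 p, q.+2 <= p < q + P.+1 & walk p <= k.+1 /\ k <= (walk p).+1.
Proof.
move=> kn; have P0 : 0 < P by apply: zperiod_gt0.
have [kP P2] : k < P /\ 2 < P by rewrite /zperiod; lia.
have [p pP pk] : exists2 p, q.+2 <= p < q.+2 + P & walk p = k.
  pose b := q.+2 %/ P * P; have bq : b <= q.+2 < b + P.
    by rewrite leq_trunc_div /= {1}(divn_eq q.+2 P) ltn_add2l ltn_mod.
  have zb c : walk (c * P + k) = k.
    by rewrite (walk_eqmod (p' := k)) ?modnMDl // (walk_up ngt1 e0P enP).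
  have [h|h] := leqP q.+2 (b + k); first by exists (b + k); [lia|exact: zb].
  by exists ((q.+2 %/ P).+1 * P + k); [rewrite mulSn -/b; lia|exact: zb].
have [pm|pm] := ltnP p (q + P.+1); first by exists p; [lia|rewrite pk; lia].
have e : p = q.+1 + P by lia.
have zq : walk q.+1 = k by rewrite -pk e walkDP.
exists q.+2; first by lia.
have := walk_adj ngt1 e0P enP (p := q.+1); rewrite zq /adj.
by case: eqP => [<- _|_ /(_ isT)]; lia.
Qed.

(** After a whole period zigzag_next applies to every further letter. *)
Lemma zigzag_absorb q z b : ztrack q z -> P < size z -> fcw m (z ++ b) -> ztrack q (z ++ b).
Proof.
elim: b z => [|x b IH] z tz sz f; first by rewrite cats0.
rewrite -cat_rcons in f *; apply: IH => //; last by rewrite size_rcons ltnW.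
rewrite ztrack_rcons tz /=; apply/eqP; apply: (zigzag_next L tz).
  exact: (@fcw_factor _ _ [::] (rcons z x) b).
have [p pP px] := walk_near q (ladder_le L x); exists p => //.
by lia.
Qed.

Lemma zigzag_absorb_left q a z : ztrack q z -> P < size z -> fcw m (a ++ z) ->
  exists q', ztrack q' (a ++ z).
Proof.
move=> tz sz f; have [q1 t1] := ztrack_rev L tz.
have f1 : fcw m (rev z ++ rev a) by rewrite -rev_cat; apply: fcw_rev (ladder_sym L) _ f.
have := zigzag_absorb t1; rewrite size_rev => /(_ (rev a) sz f1).
by rewrite -rev_cat => /(ztrack_rev L); rewrite revK.
Qed.

Lemma rturn_track k v : rturn n col k v ->
  size v = (n - k).*2 + colsize col n /\ ztrack k v.
Proof.
elim=> [x e xn /allP en ue se|k' x v' k0 xk rv [sv tv]]; rewrite /= ztrack_rcons size_rcons.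
  have zx : walk (n.-1.+1 + size e) = n.-1.
    by rewrite (walk_down ngt1 e0P enP) /zperiod; lia.
  have te p (s : seq I) : n <= p -> p + size s <= n + colsize col n -> {subset s <= e} ->
      ztrack p s.
    elim: s p => //= i s IH p np ps sub; apply/andP; split.
      have -> : col i = n by apply/eqP/en/sub; exact: mem_head.
      have [pn|pn] := leqP p n; first by rewrite (walk_up ngt1 e0P enP); lia.
      by rewrite (walk_down ngt1 e0P enP) /zperiod; lia.
    by apply: IH => [||j js]; [lia|lia|apply: sub; rewrite inE js orbT].
  split; first by lia.
  rewrite xn zx (walk_up ngt1 e0P enP) ?eqxx ?andbT /=; last by lia.
  by apply: te => //; lia.
have kn := rturn_bound L rv.
split; first by lia.
rewrite tv xk (walk_up ngt1 e0P enP) ?eqxx /=; last by lia.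
by rewrite (walk_down ngt1 e0P enP) /zperiod ?sv; lia.
Qed.

Lemma core_track e v x : col x = 1 -> all (fun i => col i == 0) e ->
  size e = colsize col 0 -> rturn n col 1 v ->
  exists q, ztrack q (x :: e ++ v) /\ size (x :: e ++ v) = P.+1.
Proof.
move=> x1 /allP e0 se /rturn_track[sv tv]; exists (P - colsize col 0).
have PE : P = n.-1.*2 + colsize col 0 + colsize col n by [].
split; last by rewrite /= size_cat sv se PE; lia.
rewrite /= x1 ztrack_cat se.
have -> : ztrack ((P - colsize col 0).+1 + colsize col 0) v.
  rewrite (_ : _ + _ = 1 + P); last by rewrite PE; lia.
  by rewrite (@ztrack_eqmod _ _ _ _ 1) // modnDr.
rewrite (walk_down ngt1 e0P enP) ?PE ?andbT; last by lia.
apply/andP; split; first by lia.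
have te p (s : seq I) : P < p + colsize col 0 -> p + size s <= P.+1 -> {subset s <= e} ->
    ztrack p s.
  elim: s p => //= i s IH p np ps sub; apply/andP; split.
    have -> : col i = 0 by apply/eqP/e0/sub; exact: mem_head.
    have [->|pn] := eqVneq p P; first by rewrite -[P]add0n walkDP walk_up.
    move: np ps pn; rewrite /zperiod => np ps pn.
    by rewrite (walk_down ngt1 e0P enP) /zperiod; lia.
  by apply: IH => [||j js]; [lia|lia|apply: sub; rewrite inE js orbT].
by apply: te => //; rewrite /zperiod; lia.
Qed.

(** Up to reversal, the letter of column 1 occurs again after the full visit of column
0.  This yields a core of one period, which absorbs the letters on both sides. *)
Lemma leftfull_zigzag r : fcw m r -> 2 < cnt col 1 r -> leftfull n col r ->
  exists q z, ceq m r z /\ zigzag q z.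
Proof.
move=> f c1 [a [x [g [b [er x1 g1 gt g2]]]]].
wlog xb : r a g b f c1 er g1 gt g2 / x \in b.
  move=> W; have [xb|xb] := boolP (x \in b); first exact: (W r a g b).
  have xa : x \in a.
    have cx s : (0 < cnt col 1 s) = (x \in s).
      rewrite -has_pred1 -has_count; apply: eq_has => i /=; apply/eqP/eqP => [i1|->//].
      by apply: (inner_inj L); rewrite i1.
    have ng : x \in g = false by apply/negP => /(allP g1); rewrite x1.
    have cr : cnt col 1 r = cnt col 1 a + (cnt col 1 g + cnt col 1 b).+2.
      by rewrite er /cnt count_cat /= count_cat /= x1 /=; lia.
    by move: c1 (cx a) (cx b) (cx g); rewrite cr ng (negPf xb); case: (x \in a); lia.
  have er' : rev r = rev b ++ x :: rev g ++ x :: rev a.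
    by rewrite er !(rev_cat, rev_cons) -!cats1; catn.
  have [q [z [rz zz]]] : exists q z, ceq m (rev r) z /\ zigzag q z.
    apply: (W _ (rev b) (rev g) (rev a)) => //.
    - exact: fcw_rev (ladder_sym L) _ f.
    - by rewrite /cnt count_rev.
    - by rewrite avoids_rev.
    - by move=> t /gt; rewrite mem_rev.
    - by rewrite avoids_rev.
    - by rewrite mem_rev.
  case/andP: (zz) => /(ztrack_rev L)[q' tz'] _; exists q', (rev z).
  have rz' : ceq m r (rev z) by rewrite -[r]revK; apply: ceq_rev (ladder_sym L) _ _ rz.
  by split=> //; rewrite /zigzag tz' /=; apply: fcw_sorted (fcw_ceq rz' f).
rewrite er in f *; have [a' [e [v [b' [rz e0 ue se rv]]]]] := core_right L f x1 g1 gt g2 xb.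
have fz := fcw_ceq rz f; have [q [tz sz]] := core_track x1 e0 se rv.
have fz1 : fcw m ((x :: e ++ v) ++ b').
  by apply: (@fcw_factor _ _ a' _ [::]); rewrite cats0.
have tz1 : ztrack q ((x :: e ++ v) ++ b') by apply: zigzag_absorb; rewrite ?sz.
have [q' tz2] : exists q', ztrack q' (a' ++ (x :: e ++ v) ++ b').
  by apply: (zigzag_absorb_left tz1) => //; rewrite size_cat sz; lia.
exists q', (a' ++ (x :: e ++ v) ++ b'); split=> //.
by rewrite /zigzag tz2 /=; apply: fcw_sorted fz.
Qed.
End Classify.

(** A failure of alternation leads to a full visit of one of the end columns; for the
last column the ladder is mirrored. *)
Theorem classify (I : finType) (m : I -> I -> nat) n (col : I -> nat) r :
  ladder m n col -> fcw m r -> long n r ->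
  altw n col r \/ exists q z, ceq m r z /\ zigzag n col q z.
Proof.
move=> L f lr; have c1 := long_cnt1 L lr f; have cn := long_cntn L lr f.
have [nL|nL] := pselect (leftfull n col r).
  by right; apply: leftfull_zigzag nL.
have [nR|nR] := pselect (leftfull n (mirror n col) r).
  right; have L' := ladder_mirror L.
  have c1' := long_cnt1 L' lr f.
  have [q [z [rz zz]]] := leftfull_zigzag L' f c1' nR.
  exists (q + (n + colsize col n - 1)), z; split=> //.
  have n1 := ladder_n L; case/andP: zz => tz so; rewrite /zigzag so andbT.
  have s0 : colsize (mirror n col) 0 = colsize col n.
    by apply: eq_card => i; rewrite !inE /mirror; have := ladder_le L i; lia.
  have sn : colsize (mirror n col) n = colsize col 0.
    by apply: eq_card => i; rewrite !inE /mirror; have := ladder_le L i; lia.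
  elim: z q tz {rz so} => //= i z IH q; rewrite s0 sn => /andP[/eqP ci tz].
  rewrite -addSn IH ?s0 ?sn // andbT; apply/eqP.
  rewrite -walk_mirror ?(ladder_size L) // -ci /mirror subKn //.
  exact: ladder_le L i.
by left; apply: (altw_of_not_full L f) => //; exact: ltnW.
Qed.

(** * Counting alternating words *)

(** The two words are read in parallel: a letter that only one of them can contain is
taken at once, a common letter when both words have reached it. *)
Lemma amalgam (T : eqType) (p q : pred T) (r s : seq T) :
  all p r -> all q s -> filter q r = filter p s ->
  exists w, [/\ filter p w = r, filter q w = s & all (fun x => p x || q x) w].
Proof.
have [k] := ubnP (size r + size s); elim: k r s => // k IH.
case=> [|x r] s szk /=.
  move=> _ qs e; exists s; split=> //; first exact/all_filterP.
  by apply: sub_all qs => y /= ->; rewrite orbT.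
case/andP=> px pr; case qx: (q x); last first.
  move=> qs e; have [|w [w1 w2 w3]] := IH r s _ pr qs e; first by move: szk => /=; lia.
  by exists (x :: w); rewrite /= px qx w1 w2 w3.
case: s szk => [|y s] //= szk /andP[qy qs]; case py: (p y).
  case=> xy e; subst y; have [|w [w1 w2 w3]] := IH r s _ pr qs e; first by lia.
  by exists (x :: w); rewrite /= px qx w1 w2 w3.
move=> e; have h : size (x :: r) + size s < k by move=> /=; lia.
have pxr : all p (x :: r) by rewrite /= px.
have e' : filter q (x :: r) = filter p s by rewrite /= qx.
have [w [w1 w2 w3]] := IH (x :: r) s h pxr qs e'.
by exists (y :: w); rewrite /= py qy w1 w2 w3.
Qed.

Fixpoint interleave (T : Type) (u v : seq T) : seq T :=
  if u is x :: u' then x :: (if v is y :: v' then y :: interleave u' v' else [::]) else [::].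

Section Interleave.
Variables (T : Type) (p q : pred T).
Hypothesis pq : forall x, p x -> ~~ q x.

Lemma interleave_filter u v :
  all p u -> all q v -> (size u == size v) || (size u == (size v).+1) ->
  [/\ filter p (interleave u v) = u, filter q (interleave u v) = v &
      all (fun x => p x || q x) (interleave u v)].
Proof.
have qp x : q x -> ~~ p x by apply: contraTN => /pq.
elim: u v => [|x u IH] [|y v] //=.
  move=> /andP[px _] _ sz; have -> : u = [::] by apply: size0nil; lia.
  by rewrite /= px (negPf (pq px)).
case/andP=> px pu /andP[qy qv] sz; have [h1 h2 h3] := IH v pu qv sz.
by rewrite px (negPf (pq px)) qy (negPf (qp _ qy)) h1 h2 h3 orbT.
Qed.

Lemma interleave_sorted (e : rel T) u v : (forall x y, p x -> q y -> e x y && e y x) ->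
  all p u -> all q v -> sorted e (interleave u v).
Proof.
move=> pe pu qv; suff H y : q y -> path e y (interleave u v).
  case: u pu H => [|x u] //= /andP[px _] H.
  case: v qv H => [|y v] //= /andP[qy _] H.
  by case/and3P: (H y qy) => _ -> ->.
elim: u v y pu qv => [|x u IH] v y //= /andP[px pu] qv qy.
have /andP[_ ->] := pe x y px qy; case: v qv => //= z v /andP[qz qv].
by have /andP[-> _] := pe x z px qz; apply: IH.
Qed.

Lemma interleave_last x0 u v : all p u -> all q v -> 0 < size u ->
  (size u = size v -> q (last x0 (interleave u v))) /\
  (size u = (size v).+1 -> p (last x0 (interleave u v))).
Proof.
elim: u v x0 => [|x u IH] [|y v] x0 //= /andP[px pu]; first by split=> // -[].
case/andP=> qy qv _; case: u IH pu => [|x' u] IH pu.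
  by split=> [_|] //=; case: v qv {IH}.
have [h1 h2] := IH v y pu qv isT.
by split=> e; [apply: h1 | apply: h2]; move: e => /=; lia.
Qed.
End Interleave.

Lemma head_interleave (T : Type) (x0 : T) u v : head x0 (interleave u v) = head x0 u.
Proof. by case: u. Qed.

(** Summation by parts. *)
Lemma endpoints_sum (c b : nat -> nat) N : (forall k, k < N -> c k + 1 = c k.+1 + b k) ->
  \sum_(k < N.+1) c k + \sum_(j < N) j.+1 = N.+1 * c N + \sum_(j < N) j.+1 * b j.
Proof.
elim: N => [|N IH] cb; first by rewrite big_ord1 !big_ord0 mul1n.
have {}IH := IH (fun k kN => cb k (ltnW kN)).
rewrite big_ord_recr [\sum_(j < N.+1) _.+1]big_ord_recr
  [\sum_(j < N.+1) _.+1 * _]big_ord_recr /=.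
have : N.+1 * (c N + 1) = N.+1 * (c N.+1 + b N) by rewrite cb.
move: IH; move: (\sum_(i < N.+1) c i) (\sum_(i < N) i.+1) (\sum_(i < N) i.+1 * b i) => A B C.
by rewrite !mulnDr muln1 [N.+2 * _]mulSn; lia.
Qed.
Section AltData.
Variables (I : finType) (m : I -> I -> nat) (n : nat) (col : I -> nat).
Hypothesis L : ladder m n col.
Variable x0 : I.
Let ngt1 : 1 < n := ladder_n L.

Local Notation F := (fun k => filter (colpair col k)).
Local Notation adjl := (fun i j => adj (col i) (col j)).

Lemma cntF k r : cnt col k (F k r) = cnt col k r /\ cnt col k.+1 (F k r) = cnt col k.+1 r.
Proof.
by split; rewrite /cnt count_filter; apply: eq_count => i /=; rewrite /colpair;
  case: eqP => //=; rewrite ?orbT.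
Qed.

(** In an alternating word on two columns the numbers of letters are related by the
first and the last letter. *)
Lemma alternating_count k w : sorted adjl w -> all (colpair col k) w -> 0 < size w ->
  cnt col k w + 1 =
  cnt col k.+1 w + (col (head x0 w) == k) + (col (last x0 w) == k).
Proof.
case: w => //= i w; elim: w i => [|j w IH] i /=.
  by rewrite /colpair andbT => _ ci _; lia.
case/andP=> aij so /and3P[ci cj cw] _.
have /= := IH j so; rewrite cj => /(_ cw isT).
by move: aij ci cj; rewrite /adj /colpair; lia.
Qed.

Lemma alternating_count_le k w : sorted adjl w -> all (colpair col k) w ->
  cnt col k w <= cnt col k.+1 w + 1 /\ cnt col k.+1 w <= cnt col k w + 1.
Proof.
move=> so cw; case: w so cw => // i w so cw.
by have := alternating_count so cw isT; lia.
Qed.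

Lemma altw_count_le r k : altw n col r -> k < n ->
  cnt col k r <= cnt col k.+1 r + 1 /\ cnt col k.+1 r <= cnt col k r + 1.
Proof.
move=> [ar _] kn; have [<- <-] := cntF k r.
by apply: alternating_count_le (ar k kn) _; exact: filter_all.
Qed.

Lemma altw_cnt_gt0 r k : altw n col r -> long n r -> k <= n -> 0 < cnt col k r.
Proof.
move=> ar lr kn; rewrite lt0n; apply/eqP => ck.
have up a : a <= n -> cnt col a r <= cnt col 0 r + a.
  elim: a => [|a IH] an; first by rewrite addn0.
  by have [_] := altw_count_le ar an; have := IH (ltnW an); lia.
have down a : a <= n -> cnt col 0 r <= cnt col a r + a.
  elim: a => [|a IH] an; first by rewrite addn0.
  by have [+ _] := altw_count_le ar an; have := IH (ltnW an); lia.
have c0 := down k kn; rewrite ck in c0.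
have: size r <= n.+1 * (n + n).
  rewrite (size_cnt L) -[X in _ <= X * _]card_ord -sum_nat_const.
  by apply: leq_sum => a _; have := up a (ltn_ord a); have := ltn_ord a; lia.
have := ltn_expl n.+1 (isT : 1 < 2); move: lr; rewrite /long => lr h1 h2.
have : n.+1 * (n + n) <= n.+1 * (2 ^ n.+1 + 6).
  by rewrite leq_mul2l /=; have := ltn_expl n (isT : 1 < 2); rewrite expnS; lia.
by lia.
Qed.

End AltData.

Section AltLabels.
Variables (I : finType) (m : I -> I -> nat) (n : nat) (col : I -> nat).
Hypothesis L : ladder m n col.
Variable x0 : I.
Let ngt1 : 1 < n := ladder_n L.

Local Notation F := (fun k => filter (colpair col k)).
Local Notation adjl := (fun i j => adj (col i) (col j)).
Local Notation shape := {ffun 'I_n -> bool * bool}.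

(** Indexed by numbers, with value 0 out of range, for inductions over the columns. *)
Definition bits (f : shape) k : nat := if insub k is Some o then (f o).1 + (f o).2 else 0.

Definition triangle := \sum_(j < n) j.+1.

Definition weight (f : shape) := \sum_(j < n) j.+1 * ((f j).1 + (f j).2).

(** Labels of the classes of alternating words of length l: for each pair of
neighbouring columns, whether the left one comes first and whether it comes last,
together with the first letters of the end columns.  These data determine the
numbers of letters in the columns up to a common summand, hence the length modulo
n + 1. *)
Definition altlabel l : pred (shape * I * I) := fun p =>
  [&& col p.1.2 == 0, col p.2 == n & l + triangle == weight p.1.1 %[mod n.+1]].

Definition altrel (p : shape * I * I) (r : seq I) : Prop :=
  [/\ altw n col r,
      forall k : 'I_n, p.1.1 k = (col (head x0 (F k r)) == k, col (last x0 (F k r)) == k),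
      head x0 (filter (fun i => col i == 0) r) = p.1.2 &
      head x0 (filter (fun i => col i == n) r) = p.2].

Lemma bitsE f (k : 'I_n) : bits f k = (f k).1 + (f k).2.
Proof. by rewrite /bits valK. Qed.

Lemma weightE f : weight f = \sum_(j < n) j.+1 * bits f j.
Proof. by apply: eq_bigr => j _; rewrite bitsE. Qed.

Lemma altrel_cnt p r k : altrel p r -> long n r -> k < n ->
  cnt col k r + 1 = cnt col k.+1 r + bits p.1.1 k.
Proof.
case=> ar pf _ _ lr kn; have := bitsE p.1.1 (Ordinal kn); rewrite /= => ->.
rewrite pf /=; have [e1 e2] := cntF col k r; rewrite -{1}e1 -e2 addnA.
apply: (alternating_count L); [exact: (ar.1 k kn) | exact: filter_all |].
have : 0 < cnt col k (F k r) by rewrite e1; apply: (altw_cnt_gt0 L) => //; exact: ltnW.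
by move/leq_trans; apply; exact: count_size.
Qed.

Lemma altrel_size p r : altrel p r -> long n r ->
  size r + triangle = n.+1 * cnt col n r + weight p.1.1.
Proof.
move=> pr lr; rewrite (size_cnt L) weightE.
by apply: (@endpoints_sum (fun k => cnt col k r)) => k; apply: altrel_cnt.
Qed.

Lemma cnt_head k r : 0 < cnt col k r -> col (head x0 (filter (fun i => col i == k) r)) = k.
Proof.
rewrite /cnt -size_filter; have := filter_all (fun i => col i == k) r.
by case: (filter _ _) => //= i s /andP[/eqP].
Qed.

Lemma alt_label r : altw n col r -> long n r ->
  exists2 p, altlabel (size r) p & altrel p r.
Proof.
move=> ar lr; pose f : shape :=
  [ffun k : 'I_n => (col (head x0 (F k r)) == k, col (last x0 (F k r)) == k)].
pose p := (f, head x0 (filter (fun i => col i == 0) r),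
              head x0 (filter (fun i => col i == n) r)).
have pr : altrel p r by split=> // k; rewrite ffunE.
exists p => //; rewrite /altlabel /= !cnt_head ?eqxx /=; last 2 first.
- exact: (altw_cnt_gt0 L).
- exact: (altw_cnt_gt0 L).
by rewrite (altrel_size pr lr) mulnC modnMDl.
Qed.

(** The label is read off the letters of two neighbouring columns, whose order is the
same in all equivalent words. *)
Lemma alt_inj p p' r r' : altrel p r -> altrel p' r' -> ceq m r r' -> p = p'.
Proof.
case: p p' => [[f i] j] [[f' i'] j'] [ar pf pi pj] [ar' pf' pi' pj'] rr' /=.
have Fe k : k < n -> F k r = F k r' by apply: (altw_filter L ar rr').
rewrite /= in pf pi pj pf' pi' pj'; congr (_, _, _).
- by apply/ffunP => k; rewrite pf pf' Fe.
- have e s : filter (fun i => col i == 0) s = filter (fun i => col i == 0) (F 0 s).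
    exact: filter_col_pair.
  by rewrite -pi -pi' (e r) (e r') Fe // ltnW.
- have e s : filter (fun i => col i == n) s = filter (fun i => col i == n) (F n.-1 s).
    by apply: filter_col_pair; lia.
  by rewrite -pj -pj' (e r) (e r') Fe //; lia.
Qed.

(** When the column has two letters they alternate, so the first one decides. *)
Lemma column_word_eq k s s' : k <= n ->
  all (fun i => col i == k) s -> all (fun i => col i == k) s' -> size s = size s' ->
  (colsize col k = 2 -> [/\ sorted (fun i j => i != j) s, sorted (fun i j => i != j) s' &
     head x0 s = head x0 s']) -> s = s'.
Proof.
move=> kn; have := ladder_size L kn; have [c1 _|c1 c12] := eqVneq (colsize col k) 1.
  elim: s s' => [|i s IH] [|i' s'] //= /andP[/eqP ik sk] /andP[/eqP ik' sk'] [sz] h.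
  have ii : i = i' by apply: (@col1_inj _ col); rewrite ik ?ik'.
  by rewrite ii; congr (_ :: _); apply: IH => // c2; rewrite c2 in c1.
move=> sk sk' sz []; first by lia.
case: s s' sk sk' sz => [|i s] [|i' s'] //= /andP[/eqP ik sk] /andP[_ sk'] [sz] so so' ii.
subst i'; congr (_ :: _); elim: s s' i ik sk sk' sz so so' => [|j s IH] [|j' s'] //= i ik.
move=> /andP[/eqP jk sk] /andP[/eqP jk' sk'] [sz] /andP[ij so] /andP[ij' so'].
have jj : j' = j.
  case: (@col2 _ _ _ _ L i j j') => //; rewrite ?ik ?jk //.
  by move=> e; move: ij'; rewrite e eqxx.
by subst j'; congr (_ :: _); apply: IH so so'.
Qed.

Lemma alternating_cols k w w' : sorted adjl w -> sorted adjl w' ->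
  all (colpair col k) w -> all (colpair col k) w' -> size w = size w' ->
  (col (head x0 w) == k) = (col (head x0 w') == k) -> map col w = map col w'.
Proof.
case: w w' => [|i w] [|i' w'] //= so so' /andP[ci cw] /andP[ci' cw'] [sz] ii.
have {ii ci ci'}ii : col i = col i' by move: ci ci' ii; rewrite /colpair; lia.
rewrite ii; congr (_ :: _); elim: w w' i i' ii so so' cw cw' sz => [|j w IH] [|j' w'] //=.
move=> i i' ii /andP[aij so] /andP[aij' so'] /andP[cj cw] /andP[cj' cw'] [sz].
have jj : col j = col j' by move: ii aij aij' cj cj'; rewrite /colpair /adj; lia.
by rewrite jj; congr (_ :: _); apply: IH so so' cw cw' sz.
Qed.

Lemma map_col_eq (w w' : seq I) : map col w = map col w' ->
  (forall k, filter (fun i => col i == k) w = filter (fun i => col i == k) w') -> w = w'.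
Proof.
elim: w w' => [|i w IH] [|i' w'] //= [ii cw] h.
have := h (col i); rewrite -ii eqxx => -[<- _]; congr (_ :: _); apply: IH cw _ => k.
by have := h k; rewrite -ii; case: ifP => // _ [].
Qed.

(** With the length the label determines the numbers of letters in the columns
(altrel_size, altrel_cnt), then the word on each column and on each pair of
neighbouring columns, and these determine the class. *)
Lemma alt_uniq p r r' : long n r -> size r = size r' -> altrel p r -> altrel p r' ->
  ceq m r r'.
Proof.
move=> lr sz pr pr'; have lr' : long n r' by rewrite /long -sz.
have cnte k : k <= n -> cnt col k r = cnt col k r'.
  move=> kn; rewrite -(subKn kn); have := leq_subr k n; elim: (n - k) => [|d IH] dn.
    have := altrel_size pr lr; have := altrel_size pr' lr'; rewrite sz subn0 => ->.
    by move/addIn/eqP; rewrite eqn_pmul2l // => /eqP.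
  have {}IH := IH (ltnW dn).
  have dn' : n - d.+1 < n by lia.
  have := altrel_cnt pr lr dn'; have := altrel_cnt pr' lr' dn'.
  by rewrite -subSn // subSS IH; lia.
have [ar pf pi pj] := pr; have [ar' pf' pi' pj'] := pr'.
have colf k : k <= n -> filter (fun i => col i == k) r = filter (fun i => col i == k) r'.
  move=> kn; apply: (@column_word_eq k) => //; try exact: filter_all.
    by rewrite !size_filter; apply: cnte.
  move=> c2; have ke : (k == 0) || (k == n).
    have := @ladder_inner _ _ _ _ L k; rewrite c2; lia.
  split; [exact: ar.2 | exact: ar'.2 |].
  by case/orP: ke => /eqP ->; rewrite ?pi ?pi' ?pj ?pj'.
have colf' k : filter (fun i => col i == k) r = filter (fun i => col i == k) r'.
  have [|kn] := leqP k n; first exact: colf.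
  have no s : filter (fun i => col i == k) s = [::].
    by apply/eqP; rewrite -(negbK (_ == _)) -has_filter; apply/hasPn => i _;
      have := ladder_le L i; lia.
  by rewrite !no.
have Fe k : k < n -> F k r = F k r'.
  move=> kn; apply: map_col_eq => [|l].
    apply: (@alternating_cols k); try exact: filter_all.
    - exact: (ar.1 k kn).
    - exact: (ar'.1 k kn).
    - have sF s : size (F k s) = cnt col k s + cnt col k.+1 s.
        rewrite size_filter /cnt -[RHS]subn0 -(count_predUI (fun i => col i == k)).
        rewrite [count (predI _ _) _](_ : _ = 0) ?addn0 ?subn0 //.
        by apply/eqP; rewrite -leqn0 leqNgt -has_count; apply/hasPn => i _ /=; lia.
      by rewrite !sF !cnte // ltnW.
    - by have := pf (Ordinal kn); rewrite (pf' (Ordinal kn)) => -[].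
  have fl s : filter (fun i => col i == l) (F k s) =
      if (l == k) || (l == k.+1) then filter (fun i => col i == l) s else [::].
    case: ifP => lk; first by rewrite -filter_col_pair.
    apply/eqP; rewrite -(negbK (_ == _)) -has_filter; apply/hasPn => i.
    by rewrite mem_filter /colpair => /andP[+ _]; lia.
  by rewrite !fl colf'.
apply: (ceq_proj (ladder_sym L)) => [i j|i].
  move=> /eqP; rewrite (ladder_commute L) negb_and !negbK => /orP[/eqP <-|aij].
    have pe s : filter (pred2 i i) s = filter (pred2 i i) (filter (fun k => col k == col i) s).
      rewrite -filter_predI; apply: eq_filter => k /=.
      by case: (eqVneq k i) => [->|]; rewrite ?eqxx.
    by rewrite pe colf' -pe.
  pose k := minn (col i) (col j).
  have kn : k < n by have := ladder_le L i; have := ladder_le L j; move: aij; rewrite /k /adj; lia.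
  have pe s : filter (pred2 i j) s = filter (pred2 i j) (F k s).
    rewrite -filter_predI; apply: eq_filter => l /=.
    have ik : colpair col k i by move: aij; rewrite /colpair /k /adj; lia.
    have jk : colpair col k j by move: aij; rewrite /colpair /k /adj; lia.
    by case: (eqVneq l i) => [->|_]; rewrite ?ik // ; case: (eqVneq l j) => [->|_]; rewrite ?jk.
  by rewrite pe (Fe k kn) -pe.
have ce s : count_mem i s = count_mem i (filter (fun k => col k == col i) s).
  by rewrite count_filter; apply: eq_count => k /=; case: (eqVneq k i) => [->|]; rewrite ?eqxx.
by rewrite ce colf' -ce.
Qed.
End AltLabels.

(** * Sums of periodic sequences *)

Section Periodic.
Variables (f : nat -> nat) (p : nat).
Hypothesis fp : forall x, f (x + p) = f x.

Lemma periodic_shift q : \sum_(l < p) f (q + l) = \sum_(l < p) f l.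
Proof.
elim: q => [|q IH]; first by apply: eq_bigr.
rewrite -IH; case: p fp => [|p'] fp'; first by rewrite !big_ord0.
rewrite big_ord_recr [RHS]big_ord_recl /= addn0 addnC addSnnS fp'; congr (_ + _).
by apply: eq_bigr => l _; rewrite /bump /= addSnnS.
Qed.

Lemma periodic_sum N k : \sum_(N <= l < N + k * p) f l = k * \sum_(l < p) f l.
Proof.
elim: k => [|k IH]; first by rewrite addn0 big_geq.
rewrite mulSnr addnA (big_cat_nat (n := N + k * p)) ?leq_addr //= IH mulSnr; congr (_ + _).
rewrite -{1}[N + k * p]add0n big_addn addKn big_mkord.
rewrite -(periodic_shift (N + k * p)); apply: eq_bigr => l _; congr f.
by rewrite addnC.
Qed.
End Periodic.

Lemma sum_congruent p c d : 0 < p -> \sum_(l < p) (c + l == d %[mod p] : nat) = 1.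
Proof.
move=> p0; rewrite (@periodic_shift (fun x => (x == d %[mod p] : nat)) p); last first.
  by move=> x; rewrite modnDr.
have dp : d %% p < p by rewrite ltn_mod.
rewrite (bigD1 (Ordinal dp)) //= modn_mod eqxx big1 // => i ne; apply/eqP; rewrite eqb0.
by apply: contra ne; rewrite modn_small // => /eqP e; apply/eqP/val_inj.
Qed.

Lemma all_alt (T : Type) (p : pred T) i j k : p i -> p j -> all p (alt i j k).
Proof. by elim: k i j => //= k IH i j pi pj; rewrite pi IH. Qed.

Lemma sorted_alt (T : eqType) (i j : T) k : i != j -> sorted (fun x y => x != y) (alt i j k).
Proof.
case: k => //= k; elim: k i j => //= k IH i j ij; rewrite ij IH //.
by rewrite eq_sym.
Qed.

Section AltExists.
Variables (I : finType) (m : I -> I -> nat) (n : nat) (col : I -> nat).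
Hypothesis L : ladder m n col.
Variable x0 : I.
Let ngt1 : 1 < n := ladder_n L.

Local Notation F := (fun k => filter (colpair col k)).
Local Notation adjl := (fun i j => adj (col i) (col j)).
Local Notation shape := {ffun 'I_n -> bool * bool}.

Lemma col_other i : exists2 i', col i' = col i & colsize col (col i) = 2 -> i != i'.
Proof.
have [c2|c2] := eqVneq (colsize col (col i)) 2; last by exists i => // c; rewrite c in c2.
have : 0 < #|[predD1 [pred j | col j == col i] & i]|.
  by have := cardD1 i [pred j | col j == col i]; rewrite inE eqxx;
    move: c2; rewrite /colsize => -> /=; case: #|_|.
by case/card_gt0P=> j; rewrite !inE => /andP[ji /eqP jc]; exists j; rewrite // eq_sym.
Qed.

Section Build.
Variables (f : shape) (i j : I) (c : nat -> nat).
Hypotheses (i0 : col i = 0) (jn : col j = n).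
Hypothesis c_bits : forall k, k < n -> c k + 1 = c k.+1 + bits f k.
Hypothesis c_gt0 : forall k, k <= n -> 0 < c k.

Lemma filter_le k (p : pred I) r : (forall x, p x -> col x <= k) ->
  filter p r = filter p (filter (fun x => col x <= k) r).
Proof.
move=> pk; rewrite -filter_predI; apply: eq_filter => x /=.
by case px: (p x) => //=; rewrite pk.
Qed.

(** The word is built column by column: the next column is interleaved with the
last one as prescribed by the label, and inserted into the word. *)
Lemma alt_build i' j' k : col i' = 0 -> col j' = n -> k <= n -> exists r,
  [/\ all (fun x => col x <= k) r,
      forall l, l <= k -> cnt col l r = c l,
      forall o : 'I_n, o < k -> sorted adjl (F o r) /\
        f o = (col (head x0 (F o r)) == o, col (last x0 (F o r)) == o),
      filter (fun x => col x == 0) r = alt i i' (c 0) &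
      k = n -> filter (fun x => col x == n) r = alt j j' (c n)].
Proof.
move=> i'0 j'n; elim: k => [|k IH] kn.
  have ai : all (fun x => col x == 0) (alt i i' (c 0)) by apply: all_alt; apply/eqP.
  exists (alt i i' (c 0)); split=> //.
  - by apply: sub_all ai => x /eqP ->.
  - move=> l; rewrite leqn0 => /eqP ->; rewrite /cnt; move: ai; rewrite all_count => /eqP ->.
    exact: size_alt.
  - exact/all_filterP.
  - by move=> n0; move: ngt1; rewrite -n0.
have [r [rk rc rF r0 _]] := IH (ltnW kn).
have [y [y' [yk y'k yn]]] : exists y y', [/\ col y = k.+1, col y' = k.+1 &
    k.+1 = n -> y = j /\ y' = j'].
  have [kn1|kn1] := eqVneq k.+1 n; first by exists j, j'; rewrite jn j'n -kn1.
  by have [y yk] := col_ex L kn; exists y, y; split=> // e; rewrite e eqxx in kn1.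
pose p x := col x == k; pose q x := col x == k.+1.
pose u := filter p r; pose v := alt y y' (c k.+1).
have pu : all p u by exact: filter_all.
have qv : all q v by apply: all_alt; rewrite /q ?yk ?y'k.
have su : size u = c k by rewrite size_filter; apply: rc.
have sv : size v = c k.+1 by exact: size_alt.
have pq x : p x -> ~~ q x by rewrite /p /q; lia.
have qp x : q x -> ~~ p x by rewrite /p /q; lia.
pose o := Ordinal kn; have cb := c_bits kn; rewrite (bitsE f o) in cb.
have uv0 : 0 < size u /\ 0 < size v by rewrite su sv !c_gt0 // ltnW.
have [w [pw qw aw sw fw]] : exists w, [/\ filter p w = u, filter q w = v,
    all (colpair col k) w, sorted adjl w &
    f o = (col (head x0 w) == k, col (last x0 w) == k)].
  have pqadj x z : p x -> q z -> adj (col x) (col z) && adj (col z) (col x).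
    by rewrite /p /q /adj; lia.
  have qpadj x z : q x -> p z -> adj (col x) (col z) && adj (col z) (col x).
    by rewrite /p /q /adj; lia.
  have hd s (P : pred I) : all P s -> 0 < size s -> P (head x0 s).
    by case: s => //= x s /andP[].
  case fo: (f o) cb => [b1 b2] /= cb; case: b1 cb {fo} => cb.
    exists (interleave u v).
    have szu : (size u == size v) || (size u == (size v).+1) by rewrite su sv; lia.
    have [h1 h2 h3] := interleave_filter pq pu qv szu; split=> //.
      exact: interleave_sorted pqadj pu qv.
    rewrite head_interleave [_ == _](hd _ p pu uv0.1); congr (_, _).
    have [l1 l2] := interleave_last x0 pu qv uv0.1.
    case: b2 cb => cb; first by apply/esym/l2; rewrite su sv; lia.
    by apply/esym/negbTE/qp/l1; rewrite su sv; lia.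
  exists (interleave v u).
  have szu : (size v == size u) || (size v == (size u).+1) by rewrite su sv; lia.
  have [h1 h2 h3] := interleave_filter qp qv pu szu; split=> //.
  - by apply: sub_all h3 => x /=; rewrite orbC.
  - exact: interleave_sorted qpadj qv pu.
  rewrite head_interleave (negbTE (qp _ (hd _ q qv uv0.2)) : (_ == _) = _); congr (_, _).
  have [l1 l2] := interleave_last x0 qv pu uv0.2.
  case: b2 cb => cb; first by apply/esym/l1; rewrite su sv; lia.
  by apply/esym/negbTE/qp/l2; rewrite su sv; lia.
have eru : filter (colpair col k) r = filter (fun x => col x <= k) w.
  have -> : filter (colpair col k) r = u.
    apply: eq_in_filter => x /(allP rk); rewrite /colpair /p; lia.
  by rewrite -pw; apply: eq_in_filter => x /(allP aw); rewrite /colpair /p; lia.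
have [s [s1 s2 s3]] := amalgam rk aw eru.
have fs l : l <= k -> filter (fun x => col x == l) s = filter (fun x => col x == l) r.
  by move=> lk; rewrite (@filter_le k) ?s1 // => x /eqP ->.
have fq : filter q s = v.
  by rewrite -qw -s2 -filter_predI; apply: eq_filter => x /=; rewrite /q /colpair; lia.
exists s; split.
- by apply: sub_all s3 => x; rewrite /colpair; lia.
- move=> l; rewrite leq_eqVlt ltnS => /orP[/eqP ->|lk].
    by rewrite -sv -fq size_filter.
  by rewrite -rc // /cnt -!size_filter fs.
- move=> o'; rewrite ltnS leq_eqVlt => /orP[/eqP e|ok].
    have -> : o' = o by apply: val_inj.
    by rewrite [F o s]s2.
  have -> : F o' s = F o' r.
    by rewrite /= (@filter_le k) ?s1 // => x; rewrite /colpair; lia.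
  exact: rF.
- by rewrite fs.
- by move=> kn1; have [<- <-] := yn kn1; rewrite -kn1.
Qed.
End Build.

Lemma bits_le2 (f : shape) k : bits f k <= 2.
Proof. by rewrite /bits; case: insub => // o; case: (f o) => [[] []]. Qed.

Lemma alt_exists l p : n.+1 * (2 ^ n.+1 + 6) < l -> @altlabel I n col l p ->
  exists r, [/\ fcw m r, size r = l & @altrel I n col x0 p r].
Proof.
case: p => [[f i] j] ll /and3P[/= /eqP i0 /eqP jn cong].
have tri : triangle n <= n * n.
  rewrite /triangle -[X in _ <= X * _]card_ord -sum_nat_const; apply: leq_sum => k _.
  exact: ltn_ord.
have wt : weight f <= 2 * triangle n.
  rewrite weightE mulnC /triangle big_distrl /=; apply: leq_sum => k _.
  by rewrite leq_mul2l bits_le2.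
have n2 := ltn_expl n (isT : 1 < 2).
have big : (n.+1) * n.+1 + weight f <= l + triangle n.
  have : n.+1 * (n.+1 + n) <= n.+1 * (2 ^ n.+1 + 6) by rewrite leq_mul2l expnS; lia.
  by move: tri wt; rewrite mulnDr => h1 h2 h3; nia.
pose cn := (l + triangle n - weight f) %/ n.+1.
have ecn : n.+1 * cn + weight f = l + triangle n.
  rewrite mulnC divnK ?subnK //; last by rewrite -eqn_mod_dvd //; lia.
  by lia.
have cn_gt : n < cn.
  by rewrite -(leq_pmul2l (ltn0Sn n)); lia.
pose c k := cn + \sum_(k <= h < n) bits f h - (n - k).
have c_bits k : k < n -> c k + 1 = c k.+1 + bits f k.
  by move=> kn; rewrite /c big_ltn //; lia.
have c_gt0 k : k <= n -> 0 < c k by move=> kn; rewrite /c; lia.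
have c_n : c n = cn by rewrite /c big_geq //; lia.
have [i' i'0 ii'] := col_other i; have [j' j'n jj'] := col_other j.
rewrite i0 in i'0 ii'; rewrite jn in j'n jj'.
have [r [rn rc rF r0 /(_ erefl) rjn]] :=
  alt_build i0 jn c_bits c_gt0 i'0 j'n (leqnn n).
have hd k : 0 < k -> forall x y : I, head x0 (alt x y k) = x by case: k.
have ar : altw n col r.
  split=> [k kn|k /orP[]/eqP -> c2]; first by have [] := rF (Ordinal kn) kn.
    by rewrite r0; apply: sorted_alt; apply: ii'.
  by rewrite rjn; apply: sorted_alt; apply: jj'.
exists r; split; first exact: (altw_fcw L).
  have := endpoints_sum c_bits; rewrite c_n -weightE ecn => /addIn <-.
  by rewrite (size_cnt L); apply: eq_bigr => k _; apply: rc; rewrite -ltnS.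
by split=> //= [k||]; [have [] := rF k (ltn_ord k)|rewrite r0 hd ?c_gt0|rewrite rjn hd ?c_gt0].
Qed.

(** Every shape is compatible with exactly one residue of the length modulo n + 1. *)
Lemma alt_card : \sum_(l < n.+1) #|@altlabel I n col l| = colsize col 0 * colsize col n * 4 ^ n.
Proof.
have e l : #|@altlabel I n col l| = colsize col 0 * colsize col n *
    \sum_(f : shape) (triangle n + l == weight f %[mod n.+1] : nat).
  have -> : #|@altlabel I n col l| =
      #|[predX [predX [pred f : shape | triangle n + l == weight f %[mod n.+1]] &
                [pred i | col i == 0]] & [pred j | col j == n]]|.
    by apply: eq_card => -[[f i] j]; rewrite !inE /altlabel unfold_in /= addnC; lia.
  rewrite !cardX -mulnA mulnC; congr (_ * _); rewrite -sum1_card big_mkcond.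
  by apply: eq_bigr => f _; rewrite inE; case: eqP.
under eq_bigr do rewrite e; rewrite -big_distrr exchange_big /=.
under eq_bigr do rewrite sum_congruent //.
by rewrite sum1_card card_ffun card_prod card_bool card_ord.
Qed.

Lemma alt_card_periodic l : #|@altlabel I n col (l + n.+1)| = #|@altlabel I n col l|.
Proof. by apply: eq_card => p; rewrite unfold_in /altlabel /= addnAC modnDr. Qed.
End AltExists.

(** * Counting zigzags *)

Section ZigzagCount.
Variables (I : finType) (m : I -> I -> nat) (n : nat) (col : I -> nat).
Hypothesis L : ladder m n col.
Variable x0 : I.
Let ngt1 : 1 < n := ladder_n L.
Let e0P : 0 < colsize col 0 <= 2 := ladder_size L (leq0n n).
Let enP : 0 < colsize col n <= 2 := ladder_size L (leqnn n).

Local Notation walk := (walk n (colsize col 0) (colsize col n)).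
Local Notation P := (zperiod n (colsize col 0) (colsize col n)).
Local Notation ztrack := (ztrack n col).
Local Notation zigzag := (zigzag n col).

Lemma period_gt0 : 0 < P. Proof. exact: zperiod_gt0. Qed.

(** Time q is the second of two consecutive steps in the same column: a zigzag
beginning at time q visits only one letter there, which may be either of the two. *)
Definition half q := walk (q + P.-1) == walk q.

Lemma half_succ q : half q.+1 = (walk q == walk q.+1).
Proof. by rewrite /half addSnnS prednK ?period_gt0 // walkDP. Qed.

Lemma half_mod q : half (q + P) = half q.
Proof. by rewrite /half addnAC !walkDP. Qed.

(** Where there is no choice the letter is set to x0, so that labels are unique. *)
Definition boundary q i := if half q then col i == walk q else i == x0.

(** The labels of the zigzags of length l: the time at which the walk is entered,
and the first and last letters where these are not determined. *)
Definition ziglabel l : pred ('I_P * I * I) := fun p =>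
  boundary p.1.1 p.1.2 && boundary (p.1.1 + l) p.2.

Definition zigrel (p : 'I_P * I * I) (z : seq I) : Prop :=
  [/\ zigzag p.1.1 z, boundary p.1.1 p.1.2, boundary (p.1.1 + size z) p.2,
      (half p.1.1 -> head x0 z = p.1.2) &
      (half (p.1.1 + size z) -> last x0 z = p.2)].

Lemma zigzag_mod q z : zigzag (q %% P) z = zigzag q z.
Proof. by rewrite /zigzag (ztrack_eqmod _ (modn_mod _ _)). Qed.

Lemma half_eqmod q q' : q = q' %[mod P] -> half q = half q'.
Proof.
move=> e; rewrite /half (walk_eqmod e); congr (_ == _).
by apply: walk_eqmod; rewrite -modnDml e modnDml.
Qed.

Lemma zigzag_head q z : 0 < size z -> zigzag q z -> col (head x0 z) = walk q.
Proof. by case: z => // i z _; rewrite zigzag_cons => /andP[/eqP]. Qed.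

Lemma zigzag_last q z : 0 < size z -> zigzag q z -> col (last x0 z) = walk (q + (size z).-1).
Proof.
case/lastP: z => // z i _ /andP[+ _].
by rewrite ztrack_rcons last_rcons size_rcons => /andP[_ /eqP].
Qed.

Lemma zig_label q z : 0 < size z -> zigzag q z ->
  exists2 p, ziglabel (size z) p & zigrel p z.
Proof.
move=> sz zz; have qP : q %% P < P by rewrite ltn_mod period_gt0.
pose i := if half q then head x0 z else x0.
pose j := if half (q + size z) then last x0 z else x0.
have e : q %% P + size z = q + size z %[mod P] by rewrite modnDml.
have bi : boundary (q %% P) i.
  rewrite /boundary (half_eqmod (modn_mod _ _)) walk_mod /i; case: (half q) => //.
  by rewrite (zigzag_head sz zz).
have bj : boundary (q %% P + size z) j.
  rewrite /boundary (half_eqmod e) (walk_eqmod e) /j; case h: (half _) => //.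
  rewrite (zigzag_last sz zz); move: h; case: (size z) sz => // k _.
  by rewrite addnS half_succ /= => /eqP ->.
exists (Ordinal qP, i, j); rewrite /ziglabel /= ?bi //.
split=> //=; first by rewrite zigzag_mod.
  by rewrite (half_eqmod (modn_mod _ _)) /i => ->.
by rewrite (half_eqmod e) /j => ->.
Qed.

(** The walk dictates the column of each letter, so there is a choice only in an end
column of two letters; a complete visit of it allows the two orders, which are
equivalent, and an incomplete one is at an end of the word. *)
Lemma zigzag_uniq q z z' : size z = size z' -> zigzag q z -> zigzag q z' ->
  (half q -> head x0 z = head x0 z') ->
  (half (q + size z) -> last x0 z = last x0 z') -> ceq m z z'.
Proof.
have [k] := ubnP (size z); elim: k z z' q => // k IH.
case=> [|i z] [|i' z'] // q; first by move=> *; exact: ceq_refl.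
rewrite ltnS => sk [sz]; rewrite !zigzag_cons => /and3P[/eqP ci iz zz] /and3P[/eqP ci' iz' zz'].
move=> hh hl; have [ii|ii] := eqVneq i i'.
  subst i'; apply: ceq_cons; apply: (IH z z' q.+1) => //.
    case: z z' sz iz iz' zz zz' {IH hl hh sk} => [|j z] [|j' z'] //= _ ij ij'.
    rewrite !zigzag_cons half_succ => /andP[/eqP cj _] /andP[/eqP cj' _] /eqP e.
    case: (@col2 _ _ _ _ L i j j' ij) => //; rewrite ?cj ?cj' ?ci // => e'.
    by rewrite e' eqxx in ij'.
  rewrite addSnnS => /hl /=; case: z z' sz {IH iz iz' zz zz' hh hl sk} => [|j z] [|j' z'] //.
have cii : col i = col i' by rewrite ci.
have [c2 ce] := col_pair L ii cii; rewrite ci in c2 ce.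
have nh : ~~ half q by apply/negP => /hh /= e; rewrite e eqxx in ii.
have flat : walk q = walk q.+1.
  have eP : (q + P.-1).+1 = q + P by rewrite -addnS prednK // period_gt0.
  have zq : walk (q + P.-1).+1 = walk q by rewrite eP walkDP.
  have zq1 : walk (q + P.-1).+2 = walk q.+1 by rewrite eP -addSn walkDP.
  have nl : ~~ lone col n (walk q) by rewrite /lone c2 andbF.
  have := walk_pair ngt1 e0P enP (p := q + P.-1) 0; rewrite zq zq1.
  case/(_ (walk_is_pair L ce nl)) => [[e _]|[-> //]].
  by move: nh; rewrite /half e eqxx.
have [_ next] := walk_flat ngt1 e0P enP flat.
case: z z' sz sk iz iz' zz zz' hh hl => [|j z] [|j' z'] //=.
  move=> _ _ _ _ _ _ _; rewrite addn1 half_succ flat eqxx => /(_ isT) e.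
  by rewrite e eqxx in ii.
move=> [sz] sk ij ij'; rewrite !zigzag_cons => /and3P[/eqP cj jz zz] /and3P[/eqP cj' jz' zz'].
move=> _ hl.
have ji' : j = i'.
  case: (@col2 _ _ _ _ L i i' j ii cii) => //; first by rewrite cj ci flat.
  by move=> e; rewrite e eqxx in ij.
have ji : j' = i.
  case: (@col2 _ _ _ _ L i i' j' ii cii) => //; first by rewrite cj' ci flat.
  by move=> e; rewrite e eqxx in ij'.
subst j j'; apply: (@ceq_trans _ _ _ (i' :: i :: z)).
  apply: (@ceq_swap2 _ _ [::]); apply/eqP; rewrite (ladder_commute L) ii cii /adj; lia.
do 2!apply: ceq_cons; apply: (IH z z' q.+2) => //.
- by rewrite ltnW.
- by rewrite half_succ eq_sym => /eqP.
- by rewrite !addSnnS => /hl; case: z z' sz {IH zz zz' jz jz' hl sk} => [|a z] [|a' z'].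
Qed.

Lemma zig_uniq p z z' : size z = size z' -> zigrel p z -> zigrel p z' -> ceq m z z'.
Proof.
move=> sz [zz _ _ h1 h2] [zz' _ _ h1' h2'].
apply: (zigzag_uniq sz zz zz') => [h|h]; first by rewrite h1 ?h1'.
by rewrite h2 // h2' -?sz.
Qed.

(** Leaving column 0 happens once in a period and thus fixes the phase of the walk. *)
Lemma walk_start r : walk r = 0 -> walk r.+1 = 1 -> r %% P = 0.
Proof.
rewrite -(walk_mod _ _ _ r) -(walk_mod _ _ _ r.+1) mod_succ //.
have := mod_lt ngt1 e0P enP r; move: (r %% P) => {}r rP.
have [r0|r0] := posnP r; first by rewrite r0.
have [rn|rn] := leqP r n; first by rewrite (walk_up ngt1 e0P enP) //; lia.
rewrite (walk_down ngt1 e0P enP) ?rn //; case: eqP => [_ _|r1].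
  by rewrite (walk_up ngt1 e0P enP).
by move=> z0; rewrite (walk_down ngt1 e0P enP); lia.
Qed.

Lemma ztrack_nth q z k : ztrack q z -> k < size z -> col (nth x0 z k) = walk (q + k).
Proof.
elim: z q k => //= i z IH q [|k] /andP[/eqP ci tz] kz; first by rewrite addn0.
by rewrite -addSnnS; apply: IH.
Qed.

Lemma zigzag_start q q' z : q < P -> q' < P -> P.+1 < size z -> ztrack q z -> ztrack q' z ->
  q = q'.
Proof.
move=> qP qP' sz tz tz'.
have h k : k < size z -> walk (q + k) = walk (q' + k).
  by move=> ks; rewrite -(ztrack_nth tz ks) -(ztrack_nth tz' ks).
have z0 : walk P = 0 by rewrite -[P]add0n walkDP walk_up.
have z1 : walk P.+1 = 1 by rewrite -[P]add0n -addSn walkDP walk_up // ltnW.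
have h1 := h (P - q); have h2 := h (P - q).+1.
rewrite !addnS subnKC ?(ltnW qP) // in h1 h2.
have {}h1 : walk (q' + (P - q)) = 0 by rewrite -h1 ?z0 //; lia.
have {}h2 : walk (q' + (P - q)).+1 = 1 by rewrite -h2 ?z1 //; lia.
have /eqP := walk_start h1 h2; rewrite -/(dvdn P _) => /dvdnP[[|[|k]]]; lia.
Qed.

(** The order of t and x is the same in all equivalent words. *)
Lemma ceq_head t t' x w w' : ceq m (t :: x :: w) (t' :: x :: w') ->
  adj (col t) (col x) -> t = t'.
Proof.
move=> zz' tx; apply/eqP/contraT => tt'.
have xt : x != t by apply: contraTneq tx => ->; rewrite /adj; lia.
have ncom (i j : I) : pred2 t x i -> pred2 t x j -> m i j <> 2.
  by move=> /pred2P[]-> /pred2P[]-> /eqP; rewrite (ladder_commute L) ?eqxx // ?(adj_sym (col x)) tx andbF.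
have := ceq_filter_eq ncom zz'; rewrite /= !eqxx orbT (eq_sym t') (negPf tt') /=.
by case: eqP => [_ [e]|_ [e]]; rewrite e eqxx in xt tt' *.
Qed.

Lemma boundary_eq q (h h' i i' : I) : boundary q i -> boundary q i' ->
  (half q -> h = i) -> (half q -> h' = i') -> (half q -> h = h') -> i = i'.
Proof.
rewrite /boundary; case: (half q) => [_ _ <- // <- // -> //|].
by move=> /eqP -> /eqP ->.
Qed.

(** The phase is determined by zigzag_start.  A letter chosen at the beginning comes
before a letter of the neighbouring column that does not commute with it, and is
visible in all equivalent words; the same holds at the end. *)
Lemma zig_inj p p' z z' : P.+1 < size z -> zigrel p z -> zigrel p' z' -> ceq m z z' -> p = p'.
Proof.
case: p p' => [[q i] j] [[q' i'] j'] sz [zz bi bj hi hj] [zz' bi' bj' hi' hj'] zz_.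
rewrite /= in zz bi bj hi hj zz' bi' bj' hi' hj'.
have zq' : zigzag q' z by rewrite (zigzag_ceq L _ zz_).
have ss := ceq_size zz_.
have qq : q = q'.
  apply: val_inj => /=; apply: (zigzag_start (ltn_ord q) (ltn_ord q') sz).
    by case/andP: zz.
  by case/andP: zq'.
subst q'; rewrite -ss in bj' hj'; have P0 := period_gt0.
have inner k l : k <> l -> adj (walk k) (walk l) -> colsize col (walk k) = 2 -> 0 < walk l < n.
  move=> _ a c2; have := walk_le ngt1 e0P enP k; have := walk_le ngt1 e0P enP l.
  have := @ladder_inner _ _ _ _ L (walk k); rewrite c2; move: a ngt1; rewrite /adj; lia.
congr (_, _, _).
  apply: (boundary_eq bi bi' hi hi'); rewrite /half => /eqP h.
  have eP : q + P = (q + P.-1).+1 by rewrite -addnS prednK.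
  have [c2 ne] := walk_flat ngt1 e0P enP (p := q + P.-1) (etrans h (etrans (esym (walkDP _ _ _ _)) (congr1 _ eP))).
  rewrite -eP -addSn !walkDP in ne; rewrite h in c2.
  have c2' : colsize col (walk q) = 2 by case: c2 => -[-> ->].
  case: z z' zz zz' zz_ sz {hi hj hi' hj' bj bj' ss zq'} => [|t [|x w]] // [|t' [|x' w']] //.
  - by move=> _ _ /ceq_size.
  - by move=> _ _ /ceq_size.
  rewrite /zigzag /= => /andP[/and3P[/eqP ct /eqP cx _] _] /andP[/and3P[/eqP ct' /eqP cx' _] _].
  have a : adj (walk q) (walk q.+1) by apply: walk_adj => //; apply/eqP => e; apply: ne.
  have xx : x' = x.
    by apply: (inner_inj L); rewrite cx' ?cx //; apply: inner a c2'; lia.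
  by subst x' => /ceq_head e _; apply: e; rewrite ct cx.
apply: (boundary_eq bj bj' hj hj') => h.
case/lastP: z zz zz_ sz bj h ss {hj hj' bj' zq' hi hi'} => // z t; rewrite size_rcons.
case/lastP: z => // z x zz zz_ sz bj h ss.
case/lastP: z' zz' zz_ ss => // z' t'; rewrite size_rcons.
case/lastP: z' => // z' x' zz' zz_ ss.
rewrite !size_rcons in ss h; case: ss => ss.
move: zz zz'; rewrite /zigzag !ztrack_rcons !size_rcons -ss.
move=> /andP[/andP[/andP[_ /eqP cx] /eqP ct] _] /andP[/andP[/andP[_ /eqP cx'] /eqP ct'] _].
rewrite !last_rcons; rewrite !addnS half_succ in h; rewrite !addnS in ct ct'.
set r := q + size z in cx ct cx' ct' h; move/eqP: h => h.
have a : adj (walk r) (walk r.+1).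
  apply: walk_adj => //; apply/eqP => e.
  by have [_] := walk_flat ngt1 e0P enP e; rewrite h.
have c2 : colsize col (walk r.+1) = 2.
  by have [[[-> ->]|[-> ->]] _] := walk_flat ngt1 e0P enP h.
have xx : x' = x.
  apply: (inner_inj L); rewrite cx' ?cx //; apply: (inner r.+1); rewrite // 1?adj_sym //.
  by lia.
subst x'; have := ceq_rev (ladder_sym L) zz_; rewrite !rev_rcons => /ceq_head; apply.
by rewrite ct cx adj_sym.
Qed.

Lemma zig_exists_from k q i : col i = walk q -> exists2 z, size z = k.+1 &
  zigzag q z /\ head x0 z = i.
Proof.
elim: k q i => [|k IH] q i ci; first by exists [:: i]; rewrite // zigzag_cons ci eqxx.
have [j cj ij] : exists2 j, col j = walk q.+1 & i != j.
  have [e|ne] := eqVneq (walk q) (walk q.+1); last first.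
    have [j cj] := col_ex L (walk_le ngt1 e0P enP q.+1); exists j => //.
    by apply: contraNneq ne => ij; rewrite -ci ij cj.
  have [j cj ij] := col_other col i; exists j; first by rewrite cj ci.
  by apply: ij; rewrite ci; have [[[-> ->]|[-> ->]] _] := walk_flat ngt1 e0P enP e.
have [z sz [zz hz]] := IH q.+1 j cj; exists (i :: z); first by rewrite /= sz.
split=> //; rewrite zigzag_cons ci eqxx zz andbT /=.
by case: z sz hz {zz} => //= _ z _ ->.
Qed.

Lemma zig_exists l p : 2 < l -> ziglabel l p -> exists z,
  [/\ fcw m z, size z = l & zigrel p z].
Proof.
case: p => [[q i] j] l2 /andP[/= bi bj].
have [i1 ci1 hi] : exists2 i1, col i1 = walk q & half q -> i1 = i.
  have [i1 ci1] := col_ex L (walk_le ngt1 e0P enP q).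
  move: bi; rewrite /boundary; case: (half q) => [/eqP ci|_]; first by exists i.
  by exists i1.
have [h|h] := boolP (half (q + l)); last first.
  have [z sz [zz hz]] := zig_exists_from l.-1 ci1; have {}sz : size z = l by lia.
  exists z; split=> //; first exact: zigzag_fcw zz.
  split=> //=; rewrite ?sz // ?hz //.
  by rewrite (negPf h).
have [z sz [zz hz]] := zig_exists_from l.-2 ci1; have {}sz : size z = l.-1 by lia.
have cj : col j = walk (q + l) by move: bj; rewrite /boundary h => /eqP.
have el : q + l = (q + l.-2).+2 by lia.
rewrite el half_succ in h; move/eqP: h => h.
have z0 : 0 < size z by lia.
have cl := zigzag_last z0 zz; rewrite sz in cl.
have lj : last x0 z != j.
  apply/eqP => e; have e' : walk (q + l.-2) = walk (q + l.-2).+1.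
    by rewrite -[RHS]/(walk _) h -el -cj -e cl.
  by have [_] := walk_flat ngt1 e0P enP e'; rewrite h.
have zzj : zigzag q (rcons z j).
  move: zz; rewrite /zigzag ztrack_rcons => /andP[-> so] /=.
  rewrite sz cj el (_ : q + l.-1 = (q + l.-2).+1) ?h ?eqxx /=; last by lia.
  by case: z sz so lj {hz z0 cl} => //= a z _ so lj; rewrite rcons_path so.
have szj : size (rcons z j) = l by rewrite size_rcons; lia.
exists (rcons z j); split=> //; first exact: zigzag_fcw zzj.
split=> //=; rewrite ?szj // ?last_rcons //.
by move=> hq; rewrite -(hi hq) -hz; case: z z0 {sz zz hz cl lj zzj szj}.
Qed.

(** The walk passes through column 0, either with two letters of column 0 in succession
or with a factor x t x, x in column 1; both break alternation. *)
Lemma zigzag_not_altw q z : P.+2 < size z -> zigzag q z -> ~ altw n col z.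
Proof.
move=> sz /andP[tz _] az; pose s := P - 1 - q %% P.
have qP := mod_lt ngt1 e0P enP q; have P0 := period_gt0.
have ss : s + 3 <= size z by rewrite /s; lia.
have es : q + s = P - 1 %[mod P] by rewrite -modnDml /s subnKC //; lia.
have [a [i [j [k [b [ez sa]]]]]] : exists a i j k b, z = a ++ [:: i, j, k & b] /\ size a = s.
  exists (take s z), (nth x0 z s), (nth x0 z s.+1), (nth x0 z s.+2), (drop s.+3 z).
  split; last by rewrite size_takel //; lia.
  by rewrite -!drop_nth ?cat_take_drop //; lia.
move: tz; rewrite ez ztrack_cat /= sa => /and5P[_ /eqP ci /eqP cj /eqP ck _].
have ePs c : walk (q + s + c) = walk (P - 1 + c).
  by apply: walk_eqmod; rewrite -modnDml es modnDml.
have zj : col j = 0.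
  by rewrite cj -addn1 ePs subnK // -[P]add0n walkDP walk_up.
have zk : col k = 1.
  rewrite ck -addn2 ePs; have -> : P - 1 + 2 = 1 + P by lia.
  by rewrite walkDP walk_up // ltnW.
have := walk_local ngt1 e0P enP (q + s); rewrite -ci -cj -ck zj zk /straight_or_turn /=.
rewrite (_ : 0 == n = false) ?andFb ?orbF; last by lia.
case: (colsize col 0 =P 1) => [c1|c2] h.
  have i1 : col i = 1 by lia.
  have ik : k = i by apply: (inner_inj L); rewrite zk ?i1.
  subst k; apply: (altw_no_iji (a := a) (i := i) (j := j) (b := b) L); rewrite ?i1 ?zj //.
  by rewrite -ez.
have i0 : col i = 0 by lia.
have n0 : 0 < n by exact: ltnW.
have := az.1 0 n0; rewrite ez filter_cat /= /colpair i0 zj /= => so.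
by have := sorted_mid so; rewrite i0 zj.
Qed.

(** * The number of zigzag labels *)

Definition nboundary q := #|boundary q|.

Lemma nboundaryE q : nboundary q = if half q then 2 else 1.
Proof.
rewrite /nboundary; case: ifP => h; last first.
  by rewrite (eq_card (B := pred1 x0)) ?card1 // => i; rewrite unfold_in /boundary h inE.
have eP : q + P = (q + P.-1).+1 by rewrite -addnS prednK // period_gt0.
have e : walk (q + P.-1) = walk (q + P.-1).+1 by rewrite -eP walkDP; apply/eqP.
have [c2 _] := walk_flat ngt1 e0P enP e; rewrite e -eP walkDP in c2.
rewrite (eq_card (B := [pred i | col i == walk q])) => [|i]; last first.
  by rewrite unfold_in /boundary h inE.
by rewrite -/(colsize col _); case: c2 => -[-> ->].
Qed.

Lemma nboundary_mod q : nboundary (q + P) = nboundary q.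
Proof. by rewrite !nboundaryE half_mod. Qed.

Lemma half_small q : q < P ->
  half q = (q == 0) && (colsize col 0 == 2) || (q == n.+1) && (colsize col n == 2).
Proof.
case: q => [_|q qP].
  rewrite /half add0n [walk 0](walk_up ngt1 e0P enP) // (walk_down ngt1 e0P enP).
    by rewrite /zperiod; lia.
  by rewrite prednK ?period_gt0 // leqnn andbT /zperiod; lia.
rewrite half_succ; have [qn|qn] := ltnP q n.
  by rewrite !(walk_up ngt1 e0P enP) //; lia.
have [e|e] := eqVneq q n.
  rewrite e (walk_up ngt1 e0P enP) // (walk_down ngt1 e0P enP); last by rewrite ltnSn /= -{1}e.
  have [E|E] : colsize col n = 1 \/ colsize col n = 2 by lia.
    by rewrite E; lia.
  by rewrite E; lia.
by rewrite !(walk_down ngt1 e0P enP); move: qP; rewrite /zperiod; lia.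
Qed.

(** The number of ways to enter the walk. *)
Definition nboundaries := P + (colsize col 0).-1 + (colsize col n).-1.

Lemma sum_nboundary : \sum_(q < P) nboundary q = nboundaries.
Proof.
have PnP : n.+1 < P by rewrite /zperiod; lia.
have E q : q < P -> nboundary q =
    1 + (colsize col 0).-1 * (q == 0) + (colsize col n).-1 * (q == n.+1).
  move=> qP; rewrite nboundaryE half_small //.
  have : colsize col n = 1 \/ colsize col n = 2 by lia.
  have : colsize col 0 = 1 \/ colsize col 0 = 2 by lia.
  by case=> -> [] ->; case: (eqVneq q 0) => q0; case: (eqVneq q n.+1) => q1 /=; lia.
have S c : c < P -> \sum_(q < P) (nat_of_ord q == c : nat) = 1.
  move=> cP; rewrite (bigD1 (Ordinal cP)) //= eqxx big1 // => q ne; apply/eqP; rewrite eqb0.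
  by apply: contra ne => /eqP e; apply/eqP/val_inj.
rewrite (eq_bigr (fun q : 'I_P => 1 + (colsize col 0).-1 * (q == 0 :> nat) +
    (colsize col n).-1 * (q == n.+1 :> nat))) => [|q _]; last exact: E.
rewrite !big_split /= sum1_card card_ord -!big_distrr /= !S ?period_gt0 //.
by rewrite !muln1.
Qed.

Lemma zig_card l : #|ziglabel l| = \sum_(q < P) nboundary q * nboundary (q + l).
Proof.
rewrite -sum1_card (partition_big (fun p : 'I_P * I * I => p.1.1) predT) //=.
apply: eq_bigr => q _; rewrite sum1_card /nboundary -cardX.
have inj : injective (fun ij : I * I => (q, ij.1, ij.2)) by move=> [i j] [i' j'] [-> ->].
rewrite -(card_image inj); apply: eq_card => -[[q' i] j].
apply/idP/imageP => [|[[i' j'] /= + [-> -> ->]]].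
  by rewrite unfold_in /= /ziglabel => /andP[/= b /eqP e]; exists (i, j); rewrite -?e.
by rewrite unfold_in /= => b; rewrite unfold_in /= eqxx andbT.
Qed.

Lemma zig_card_periodic l : #|ziglabel (l + P)| = #|ziglabel l|.
Proof. by rewrite !zig_card; apply: eq_bigr => q _; rewrite addnA nboundary_mod. Qed.

(** When the length runs over a period, so does the time of exit, whatever the time of
entrance. *)
Lemma zig_card_sum : \sum_(l < P) #|ziglabel l| = nboundaries ^ 2.
Proof.
under eq_bigr do rewrite zig_card; rewrite exchange_big /=.
under eq_bigr do rewrite -big_distrr /= (periodic_shift nboundary_mod) sum_nboundary.
by rewrite -big_distrl /= sum_nboundary.
Qed.
End ZigzagCount.

(** * The mean value *)

Section Mean.
Variables (I : finType) (m : I -> I -> nat) (n : nat) (col : I -> nat).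
Hypothesis L : ladder m n col.
Variables (W : groupType) (s : I -> W).
Hypothesis cox : coxeter_system m s.

Local Notation P := (zperiod n (colsize col 0) (colsize col n)).

Lemma fc_growth_long x0 l : n.+1 * (2 ^ n.+1 + 6) + P.+3 <= l ->
  fc_growth m s l = #|@altlabel I n col l| + #|@ziglabel I n col x0 l|.
Proof.
move=> ll; have la : n.+1 * (2 ^ n.+1 + 6) < l by lia.
have lz : P.+2 < l by lia.
pose T := ({ffun 'I_n -> bool * bool} * I * I + 'I_P * I * I)%type.
pose S : pred T := fun p =>
  match p with inl a => @altlabel I n col l a | inr b => @ziglabel I n col x0 l b end.
pose R (p : T) := match p with inl a => altrel col x0 a | inr b => zigrel x0 b end.
have disj (a : {ffun 'I_n -> bool * bool} * I * I) (b : 'I_P * I * I) r r' :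
    size r' = l -> altrel col x0 a r -> zigrel x0 b r' -> ~ ceq m r r'.
  move=> sr' [ar _ _ _] [zr _ _ _ _] rr'; have lr' : P.+2 < size r' by rewrite sr'.
  exact: (zigzag_not_altw L x0 lr' zr (altw_ceq L ar rr')).
rewrite (@fc_growth_card _ _ _ _ (ladder_sym L) (ladder_refl L) (ladder_off L) cox T S R l).
- rewrite -!sum1_card big_sumType /=; congr (_ + _).
- case=> [a|b] /= pS; first by apply: (alt_exists L).
  by apply: (zig_exists L) => //; lia.
- move=> r fr sr; have lr : long n r by rewrite /long sr.
  have [ar|[q [z [rz zz]]]] := classify L fr lr.
    have [a aS aR] := alt_label L x0 ar lr.
    exists (inl a), r; split=> //; last exact: ceq_refl.
    by rewrite -[_ \in _]/(@altlabel I n col l a) -sr.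
  have sz : size z = l by rewrite -(ceq_size rz).
  have z0 : 0 < size z by rewrite sz; lia.
  have [b bS bR] := zig_label L x0 z0 zz.
  exists (inr b), z; split=> //.
  by rewrite -[_ \in _]/(@ziglabel I n col x0 l b) -sz.
- case=> [a|b] r r' sr sr'; last by apply: (zig_uniq L); rewrite sr.
  by apply: (alt_uniq L); rewrite ?sr // /long sr.
- case=> [a|b] [a'|b'] r r' fr sr sr' h h' rr'.
  + by rewrite (alt_inj L h h' rr').
  + by case: (disj a b' r r').
  + by case: (disj a' b r' r) => //; apply: ceq_sym.
  + by rewrite (zig_inj L _ h h' rr') // sr ltnW.
Qed.

Import GRing.Theory Num.Theory.
Local Open Scope ring_scope.

(** The two counts have periods n + 1 and P; the mean is taken over the product of the
periods. *)
Theorem ladder_mean : has_mean_value (fc_growth m s)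
  ((colsize col 0 * colsize col n * 4 ^ n)%N%:R / n.+1%:R +
   (nboundaries n col ^ 2)%N%:R / P%:R).
Proof.
have [x0 _] := col_ex L (leq0n n).
pose N := (n.+1 * (2 ^ n.+1 + 6) + P.+3)%N.
have P0 : (0 < P)%N by apply: (period_gt0 L).
have pa := alt_card_periodic n col.
have pz := zig_card_periodic L x0.
have pm (f : nat -> nat) p k : (forall l, f (l + p) = f l)%N -> forall l, f (l + k * p)%N = f l.
  by move=> fp; elim: k => [|k IH] l; rewrite ?addn0 // mulSn addnA IH fp.
exists N, (n.+1 * P)%N; split.
- by rewrite muln_gt0 P0.
- move=> l Nl; rewrite !(fc_growth_long x0) //; last by rewrite (leq_trans Nl) ?leq_addr.
  by rewrite (pm _ _ _ pz) mulnC (pm _ _ _ pa).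
- have -> : (\sum_(N <= l < N + n.+1 * P) fc_growth m s l =
     P * (colsize col 0 * colsize col n * 4 ^ n) + n.+1 * nboundaries n col ^ 2)%N.
    rewrite (eq_big_nat _ _ (F2 := fun l => #|@altlabel I n col l| + #|@ziglabel I n col x0 l|)%N);
      last by move=> l /andP[Nl _]; apply: fc_growth_long.
    rewrite big_split /= (periodic_sum pz) (zig_card_sum L x0); congr (_ + _)%N.
    by rewrite mulnC (periodic_sum pa) (alt_card L).
  have n0 : n.+1%:R != 0 :> rat by rewrite pnatr_eq0.
  have P0' : P%:R != 0 :> rat by rewrite pnatr_eq0 -lt0n.
  have key (a b c d : rat) : a != 0 -> b != 0 -> c / a + d / b = (b * c + a * d) / (a * b).
    by move=> a0 b0; field; rewrite a0 b0.
  by rewrite key // -!natrM -natrD.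
Qed.
End Mean.

(** * The three affine families *)

Lemma colsize1 (I : finType) (col : I -> nat) k i : col i = k ->
  (forall j, col j = k -> j = i) -> colsize col k = 1.
Proof.
move=> ik ki; rewrite /colsize (eq_card (B := pred1 i)) ?card1 // => j; rewrite !inE.
by apply/eqP/eqP => [/ki|->].
Qed.

Lemma colsize2 (I : finType) (col : I -> nat) k i i' : i != i' -> col i = k -> col i' = k ->
  (forall j, col j = k -> j = i \/ j = i') -> colsize col k = 2.
Proof.
move=> ii ik ik' ki; rewrite /colsize (eq_card (B := pred2 i i')) ?card2 ?ii // => j.
rewrite !inE; apply/eqP/pred2P; first exact: ki.
by case=> ->.
Qed.

Section Families.
Variable n : nat.
Hypothesis ngt1 : 1 < n.

Definition colC (x : vertexC n) : nat :=
  match x with inl i => i.+1 | inr false => 0 | inr true => n end.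

Definition colB (x : vertexB n) : nat :=
  match x with inl i => i.+1 | inr (Some _) => 0 | inr None => n end.

Definition colD (x : vertexD n) : nat :=
  match x with inl i => i.+1 | inr (false, _) => 0 | inr (true, _) => n end.

Lemma ltn_inner (i : 'I_n.-1) : i.+1 < n.
Proof. by have := ltn_ord i; lia. Qed.

Lemma colC0 : colsize colC 0 = 1.
Proof. by apply: (@colsize1 _ _ _ (inr false)) => // -[i|[]] //=; lia. Qed.

Lemma colCn : colsize colC n = 1.
Proof.
by apply: (@colsize1 _ _ _ (inr true)) => // -[i|[]] //=; [have := ltn_inner i|]; lia.
Qed.

Lemma colB0 : colsize colB 0 = 2.
Proof.
apply: (@colsize2 _ _ _ (inr (Some false)) (inr (Some true))) => // -[i|[[]|]] //=.
- by right.
- by left.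
- by lia.
Qed.

Lemma colBn : colsize colB n = 1.
Proof.
by apply: (@colsize1 _ _ _ (inr None)) => // -[i|[[]|]] //=; [have := ltn_inner i| |]; lia.
Qed.

Lemma colD0 : colsize colD 0 = 2.
Proof.
apply: (@colsize2 _ _ _ (inr (false, false)) (inr (false, true))) => // -[i|[[] []]] //=.
- by lia.
- by lia.
- by right.
- by left.
Qed.

Lemma colDn : colsize colD n = 2.
Proof.
apply: (@colsize2 _ _ _ (inr (true, false)) (inr (true, true))) => // -[i|[[] []]] //=.
- by have := ltn_inner i; lia.
- by right.
- by left.
- by lia.
- by lia.
Qed.

Section Inner.
Variables (k : nat) (kn : 0 < k < n).

Lemma inner_ord : k.-1 < n.-1. Proof. by lia. Qed.

Lemma inner_eq (i : 'I_n.-1) : i.+1 = k -> i = Ordinal inner_ord.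
Proof. by move=> ik; apply: val_inj => /=; lia. Qed.

Lemma colC_inner : colsize colC k = 1.
Proof.
apply: (@colsize1 _ _ _ (inl (Ordinal inner_ord))) => [/=|[i|[]] /=]; try lia.
by move=> /inner_eq ->.
Qed.

Lemma colB_inner : colsize colB k = 1.
Proof.
apply: (@colsize1 _ _ _ (inl (Ordinal inner_ord))) => [/=|[i|[[]|]] /=]; try lia.
by move=> /inner_eq ->.
Qed.

Lemma colD_inner : colsize colD k = 1.
Proof.
apply: (@colsize1 _ _ _ (inl (Ordinal inner_ord))) => [/=|[i|[[] []]] /=]; try lia.
by move=> /inner_eq ->.
Qed.
End Inner.

Lemma colsizes (I : finType) (col : I -> nat) : 0 < colsize col 0 <= 2 ->
  0 < colsize col n <= 2 -> (forall k, 0 < k < n -> colsize col k = 1) ->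
  forall k, k <= n -> 0 < colsize col k <= 2.
Proof.
move=> c0 cn ci k kn; have [->//|k0] := posnP k.
by have [->//|kn'] := eqVneq k n; rewrite ci //; lia.
Qed.

Lemma spath_edgeE (i j : 'I_n.-1) :
  maxn (spath_edge i j) (spath_edge j i) = if adj i.+1 j.+1 then 3 else 2.
Proof. by rewrite /spath_edge /adj !eqSS; do 2!case: eqP. Qed.

Lemma lone_inner (I : finType) (col : I -> nat) (i : 'I_n.-1) : lone col n i.+1 = false.
Proof. by apply: inner_lone; exact: ltn_inner. Qed.

Lemma ladderC : ladder (@coxC n) n colC.
Proof.
split=> //.
- by case=> [i|[]] //=; exact: ltnW (ltn_inner i).
- by apply: colsizes; rewrite ?colC0 ?colCn //; exact: colC_inner.
- exact: colC_inner.
have l0 : lone colC n 0 by rewrite /lone colC0.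
have ln : lone colC n n by rewrite /lone colCn eqxx orbT.
move=> x y; rewrite /coxC /coxeter_matrix; case: eqP => // _.
case: x y => [i|[]] [j|[]] /=; rewrite ?lone_inner ?l0 ?ln ?orbT ?spath_edgeE //=.
all: try have := ltn_inner i.
all: try have := ltn_inner j.
all: by rewrite /adj; move=> *; repeat (case: ifP => ? /=); lia.
Qed.

Lemma ladderB : ladder (@coxB n) n colB.
Proof.
split=> //.
- by case=> [i|[[]|]] //=; exact: ltnW (ltn_inner i).
- by apply: colsizes; rewrite ?colB0 ?colBn //; exact: colB_inner.
- exact: colB_inner.
have l0 : lone colB n 0 = false by rewrite /lone colB0 andbF.
have ln : lone colB n n by rewrite /lone colBn eqxx orbT.
move=> x y; rewrite /coxB /coxeter_matrix; case: eqP => // _.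
case: x y => [i|[b|]] [j|[b'|]] /=; rewrite ?lone_inner ?l0 ?ln ?orbT ?spath_edgeE //=.
all: try have := ltn_inner i.
all: try have := ltn_inner j.
all: by rewrite /adj; move=> *; repeat (case: ifP => ? /=); lia.
Qed.

Lemma ladderD : ladder (@coxD n) n colD.
Proof.
split=> //.
- by case=> [i|[[] ?]] //=; exact: ltnW (ltn_inner i).
- by apply: colsizes; rewrite ?colD0 ?colDn //; exact: colD_inner.
- exact: colD_inner.
have l0 : lone colD n 0 = false by rewrite /lone colD0 andbF.
have ln : lone colD n n = false by rewrite /lone colDn andbF.
move=> x y; rewrite /coxD /coxeter_matrix; case: eqP => // _.
case: x y => [i|[[] b]] [j|[[] b']] /=; rewrite ?lone_inner ?l0 ?ln ?orbT ?spath_edgeE //=.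
all: try have := ltn_inner i.
all: try have := ltn_inner j.
all: by rewrite /adj; move=> *; repeat (case: ifP => ? /=); lia.
Qed.
End Families.

Import GRing.Theory Num.Theory.
Local Open Scope ring_scope.

Theorem proposition4p5 (n : nat) (hn : (2 <= n)%N) :
  [/\ forall (W : groupType) (s : vertexC n -> W),
        coxeter_system (@coxC n) s ->
        has_mean_value (fc_growth (@coxC n) s)
          (2 * n%:R + 4 ^+ n / n.+1%:R),
      forall (W : groupType) (s : vertexB n -> W),
        coxeter_system (@coxB n) s ->
        has_mean_value (fc_growth (@coxB n) s)
          (2 * n%:R + 3 + 1 / (2 * n + 1)%:R + 2 * 4 ^+ n / n.+1%:R)
    & forall (W : groupType) (s : vertexD n -> W),
        coxeter_system (@coxD n) s ->
        has_mean_value (fc_growth (@coxD n) s)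
          (2 * n%:R + 6 + (2 + 4 ^+ n.+1) / n.+1%:R)].
Proof.
have x0 : 0 < n%:R :> rat by rewrite ltr0n ltnW.
have neq0 (y : rat) : 0 < y -> y != 0 by move/lt0r_neq0.
split=> W s cox.
- have := ladder_mean (ladderC hn) cox; congr has_mean_value.
  rewrite /nboundaries (colC0 hn) (colCn hn) !mul1n !addn0.
  have -> : zperiod n 1 1 = (2 * n)%N by rewrite /zperiod; lia.
  rewrite !natrX !natrM -[n.+1]addn1 natrD.
  move: x0; move: n%:R (4%:R ^+ n) => x y x0.
  by field; rewrite !neq0 //; lra.
- have := ladder_mean (ladderB hn) cox; congr has_mean_value.
  rewrite /nboundaries (colB0 hn) (colBn hn) muln1 addn0 -[2.-1]/1%N.
  have -> : zperiod n 2 1 = (2 * n + 1)%N by rewrite /zperiod; lia.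
  rewrite !(natrX, natrM, natrD) -[n.+1]addn1 natrD.
  move: x0; move: n%:R (4%:R ^+ n) => x y x0.
  by field; rewrite !neq0 //; lra.
- have := ladder_mean (ladderD hn) cox; congr has_mean_value.
  rewrite /nboundaries (colD0 hn) (colDn hn) -[2.-1]/1%N.
  have -> : zperiod n 2 2 = (2 * (n + 1))%N by rewrite /zperiod; lia.
  rewrite [4 ^+ n.+1]exprS natrM !natrX; move: (4 ^+ n) => y.
  rewrite !(natrM, natrD) -[n.+1]addn1 natrD; move: x0; move: n%:R => x x0.
  by field; rewrite !neq0 //; lra.
Qed.
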